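(* \textsc{Diverse Minimum Cuts} can be solved in $|V|^{O(1)}$ time on instances with $\lambda(G)\le 2$.
   Context: Let $G=(V,E)$ be a graph. A cut of $G$ is a partition of $V$ into two nonempty sets $A,B$, identified with the edge set $E(A,B)$ of edges having one end in $A$ and the other in $B$; its size is $|E(A,B)|$. A minimum cut is a cut of minimum size, and $\lambda(G)$ denotes the size of a minimum cut of $G$. For $w\colon E\to\mathbb R_{\ge 0}$, $d_{\mathrm{sum}}(\{C_1,\dots,C_k\})=\sum_{1\le i<j\le k} w(C_i\triangle C_j)$ where $w(Z)=\sum_{e\in Z}w(e)$. \textsc{Diverse Minimum Cuts}: given $G$, $w\colon E\to\mathbb R_{\ge 0}$ and an integer $k$, find $k$ distinct minimum cuts $C_1,\dots,C_k$ of $G$ maximizing $d_{\mathrm{sum}}(\{C_1,\dots,C_k\})$ (or report that fewer than $k$ minimum cuts exist). *)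

(* Defs.v *)
From HB Require Import structures.
From mathcomp Require Import all_boot all_order all_algebra.
From mathcomp Require Import reals.

Set Implicit Arguments.
Unset Strict Implicit.
Unset Printing Implicit Defensive.

Import Order.TTheory GRing.Theory Num.Theory.

(** * Simple graphs and their minimum cuts *)

Record sgraph (V : finType) := SGraph {
  edges : {set {set V}};
  card_edge : forall e, e \in edges -> #|e| = 2 }.

Section Cuts.
Variables (V : finType) (G : sgraph V).

Definition edges_between (A B : {set V}) : {set {set V}} :=
  [set e in edges G | [exists x in A, exists y in B, e == [set x; y]]].

(* Cuts are identified with their edge sets, so two partitions with the same
   crossing edges (possible only if G is disconnected) are the same cut. *)
Definition cuts : {set {set {set V}}} :=
  [set C | [exists A : {set V}, exists B : {set V},
     [&& A :|: B == [set: V], [disjoint A & B], A != set0, B != set0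
       & C == edges_between A B]]].

Definition mincuts : {set {set {set V}}} :=
  [set C in cuts | [forall D in cuts, #|C| <= #|D|]].

(* The default value #|edges G| bounds the size of every cut, so it matters
   only if there is no cut at all, i.e. #|V| <= 1; then lambda = 0. *)
Definition lambda : nat := \big[minn/#|edges G|]_(C in cuts) #|C|.

Variables (R : realType) (w : {set V} -> R).

Definition weight (Z : {set {set V}}) : R := (\sum_(e in Z) w e)%R.

Definition symdiff (C D : {set {set V}}) := (C :\: D) :|: (D :\: C).

Definition dsum k (Cs : k.-tuple {set {set V}}) : R :=
  (\sum_(i < k) \sum_(j < k | (i < j)%N) weight (symdiff (tnth Cs i) (tnth Cs j)))%R.

Definition distinct_mincuts k (Cs : k.-tuple {set {set V}}) : Prop :=
  uniq Cs /\ {subset Cs <= mincuts}.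

Definition diverse_mincuts k (Cs : k.-tuple {set {set V}}) : Prop :=
  distinct_mincuts Cs /\
  forall Ds : k.-tuple {set {set V}},
    distinct_mincuts Ds -> (dsum Ds <= dsum Cs)%R.

End Cuts.

(** * Random access machine over the integers and the reals

    The machine has two infinite memories indexed by nat, one holding natural
    numbers and one holding reals, with indirect addressing. Every memory
    access, operation, comparison and constant has cost 1.

    Natural numbers are only added and subtracted, which prevents unit-cost
    arithmetic from building numbers of superpolynomial bit length. Reals are
    only moved, added, subtracted and compared: there are no real constants and
    no rounding. A bound on the cost is therefore also a bound for the usual
    real RAM and, up to a polynomial in the input bit length, for bit
    complexity when the weights are rational. *)

Inductive nexp :=
  | NConst of nat
  | NLoad of nexp
  | NAdd of nexp & nexp
  | NSub of nexp & nexp.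

Inductive rexp :=
  | RLoad of nexp
  | RAdd of rexp & rexp
  | RSub of rexp & rexp.

Inductive test :=
  | NLe of nexp & nexp
  | RLe of rexp & rexp.

Inductive cmd :=
  | Skip
  | NStore of nexp & nexp (* address, value *)
  | RStore of nexp & rexp (* address, value *)
  | Seq of cmd & cmd
  | If of test & cmd & cmd
  | While of test & cmd.

Fixpoint ncost (e : nexp) : nat :=
  match e with
  | NConst _ => 1
  | NLoad e => (ncost e).+1
  | NAdd e1 e2 | NSub e1 e2 => (ncost e1 + ncost e2).+1
  end.

Fixpoint rcost (e : rexp) : nat :=
  match e with
  | RLoad e => (ncost e).+1
  | RAdd e1 e2 | RSub e1 e2 => (rcost e1 + rcost e2).+1
  end.

Definition tcost (b : test) : nat :=
  match b with
  | NLe e1 e2 => (ncost e1 + ncost e2).+1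
  | RLe e1 e2 => (rcost e1 + rcost e2).+1
  end.

Section Semantics.
Variable R : realType.

Record state := State { nmem : nat -> nat; rmem : nat -> R }.

Fixpoint neval (s : state) (e : nexp) : nat :=
  match e with
  | NConst c => c
  | NLoad e => nmem s (neval s e)
  | NAdd e1 e2 => neval s e1 + neval s e2
  | NSub e1 e2 => neval s e1 - neval s e2
  end.

Fixpoint reval (s : state) (e : rexp) : R :=
  match e with
  | RLoad e => rmem s (neval s e)
  | RAdd e1 e2 => (reval s e1 + reval s e2)%R
  | RSub e1 e2 => (reval s e1 - reval s e2)%R
  end.

Definition teval (s : state) (b : test) : bool :=
  match b with
  | NLe e1 e2 => neval s e1 <= neval s e2
  | RLe e1 e2 => (reval s e1 <= reval s e2)%R
  end.

Definition update (T : Type) (m : nat -> T) (a : nat) (v : T) : nat -> T :=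
  fun a' => if a' == a then v else m a'.

(* exec c s t s': started in s, c halts in s' after t units of time. *)
Inductive exec : cmd -> state -> nat -> state -> Prop :=
  | exec_skip s : exec Skip s 1 s
  | exec_nstore s a e :
      exec (NStore a e) s (ncost a + ncost e).+1
        (State (update (nmem s) (neval s a) (neval s e)) (rmem s))
  | exec_rstore s a e :
      exec (RStore a e) s (ncost a + rcost e).+1
        (State (nmem s) (update (rmem s) (neval s a) (reval s e)))
  | exec_seq c1 c2 s1 s2 s3 t1 t2 :
      exec c1 s1 t1 s2 -> exec c2 s2 t2 s3 -> exec (Seq c1 c2) s1 (t1 + t2) s3
  | exec_if b c1 c2 s s' t :
      exec (if teval s b then c1 else c2) s t s' ->
      exec (If b c1 c2) s (tcost b + t) s'
  | exec_while_stop b c s :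
      ~~ teval s b -> exec (While b c) s (tcost b) s
  | exec_while_step b c s1 s2 s3 t1 t2 :
      teval s1 b -> exec c s1 t1 s2 -> exec (While b c) s2 t2 s3 ->
      exec (While b c) s1 (tcost b + t1 + t2) s3.

(** * Encoding of inputs and outputs *)

Variables (n : nat) (G : sgraph 'I_n) (w : {set 'I_n} -> R) (k : nat).

(* Row-major n x n matrix; entries outside the matrix are x0. *)
Definition matrix_mem (T : Type) (x0 : T) (F : 'I_n -> 'I_n -> T) : nat -> T :=
  fun a => if [pick p : 'I_n * 'I_n | p.1 * n + p.2 == a] is Some p
           then F p.1 p.2 else x0.

(* Natural memory: n, k, then the adjacency matrix. Real memory: the weight
   matrix, with 0 for non-edges. All other cells are 0. *)
Definition input_state : state :=
  State
    (fun a => match a with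
              | 0 => n
              | 1 => k
              | a'.+2 => matrix_mem 0 (fun i j => nat_of_bool ([set i; j] \in edges G)) a'
              end)
    (matrix_mem 0%R (fun i j => if [set i; j] \in edges G
                                then w [set i; j] else 0%R)).

(* Cell 0 tells whether k distinct minimum cuts exist; if so, cell 1 holds the
   address of a block of k adjacency matrices, one per cut. *)
Definition correct_output (s : state) : Prop :=
  (nmem s 0 = 0 /\ #|mincuts G| < k) \/
  (nmem s 0 = 1 /\
   exists2 Cs : k.-tuple {set {set 'I_n}}, diverse_mincuts G w Cs &
     forall (l : 'I_k) (i j : 'I_n),
       nmem s (nmem s 1 + ((l * n + i) * n + j)) =
         nat_of_bool ([set i; j] \in tnth Cs l)).

End Semantics.

(* Main.v *)
Require Import Defs.
From mathcomp Require Import all_boot all_order all_algebra.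
From mathcomp Require Import reals.
From mathcomp Require Import boolp zify ring lra.

(** A minimum cut with at most two edges is determined by a pair of codes: the two
    edges, a bridge and a dummy, or two dummies for the empty cut. If [x a] is the
    number of chosen cuts containing the edge [a], the diversity of [k] cuts is the
    sum of [w a * x a * (k - x a)]. So one has to choose [k] edges in an auxiliary
    graph [H] on the codes maximizing a separable concave function of the degrees.
    An optimal set of [p] edges of any graph can be improved to an optimal set of
    [p + 1] edges whose degrees differ by increments at two, possibly equal,
    vertices: take an alternating walk in the symmetric difference with an optimal
    set of [p + 1] edges. Since the symmetric difference of two cuts is a cut, [H]
    is a disjoint union of cliques, where the algorithm of Havel and Hakimi decides
    whether given degrees are realizable and realizes them. Hence [k] rounds, each
    trying all increments at two vertices, solve the problem.

    The machine program is written in a language whose loops all have length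
    [n ^ c] for a constant [c]. The candidate increments of one round are handled
    in parallel, by tables indexed by the candidate. *)

Set Implicit Arguments.
Unset Strict Implicit.
Unset Printing Implicit Defensive.

Import Order.TTheory GRing.Theory Num.Theory.

(** * A bounded-loop language compiled to the machine *)

(** With dummies of weight 0, minimum cuts of sizes 0, 1 and 2 all become edges of one graph on the
    [n ^ 2] codes, and the optimization needs no case distinction. A round recomputes its edge set
    instead of extending the old one: the alternating walk may remove edges chosen before, and a
    candidate prescribes degrees only. Deciding whether a graph has a subgraph with given degrees is
    a matching problem in general; the cliques are what lets a simple greedy construction suffice.
    The objective [x (k - x)] contains the final [k] in every round. This is harmless since the
    exchange argument uses only concavity, so the optima for fewer than [k] edges are mere stepping
    stones. One program serves all [n] on a machine without multiplication, so products, including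
    those of weights by integers, are repeated additions. *)

Definition upd T (m : nat -> nat -> T) q i v : nat -> nat -> T :=
  fun q' i' => if (q' == q) && (i' == i) then v else m q' i'.

Lemma upd_same T (m : nat -> nat -> T) q i v : upd m q i v q i = v.
Proof. by rewrite /upd !eqxx. Qed.

Lemma upd_neq T (m : nat -> nat -> T) q i v q' i' :
  (q' != q) || (i' != i) -> upd m q i v q' i' = m q' i'.
Proof. by rewrite /upd; case: eqP => //= _ /negbTE ->. Qed.

Lemma upd_id T (m : nat -> nat -> T) q i v : m q i = v -> upd m q i v = m.
Proof.
move=> <-; apply/funext => q'; apply/funext => i'; rewrite /upd.
by case: eqP => //= ->; case: eqP => //= ->.
Qed.

Ltac upds := rewrite /=; repeat first [ rewrite upd_same
  | rewrite upd_neq; last first; [by [] || by apply/orP; right; lia|] ].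

(** Names of the arrays of natural numbers. There is a single array of reals. *)
Inductive arr := AR | AT | AF | AD | AP | AS | AOk | ABest | ACnt | AOut | AAns | ALen.

Definition cls (q : arr) : nat :=
  match q with
  | AR => 2 | AT => 3 | AF => 4 | AD => 5 | AP => 6 | AS => 7 | AOk => 8
  | ABest => 9 | ACnt => 10 | AOut => 11 | AAns => 12 | ALen => 13
  end.

(** All loops run a fixed power of the input [n] many times: the cost of a
    program is then polynomial whatever values it computes. The exponent comes
    just before the bound variable in [XSum], [RSum], [Tab] and [RTab]. [XMul c]
    and [XDiv c] also loop, and are exact only when the left factor, resp. the
    quotient, is at most [n ^ c]. [XI] reads the adjacency matrix, [RI] the weight matrix, and [XObj] compares
    two entries of the array of reals. *)
Inductive nx :=
  | XC of nat
  | XN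
  | XK
  | XV of nat
  | XA of arr & nx
  | XI of nx
  | XAdd of nx & nx
  | XSub of nx & nx
  | XMul of nat & nx & nx
  | XDiv of nat & nx & nx
  | XLe of nx & nx
  | XObj of nx & nx
  | XIf of nx & nx & nx
  | XSum of nat & nat & nx.

Inductive rx :=
  | RI of nx
  | RSum of nat & nat & nx & rx.

(** [Tab] and [RTab] tabulate an expression: all entries are computed from the
    old state. *)
Inductive stmt :=
  | Tab of arr & nat & nat & nx
  | RTab of nat & nat & rx
  | Rep of nat & stmt
  | SSeq of stmt & stmt.

Section Machine.
Variables (R : realType) (n k B : nat) (low : nat -> nat) (rlow : nat -> R).
Hypotheses (low0 : low 0 = n) (low1 : low 1 = k) (low2 : low 2 = B) (B2 : 2 < B).

Notation mem := (nat -> nat -> nat).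
Notation rmemo := (nat -> nat -> R).
Notation st := (mem * rmemo)%type.

(** The input below address [B], in [low] and [rlow], is never modified; reading
    outside of it gives 0. *)
Definition inp a := if a.+2 < B then low a.+2 else 0.
Definition winp a : R := if a < B then rlow a else 0%R.

Fixpoint nx_eval (m : mem) (o : nat -> R) (e : nx) : nat :=
  match e with
  | XC c => c
  | XN => n
  | XK => k
  | XV x => m 1 x
  | XA q e => m (cls q) (nx_eval m o e)
  | XI e => inp (nx_eval m o e)
  | XAdd e1 e2 => nx_eval m o e1 + nx_eval m o e2
  | XSub e1 e2 => nx_eval m o e1 - nx_eval m o e2
  | XMul c e1 e2 => minn (nx_eval m o e1) (n ^ c) * nx_eval m o e2
  | XDiv c e1 e2 => \sum_(i < n ^ c) (i.+1 * nx_eval m o e2 <= nx_eval m o e1)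
  | XLe e1 e2 => nx_eval m o e1 <= nx_eval m o e2
  | XObj e1 e2 => (o (nx_eval m o e1) <= o (nx_eval m o e2))%R
  | XIf e1 e2 e3 => if nx_eval m o e1 != 0 then nx_eval m o e2 else nx_eval m o e3
  | XSum c x e => \sum_(i < n ^ c) nx_eval (upd m 1 x i) o e
  end.

Fixpoint rx_eval (m : mem) (o : nat -> R) (e : rx) : R :=
  match e with
  | RI e => winp (nx_eval m o e)
  | RSum c x g e =>
    (\sum_(i < n ^ c | nx_eval (upd m 1 x i) o g != 0)
       rx_eval (upd m 1 x i) o e)%R
  end.

Fixpoint run (c : stmt) (s : st) : st :=
  match c with
  | Tab q c x e =>
    (fun q' a => if (q' == cls q) && (a < n ^ c) then nx_eval (upd s.1 1 x a) (s.2 1) e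
                 else s.1 q' a, s.2)
  | RTab c x e =>
    (s.1, fun q' a => if (q' == 1) && (a < n ^ c) then rx_eval (upd s.1 1 x a) (s.2 1) e
                      else s.2 q' a)
  | Rep c b => iter (n ^ c) (run b) s
  | SSeq c1 c2 => run c2 (run c1 s)
  end.

(** * Compilation *)

(** Cell [i] of class [q] is stored at address [B + 16 * i + q]. Class 0 holds the
    registers, class 1 the loop variables, class 15 a temporary array, and the
    classes in between the named arrays. In the memory of reals, class 1 is the
    array and class 2 the temporary one. *)
Definition conc (s : st) : state R :=
  State (fun a => if a < B then low a else s.1 ((a - B) %% 16) ((a - B) %/ 16))
        (fun a => if a < B then rlow a else s.2 ((a - B) %% 16) ((a - B) %/ 16)).

Definition base := NLoad (NConst 2).
Definition cell q i := NAdd base (NConst (16 * i + q)).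
(** The machine does not multiply, so the expression is doubled four times. This evaluates [e]
    sixteen times, at constant cost because [e] is only ever the load of a fixed cell. *)
Definition x16 e := let f e := NAdd e e in f (f (f (f e))).
Definition dyn q e := NAdd base (NAdd (x16 e) (NConst q)).

Definition runs c T (s s' : st) := exists2 t, t <= T & exec c (conc s) t (conc s').

Lemma runs_le c T T' s s' : T <= T' -> runs c T s s' -> runs c T' s s'.
Proof. by move=> TT' [t tT ex]; exists t => //; apply: leq_trans TT'. Qed.

Lemma runs_seq c1 c2 T1 T2 s1 s2 s3 :
  runs c1 T1 s1 s2 -> runs c2 T2 s2 s3 -> runs (Seq c1 c2) (T1 + T2) s1 s3.
Proof.
move=> [t1 le1 ex1] [t2 le2 ex2]; exists (t1 + t2); first exact: leq_add.
exact: exec_seq ex1 ex2.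
Qed.

Lemma runs_if b c1 c2 T s s' :
  runs (if teval (conc s) b then c1 else c2) T s s' ->
  runs (If b c1 c2) (tcost b + T) s s'.
Proof.
move=> [t le ex]; exists (tcost b + t); first by rewrite leq_add2l.
exact: exec_if ex.
Qed.

Lemma runs_skip s : runs Skip 1 s s.
Proof. by exists 1 => //; apply: exec_skip. Qed.

Lemma addr_mod q i : q < 16 -> (16 * i + q) %% 16 = q.
Proof. by move=> q16; rewrite mulnC modnMDl modn_small. Qed.

Lemma addr_div q i : q < 16 -> (16 * i + q) %/ 16 = i.
Proof. by move=> q16; rewrite mulnC divnMDl // divn_small // addn0. Qed.

Lemma update_conc T (m : nat -> nat -> T) (l : nat -> T) q i v : q < 16 ->
  update (fun a => if a < B then l a else m ((a - B) %% 16) ((a - B) %/ 16))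
    (B + (16 * i + q)) v =
  (fun a => if a < B then l a else upd m q i v ((a - B) %% 16) ((a - B) %/ 16)).
Proof.
move=> q16; apply/funext => a; rewrite /update /upd.
case: eqP => [->|ne].
  by rewrite ltnNge leq_addr /= addKn addr_mod // addr_div // !eqxx.
case: ltnP => // Ba; case: eqP => //= e1; case: eqP => //= e2.
by case: ne; rewrite -(subnKC Ba) {1}(divn_eq (a - B) 16) e1 e2 mulnC.
Qed.

Lemma neval_base s : neval (conc s) base = B.
Proof. by rewrite /= B2 low2. Qed.

Lemma neval_cell s q i : neval (conc s) (cell q i) = B + (16 * i + q).
Proof.
have -> : neval (conc s) (cell q i) = neval (conc s) base + (16 * i + q) by [].
by rewrite neval_base.
Qed.

Lemma neval_dyn s q e : neval (conc s) (dyn q e) = B + (16 * neval (conc s) e + q).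
Proof.
have -> : neval (conc s) (dyn q e) =
  neval (conc s) base + (neval (conc s) (x16 e) + q) by [].
rewrite neval_base; congr (_ + (_ + _)) => /=; lia.
Qed.

Lemma conc_nmem s q i : q < 16 -> nmem (conc s) (B + (16 * i + q)) = s.1 q i.
Proof. by move=> q16; rewrite /= ltnNge leq_addr /= addKn addr_mod // addr_div. Qed.

Lemma conc_rmem s q i : q < 16 -> rmem (conc s) (B + (16 * i + q)) = s.2 q i.
Proof. by move=> q16; rewrite /= ltnNge leq_addr /= addKn addr_mod // addr_div. Qed.

Lemma neval_ld s q i : q < 16 -> neval (conc s) (NLoad (cell q i)) = s.1 q i.
Proof.
by move=> q16; rewrite -(conc_nmem s i q16) -(neval_cell s).
Qed.

Lemma neval_dynld s q e : q < 16 ->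
  neval (conc s) (NLoad (dyn q e)) = s.1 q (neval (conc s) e).
Proof.
by move=> q16; rewrite -(conc_nmem s _ q16) -(neval_dyn s).
Qed.

Lemma reval_ld s q i : q < 16 -> reval (conc s) (RLoad (cell q i)) = s.2 q i.
Proof.
by move=> q16; rewrite -(conc_rmem s i q16) -(neval_cell s).
Qed.

Lemma reval_dynld s q e : q < 16 ->
  reval (conc s) (RLoad (dyn q e)) = s.2 q (neval (conc s) e).
Proof.
by move=> q16; rewrite -(conc_rmem s _ q16) -(neval_dyn s).
Qed.

Lemma runs_store a e s q i v T : q < 16 ->
  neval (conc s) a = B + (16 * i + q) -> neval (conc s) e = v ->
  ncost a + ncost e < T ->
  runs (NStore a e) T s (upd s.1 q i v, s.2).
Proof.
move=> q16 ea ev leT; exists (ncost a + ncost e).+1 => //.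
have := exec_nstore (conc s) a e; rewrite ea ev /conc.
by rewrite (update_conc s.1 low i v q16).
Qed.

Lemma runs_rstore a e s q i v T : q < 16 ->
  neval (conc s) a = B + (16 * i + q) -> reval (conc s) e = v ->
  ncost a + rcost e < T ->
  runs (RStore a e) T s (s.1, upd s.2 q i v).
Proof.
move=> q16 ea ev leT; exists (ncost a + rcost e).+1 => //.
have := exec_rstore (conc s) a e; rewrite ea ev /conc.
by rewrite (update_conc s.2 rlow i v q16).
Qed.

(** A generous bound for any single command emitted by the compiler. The most expensive ones contain
    two copies of [dyn], each costing about 100 because of [x16]. *)
Definition step_cost := 1000.

Definition set_cell q i e := NStore (cell q i) e.

Lemma runs_set q i e s v : q < 16 -> neval (conc s) e = v -> ncost e < 900 ->
  runs (set_cell q i e) step_cost s (upd s.1 q i v, s.2).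
Proof.
move=> q16 ev le; apply: runs_store (ev) _ => //; first exact: neval_cell.
by rewrite /= /step_cost; lia.
Qed.

(** [c] nested loops of length [n], with counters in the registers [d], ...,
    [d + c - 1], run [body] [n ^ c] times without computing [n ^ c]. *)
Fixpoint loop d c body :=
  match c with
  | 0 => body
  | c'.+1 =>
    Seq (set_cell 0 d (NConst 0))
        (While (NLe (NAdd (NLoad (cell 0 d)) (NConst 1)) (NLoad (NConst 0)))
           (Seq (loop d.+1 c' body)
                (set_cell 0 d (NAdd (NLoad (cell 0 d)) (NConst 1)))))
  end.

Fixpoint lcost c T :=
  match c with
  | 0 => T
  | c'.+1 => 2 * step_cost + n * (lcost c' T + 2 * step_cost)
  end.

Lemma runs_while_stop b c s : ~~ teval (conc s) b -> runs (While b c) (tcost b) s s.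
Proof. by move=> nb; exists (tcost b) => //; apply: exec_while_stop. Qed.

Lemma runs_while_step b c s s1 s2 T1 T2 : teval (conc s) b ->
  runs c T1 s s1 -> runs (While b c) T2 s1 s2 ->
  runs (While b c) (tcost b + T1 + T2) s s2.
Proof.
move=> tb [t1 l1 e1] [t2 l2 e2]; exists (tcost b + t1 + t2).
  by rewrite !leq_add.
exact: exec_while_step e1 e2.
Qed.

(** The nested loops act as one loop of length [n ^ c] whose invariant is indexed by the number of
    runs of the body. The counters change between those runs, so the invariant must be stable under
    writing to them. The bound [lo] lets a caller keep live values in the registers from [lo] to
    [d]. *)
Lemma loopP lo c d body T (I : nat -> st -> Prop) s : lo <= d ->
  (forall j s, j < n ^ c -> I j s -> exists s',
     [/\ runs body T s s', I j.+1 s'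
       & forall i, lo <= i < d + c -> s'.1 0 i = s.1 0 i]) ->
  (forall j s i v, d <= i < d + c -> I j s -> I j (upd s.1 0 i v, s.2)) ->
  I 0 s -> exists s',
    [/\ runs (loop d c body) (lcost c T) s s', I (n ^ c) s'
      & forall i, lo <= i < d -> s'.1 0 i = s.1 0 i].
Proof.
elim: c d I s => [|c IH] d I s lod step stab I0.
  have [|s' [r I1 pr]] := step 0 s _ I0; first by rewrite expn0.
  by exists s'; rewrite expn0; split => // i id; apply: pr; rewrite addn0.
have dstab j s0 v : I j s0 -> I j (upd s0.1 0 d v, s0.2).
  by move=> Ij; apply: stab => //; rewrite leqnn addnS ltnS leq_addr.
pose b := NLe (NAdd (NLoad (cell 0 d)) (NConst 1)) (NLoad (NConst 0)).
pose bd := Seq (loop d.+1 c body) (set_cell 0 d (NAdd (NLoad (cell 0 d)) (NConst 1))).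
have tb s0 : teval (conc s0) b = (s0.1 0 d < n).
  have -> : teval (conc s0) b =
     (neval (conc s0) (NLoad (cell 0 d)) + 1 <= neval (conc s0) (NLoad (NConst 0))).
    by [].
  rewrite neval_ld // addn1; congr (_ < _); rewrite /= low0.
  by rewrite (leq_trans _ B2).
have W m s0 : s0.1 0 d + m = n -> I (s0.1 0 d * n ^ c) s0 ->
  exists s', [/\ runs (While b bd) (step_cost + m * (lcost c T + 2 * step_cost)) s0 s',
   I (n ^ c.+1) s' & forall i, lo <= i < d -> s'.1 0 i = s0.1 0 i].
  elim: m s0 => [|m IHm] s0 em I0'.
    exists s0; split => //.
      apply: runs_le (runs_while_stop _ _) => //.
      by rewrite tb -em addn0 ltnn.
    by rewrite expnS -em addn0 in I0' *.
  have lt : s0.1 0 d < n by rewrite -em; lia.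
  (* The inner loops use the invariant shifted by the runs that the earlier outer iterations have
     completed. *)
  have [|||s1 [r1 I1 p1]] := IH d.+1 (fun j s1 => I (s0.1 0 d * n ^ c + j) s1) s0 (leqW lod).
  - move=> j s1 jc Ij; have [|s2 [r2 I2 p2]] := step _ _ _ Ij.
      rewrite expnS; apply: leq_trans (_ : (s0.1 0 d).+1 * n ^ c <= _).
        by rewrite mulSn [n ^ c + _]addnC ltn_add2l.
      by rewrite leq_pmul2r // (leq_ltn_trans _ jc).
    by exists s2; rewrite addnS; split => // i; rewrite addSnnS; apply: p2.
  - move=> j s1 i v /andP[di id]; apply: stab.
    by rewrite (ltnW di) /= -addSnnS.
  - by rewrite addn0.
  pose s2 : st := (upd s1.1 0 d (s0.1 0 d).+1, s1.2).
  have r2 : runs (set_cell 0 d (NAdd (NLoad (cell 0 d)) (NConst 1))) step_cost s1 s2.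
    apply: runs_set => //.
    have -> : neval (conc s1) (NAdd (NLoad (cell 0 d)) (NConst 1))
       = neval (conc s1) (NLoad (cell 0 d)) + 1 by [].
    by rewrite neval_ld // addn1 p1 // lod leqnn.
  have e2 : s2.1 0 d = (s0.1 0 d).+1 by rewrite /s2 /= upd_same.
  have [||s3 [r3 I3 p3]] := IHm s2.
  - by rewrite e2 -em addSnnS.
  - by rewrite e2 mulSn addnC; apply: dstab.
  exists s3; split => //.
    apply: runs_le (runs_while_step _ (runs_seq r1 r2) r3); last by rewrite tb.
    rewrite mulSn; have : tcost b <= step_cost by []. lia.
  move=> i id; rewrite p3 // /s2 /= upd_neq ?p1 //; first by lia.
  by apply/orP; right; lia.
have r0 : runs (set_cell 0 d (NConst 0)) step_cost s (upd s.1 0 d 0, s.2) by exact: runs_set.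
have [||s' [r I1 pr]] := W n (upd s.1 0 d 0, s.2).
- by rewrite /= upd_same.
- by rewrite /= upd_same mul0n; apply: dstab.
exists s'; split => //.
  apply: runs_le (runs_seq r0 r) => /=; lia.
move=> i id; rewrite pr //= upd_neq //.
by apply/orP; right; lia.
Qed.

(** Bound variables are local in the semantics, so the old value of [x] is saved in register [d] and
    restored at the end. *)
Definition forx d c x body :=
  Seq (set_cell 0 d (NLoad (cell 1 x)))
 (Seq (set_cell 1 x (NConst 0))
 (Seq (loop d.+1 c (Seq body (set_cell 1 x (NAdd (NLoad (cell 1 x)) (NConst 1)))))
      (set_cell 1 x (NLoad (cell 0 d))))).

Definition fcost c T := lcost c (T + step_cost) + 3 * step_cost.

Lemma neval_inc s q i : q < 16 ->
  neval (conc s) (NAdd (NLoad (cell q i)) (NConst 1)) = (s.1 q i).+1.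
Proof.
move=> q16; have -> : neval (conc s) (NAdd (NLoad (cell q i)) (NConst 1)) =
  neval (conc s) (NLoad (cell q i)) + 1 by [].
by rewrite neval_ld // addn1.
Qed.

Lemma forxP c d x body T (I : nat -> st -> Prop) s :
  (forall j s, j < n ^ c -> I j s -> s.1 1 x = j -> exists s',
     [/\ runs body T s s', I j.+1 s', s'.1 1 x = j
       & forall i, d <= i < d.+1 + c -> s'.1 0 i = s.1 0 i]) ->
  (forall j s i v, d <= i < d.+1 + c -> I j s -> I j (upd s.1 0 i v, s.2)) ->
  (forall j s v, I j s -> I j (upd s.1 1 x v, s.2)) ->
  I 0 s -> exists s',
    [/\ runs (forx d c x body) (fcost c T) s s', I (n ^ c) s'
      & s'.1 1 x = s.1 1 x].
Proof.
move=> step stab stabx I0.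
pose s1 : st := (upd s.1 0 d (s.1 1 x), s.2).
have r1 : runs (set_cell 0 d (NLoad (cell 1 x))) step_cost s s1.
  by apply: runs_set => //; rewrite neval_ld.
pose s2 : st := (upd s1.1 1 x 0, s1.2).
have r2 : runs (set_cell 1 x (NConst 0)) step_cost s1 s2 by apply: runs_set.
pose J j (s' : st) := [/\ I j s', s'.1 1 x = j & s'.1 0 d = s.1 1 x].
have [||||s3 [r3 [I3 x3 d3] p3]] := @loopP d c d.+1
   (Seq body (set_cell 1 x (NAdd (NLoad (cell 1 x)) (NConst 1)))) (T + step_cost) J s2.
- exact: leqnSn.
- move=> j s' jc [Ij xj dj]; have [s'' [r I1 x1 pr]] := step _ _ jc Ij xj.
  exists (upd s''.1 1 x j.+1, s''.2); split.
  + by apply: (runs_seq r); apply: runs_set => //; rewrite neval_inc ?x1.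
  + split; [exact: stabx|by rewrite /= upd_same|].
    by rewrite /= upd_neq // pr // leqnn addSn ltnS leq_addr.
  + by move=> i ic; rewrite /= upd_neq // pr.
- move=> j s' i v /andP[di id] [Ij xj dj]; split.
  + by apply: stab => //; rewrite (ltnW di) id.
  + by rewrite /= upd_neq.
  + by rewrite /= upd_neq // (ltn_eqF di) orbT.
- split; last by rewrite /s2 /s1 /= upd_neq // upd_same.
    by apply/stabx/stab => //; rewrite leqnn addSn ltnS leq_addr.
  by rewrite /s2 /= upd_same.
exists (upd s3.1 1 x (s.1 1 x), s3.2); split.
- apply: runs_le (runs_seq r1 (runs_seq r2 (runs_seq r3 _))); last first.
    by apply: (@runs_set 1 x _ s3) => //; rewrite neval_ld.
  rewrite /fcost; lia.
- exact: stabx.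
- by rewrite /= upd_same.
Qed.

(** * Compiling expressions with natural values *)

Notation reg d := (NLoad (cell 0 d)).

Definition ite01 b d := If b (set_cell 0 d (NConst 1)) (set_cell 0 d (NConst 0)).

(** The registers form an evaluation stack: the value ends up in register [d], and nothing below [d]
    is written. A sum accumulates in [d], saves its variable in [d.+1], has its counters in the next
    [c] registers and evaluates its body from [d.+2 + c] on. A product adds its second factor
    repeatedly; a quotient counts the positive multiples of the divisor that do not exceed the
    dividend. *)
Fixpoint comp e d :=
  match e with
  | XC c => set_cell 0 d (NConst c)
  | XN => set_cell 0 d (NLoad (NConst 0))
  | XK => set_cell 0 d (NLoad (NConst 1))
  | XV x => set_cell 0 d (NLoad (cell 1 x))
  | XA q e => Seq (comp e d) (set_cell 0 d (NLoad (dyn (cls q) (reg d))))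
  | XI e => Seq (comp e d)
      (If (NLe (NAdd (reg d) (NConst 3)) base)
          (set_cell 0 d (NLoad (NAdd (reg d) (NConst 2))))
          (set_cell 0 d (NConst 0)))
  | XAdd e1 e2 => Seq (Seq (comp e1 d) (comp e2 d.+1))
      (set_cell 0 d (NAdd (reg d) (reg d.+1)))
  | XSub e1 e2 => Seq (Seq (comp e1 d) (comp e2 d.+1))
      (set_cell 0 d (NSub (reg d) (reg d.+1)))
  | XMul c e1 e2 => Seq (Seq (comp e1 d.+1) (comp e2 d.+2))
     (Seq (Seq (set_cell 0 d (NConst 0)) (set_cell 0 d.+3 (NConst 0)))
          (loop d.+4 c
            (Seq (If (NLe (NAdd (reg d.+3) (NConst 1)) (reg d.+1))
                     (set_cell 0 d (NAdd (reg d) (reg d.+2))) Skip)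
                 (set_cell 0 d.+3 (NAdd (reg d.+3) (NConst 1))))))
  | XDiv c e1 e2 => Seq (Seq (comp e1 d.+1) (comp e2 d.+2))
     (Seq (Seq (set_cell 0 d (NConst 0)) (set_cell 0 d.+3 (NConst 0)))
          (loop d.+4 c
            (Seq (set_cell 0 d.+3 (NAdd (reg d.+3) (reg d.+2)))
                 (If (NLe (reg d.+3) (reg d.+1))
                     (set_cell 0 d (NAdd (reg d) (NConst 1))) Skip))))
  | XLe e1 e2 => Seq (Seq (comp e1 d) (comp e2 d.+1))
      (ite01 (NLe (reg d) (reg d.+1)) d)
  | XObj e1 e2 => Seq (Seq (comp e1 d) (comp e2 d.+1))
      (ite01 (RLe (RLoad (dyn 1 (reg d))) (RLoad (dyn 1 (reg d.+1)))) d)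
  | XIf e1 e2 e3 => Seq (comp e1 d)
      (If (NLe (NConst 1) (reg d)) (comp e2 d) (comp e3 d))
  | XSum c x e => Seq (set_cell 0 d (NConst 0))
      (forx d.+1 c x (Seq (comp e (d.+2 + c))
                          (set_cell 0 d (NAdd (reg d) (reg (d.+2 + c))))))
  end.

Fixpoint cost e :=
  match e with
  | XC _ | XN | XK | XV _ => step_cost
  | XA _ e => cost e + step_cost
  | XI e => cost e + 2 * step_cost
  | XAdd e1 e2 | XSub e1 e2 => cost e1 + cost e2 + step_cost
  | XLe e1 e2 | XObj e1 e2 => cost e1 + cost e2 + 2 * step_cost
  | XMul c e1 e2 | XDiv c e1 e2 => cost e1 + cost e2 + (2 * step_cost + lcost c (3 * step_cost))
  | XIf e1 e2 e3 => cost e1 + (step_cost + (cost e2 + cost e3))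
  | XSum c x e => step_cost + fcost c (cost e + step_cost)
  end.

Definition agr T d (m m' : nat -> nat -> T) :=
  forall q i, (q != 0) || (i < d) -> m' q i = m q i.

Lemma agr_trans T d (m1 m2 m3 : nat -> nat -> T) : agr d m1 m2 -> agr d m2 m3 -> agr d m1 m3.
Proof. by move=> a b q i qi; rewrite b // a. Qed.

Lemma agr_le T d d' (m m' : nat -> nat -> T) : d <= d' -> agr d' m m' -> agr d m m'.
Proof.
move=> le a q i /orP[q0|id]; first by rewrite a ?q0.
by rewrite a // (leq_trans id le) orbT.
Qed.

Lemma agr_upd T d i v (m : nat -> nat -> T) : d <= i -> agr d m (upd m 0 i v).
Proof.
move=> le q j /orP[q0|jd]; rewrite upd_neq ?q0 //.
by rewrite (ltn_eqF (leq_trans jd le)) orbT.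
Qed.

(** Registers (class 0) and the temporary array (class 15) are invisible to the
    semantics of expressions. *)
Definition eqm (m m' : mem) := forall q i, q != 0 -> q != 15 -> m q i = m' q i.

Lemma agr_eqm d (m m' : mem) : agr d m m' -> eqm m m'.
Proof. by move=> a q i q0 _; rewrite a ?q0. Qed.

Lemma eqm_upd m m' q i v : eqm m m' -> eqm (upd m q i v) (upd m' q i v).
Proof. by move=> e q' i' q0 q15; rewrite /upd; case: ifP => // _; apply: e. Qed.

Lemma eval_eqm e m m' o : eqm m m' -> nx_eval m o e = nx_eval m' o e.
Proof.
elim: e m m' => //=.
- by move=> x m m' E; apply: E.
- by move=> q e IH m m' E; rewrite (IH _ _ E) E //; case: q.
- by move=> e IH m m' E; rewrite (IH _ _ E).
- by move=> e1 IH1 e2 IH2 m m' E; rewrite (IH1 _ _ E) (IH2 _ _ E).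
- by move=> e1 IH1 e2 IH2 m m' E; rewrite (IH1 _ _ E) (IH2 _ _ E).
- by move=> c e1 IH1 e2 IH2 m m' E; rewrite (IH1 _ _ E) (IH2 _ _ E).
- by move=> c e1 IH1 e2 IH2 m m' E; rewrite (IH1 _ _ E) (IH2 _ _ E).
- by move=> e1 IH1 e2 IH2 m m' E; rewrite (IH1 _ _ E) (IH2 _ _ E).
- by move=> e1 IH1 e2 IH2 m m' E; rewrite (IH1 _ _ E) (IH2 _ _ E).
- by move=> e1 IH1 e2 IH2 e3 IH3 m m' E; rewrite (IH1 _ _ E) (IH2 _ _ E) (IH3 _ _ E).
- by move=> c x e IH m m' E; apply: eq_bigr => i _; apply/IH/eqm_upd.
Qed.

Lemma reval_eqm e m m' o : eqm m m' -> rx_eval m o e = rx_eval m' o e.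
Proof.
elim: e m m' => [e|c x g e IH] m m' E /=; first by rewrite (eval_eqm _ _ E).
apply: eq_big => i; first by rewrite (eval_eqm _ _ (eqm_upd _ _ _ E)).
by move=> _; apply/IH/eqm_upd.
Qed.

Definition okc e d s := exists s',
  [/\ runs (comp e d) (cost e) s s', s'.1 0 d = nx_eval s.1 (s.2 1) e,
      agr d s.1 s'.1 & s'.2 = s.2].

Lemma comp2P e1 e2 d s : okc e1 d s -> (forall s', okc e2 d.+1 s') ->
  exists s', [/\ runs (Seq (comp e1 d) (comp e2 d.+1)) (cost e1 + cost e2) s s',
    s'.1 0 d = nx_eval s.1 (s.2 1) e1, s'.1 0 d.+1 = nx_eval s.1 (s.2 1) e2,
    agr d s.1 s'.1 & s'.2 = s.2].
Proof.
move=> [s1 [r1 v1 a1 o1]] /(_ s1)[s2 [r2 v2 a2 o2]].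
exists s2; split.
- exact: runs_seq r1 r2.
- by rewrite a2 // ltnSn orbT.
- by rewrite v2 o1 -(eval_eqm _ _ (agr_eqm a1)).
- exact: agr_trans a1 (agr_le (leqnSn d) a2).
- by rewrite o2.
Qed.

Lemma set_regP e d s v : neval (conc s) e = v -> ncost e < 900 -> exists s',
  [/\ runs (set_cell 0 d e) step_cost s s', s'.1 0 d = v, agr d s.1 s'.1 & s'.2 = s.2].
Proof.
move=> ev le; exists (upd s.1 0 d v, s.2); split => //.
- exact: runs_set.
- by rewrite /= upd_same.
- exact: agr_upd.
Qed.

Lemma finish c1 c2 T1 T2 d s s1 v : runs c1 T1 s s1 -> agr d s.1 s1.1 -> s1.2 = s.2 ->
  (exists s2, [/\ runs c2 T2 s1 s2, s2.1 0 d = v, agr d s1.1 s2.1 & s2.2 = s1.2]) ->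
  exists s', [/\ runs (Seq c1 c2) (T1 + T2) s s', s'.1 0 d = v, agr d s.1 s'.1 & s'.2 = s.2].
Proof.
move=> r1 a1 o1 [s2 [r2 v2 a2 o2]]; exists s2; split => //.
- exact: runs_seq r1 r2.
- exact: agr_trans a1 a2.
- by rewrite o2.
Qed.

Lemma ite01P b d s : tcost b < step_cost -> exists s',
  [/\ runs (ite01 b d) (2 * step_cost) s s', s'.1 0 d = teval (conc s) b,
      agr d s.1 s'.1 & s'.2 = s.2].
Proof.
move=> le; have [s' [r v a o]] :
    exists s', [/\ runs (if teval (conc s) b then set_cell 0 d (NConst 1)
      else set_cell 0 d (NConst 0)) step_cost s s', s'.1 0 d = teval (conc s) b,
      agr d s.1 s'.1 & s'.2 = s.2].
  by case: (teval _ _); apply: set_regP.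
exists s'; split => //; apply: runs_le (runs_if r); lia.
Qed.

Lemma neval_add s e1 e2 : neval (conc s) (NAdd e1 e2) = neval (conc s) e1 + neval (conc s) e2.
Proof. by []. Qed.

Lemma neval_sub s e1 e2 : neval (conc s) (NSub e1 e2) = neval (conc s) e1 - neval (conc s) e2.
Proof. by []. Qed.

Lemma teval_le s e1 e2 : teval (conc s) (NLe e1 e2) = (neval (conc s) e1 <= neval (conc s) e2).
Proof. by []. Qed.

Lemma neval_const s c : neval (conc s) (NConst c) = c.
Proof. by []. Qed.

Lemma neval_n s : neval (conc s) (NLoad (NConst 0)) = n.
Proof. by rewrite /= low0 (leq_trans _ B2). Qed.

Lemma neval_k s : neval (conc s) (NLoad (NConst 1)) = k.
Proof. by rewrite /= low1 (leq_trans _ B2). Qed.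

Lemma compP e d s : okc e d s.
Proof.
elim: e d s.
- by move=> c d s; apply: set_regP.
- by move=> d s; apply: set_regP; rewrite ?neval_n.
- by move=> d s; apply: set_regP; rewrite ?neval_k.
- by move=> x d s; apply: set_regP; rewrite ?neval_ld.
- move=> q e IH d s; have [s1 [r1 v1 a1 o1]] := IH d s.
  apply: (finish r1 a1 o1); apply: set_regP; last by case: q.
  have q16 : cls q < 16 by case: q.
  by rewrite neval_dynld // neval_ld // v1 a1 //; case: q {q16}.
- move=> e IH d s; have [s1 [r1 v1 a1 o1]] := IH d s.
  apply: (finish r1 a1 o1); rewrite /nx_eval -/nx_eval -v1 /inp.
  have tE : teval (conc s1) (NLe (NAdd (reg d) (NConst 3)) base) = ((s1.1 0 d).+2 < B).
    by rewrite teval_le neval_add neval_ld // neval_base neval_const addn3.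
  have [s2 [r2 v2 a2 o2]] : exists s2, [/\ runs
      (if teval (conc s1) (NLe (NAdd (reg d) (NConst 3)) base)
       then set_cell 0 d (NLoad (NAdd (reg d) (NConst 2)))
       else set_cell 0 d (NConst 0)) step_cost s1 s2,
      s2.1 0 d = (if (s1.1 0 d).+2 < B then low (s1.1 0 d).+2 else 0),
      agr d s1.1 s2.1 & s2.2 = s1.2].
    rewrite tE; case: ifP => lt; apply: set_regP => //.
    have -> : neval (conc s1) (NLoad (NAdd (reg d) (NConst 2))) =
       nmem (conc s1) (neval (conc s1) (reg d) + 2) by [].
    by rewrite neval_ld // addn2 /= lt.
  by exists s2; split => //; apply: runs_le (runs_if r2); rewrite /= /step_cost; lia.
- move=> e1 IH1 e2 IH2 d s; have [s1 [r1 v1 v2 a1 o1]] := comp2P (IH1 d s) (IH2 d.+1).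
  by apply: (finish r1 a1 o1); apply: set_regP; rewrite ?neval_add ?neval_ld ?v1 ?v2.
- move=> e1 IH1 e2 IH2 d s; have [s1 [r1 v1 v2 a1 o1]] := comp2P (IH1 d s) (IH2 d.+1).
  by apply: (finish r1 a1 o1); apply: set_regP; rewrite ?neval_sub ?neval_ld ?v1 ?v2.
- move=> c e1 IH1 e2 IH2 d s.
  have [s1 [r1 v1 v2 a1 o1]] := comp2P (IH1 d.+1 s) (IH2 d.+2).
  apply: (finish r1 (agr_le (leqnSn d) a1) o1).
  set w1 := nx_eval _ _ e1 in v1; set w2 := nx_eval _ _ e2 in v2.
  pose s2 : st := (upd s1.1 0 d 0, s1.2); pose s3 : st := (upd s2.1 0 d.+3 0, s2.2).
  have r2 : runs (Seq (set_cell 0 d (NConst 0)) (set_cell 0 d.+3 (NConst 0))) (2 * step_cost) s1 s3.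
    by rewrite mul2n -addnn; apply: runs_seq; apply: runs_set.
  (* All [n ^ c] iterations are run, but nothing is added any more once the counter has reached the
     first factor; hence the minimum. *)
  pose I j (s' : st) := [/\ s'.1 0 d = minn w1 j * w2, s'.1 0 d.+1 = w1,
     s'.1 0 d.+2 = w2, s'.1 0 d.+3 = j & agr d s1.1 s'.1 /\ s'.2 = s1.2].
  set body := (X in loop _ _ X).
  have [||||s4 [r4 [I4 _ _ _ [I5 I6]] _]] := @loopP d.+4 c d.+4 body (3 * step_cost) I s3.
  + by [].
  + move=> j s' jc [i1 i2 i3 i4 [i5 i6]].
    set b := NLe (NAdd (reg d.+3) (NConst 1)) (reg d.+1).
    have tb : teval (conc s') b = (j < w1).
      by rewrite teval_le neval_add !neval_ld // i4 i2 neval_const addn1.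
    pose s5 : st := (upd s'.1 0 d (minn w1 j.+1 * w2), s'.2).
    have rs5 : runs (If b (set_cell 0 d (NAdd (reg d) (reg d.+2))) Skip) (2 * step_cost) s' s5.
      apply: (runs_le (T := tcost b + step_cost)); first by rewrite /= /step_cost; lia.
      apply: runs_if; rewrite tb; case: ltnP => lt.
        apply: runs_set => //; rewrite neval_add !neval_ld // i1 i3.
        by rewrite !(minn_idPr _) ?(ltnW lt) // mulSn addnC.
      apply: (runs_le (T := 1)) => //.
      suff -> : s5 = s' by exact: runs_skip.
      rewrite /s5 upd_id -?surjective_pairing // i1.
      by rewrite !(minn_idPl _) // (leq_trans lt).
    exists (upd s5.1 0 d.+3 j.+1, s5.2); split.
    * apply: (runs_le (T := 2 * step_cost + step_cost)) => //; apply: (runs_seq rs5); apply: runs_set => //.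
      by rewrite neval_inc //; upds; rewrite i4.
    * split; try by upds.
      split => //; apply: (agr_trans i5); apply: agr_trans (agr_upd _ _ (leqnn d)) _.
      by apply: agr_upd; lia.
    * by move=> i ic; upds.
  + move=> j s' i v /andP[di id] [i1 i2 i3 i4 [i5 i6]].
    split; try by upds.
    by split => //; apply: agr_trans i5 (agr_upd _ _ _); lia.
  + split; rewrite ?/s3 ?/s2; try by upds.
    split => //; apply: agr_trans (agr_upd _ _ (leqnn d)) _.
    by apply: agr_upd; lia.
  exists s4; split => //; exact: runs_seq r2 r4.
- move=> c e1 IH1 e2 IH2 d s.
  have [s1 [r1 v1 v2 a1 o1]] := comp2P (IH1 d.+1 s) (IH2 d.+2).
  apply: (finish r1 (agr_le (leqnSn d) a1) o1).
  set w1 := nx_eval _ _ e1 in v1; set w2 := nx_eval _ _ e2 in v2.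
  pose s2 : st := (upd s1.1 0 d 0, s1.2); pose s3 : st := (upd s2.1 0 d.+3 0, s2.2).
  have r2 : runs (Seq (set_cell 0 d (NConst 0)) (set_cell 0 d.+3 (NConst 0))) (2 * step_cost) s1 s3.
    by rewrite mul2n -addnn; apply: runs_seq; apply: runs_set.
  pose S j := \sum_(i < j) (i.+1 * w2 <= w1).
  pose I j (s' : st) := [/\ s'.1 0 d = S j, s'.1 0 d.+1 = w1,
     s'.1 0 d.+2 = w2, s'.1 0 d.+3 = j * w2 & agr d s1.1 s'.1 /\ s'.2 = s1.2].
  set body := (X in loop _ _ X).
  have [||||s4 [r4 [I4 _ _ _ [I5 I6]] _]] := @loopP d.+4 c d.+4 body (3 * step_cost) I s3.
  + by [].
  + move=> j s' jc [i1 i2 i3 i4 [i5 i6]].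
    pose s5 : st := (upd s'.1 0 d.+3 (j.+1 * w2), s'.2).
    have rs5 : runs (set_cell 0 d.+3 (NAdd (reg d.+3) (reg d.+2))) step_cost s' s5.
      apply: runs_set => //.
      by rewrite neval_add !neval_ld // i4 i3 mulSn addnC.
    set b := NLe (reg d.+3) (reg d.+1).
    have tb : teval (conc s5) b = (j.+1 * w2 <= w1).
      by rewrite teval_le !neval_ld //; upds; rewrite i2.
    have d5 : s5.1 0 d = S j by upds.
    pose s6 : st := (upd s5.1 0 d (S j.+1), s5.2).
    have rs6 : runs (If b (set_cell 0 d (NAdd (reg d) (NConst 1))) Skip) (2 * step_cost) s5 s6.
      apply: (runs_le (T := tcost b + step_cost)); first by rewrite /= /step_cost; lia.
      apply: runs_if; rewrite tb; case: ifPn => lt.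
        by apply: runs_set => //; rewrite neval_inc // d5 /S big_ord_recr /= lt addn1.
      apply: (runs_le (T := 1)) => //.
      suff -> : s6 = s5 by exact: runs_skip.
      rewrite /s6 upd_id -?surjective_pairing // d5.
      by rewrite /S big_ord_recr /= (negbTE lt) addn0.
    exists s6; split.
    * by apply: (runs_le (T := step_cost + 2 * step_cost)) => //; apply: (runs_seq rs5).
    * split; try by upds.
      split => //; apply: (agr_trans i5); apply: (agr_trans (agr_upd _ _ (_ : d <= d.+3))).
        by lia.
      exact: agr_upd.
    * by move=> i ic; upds.
  + move=> j s' i v /andP[di id] [i1 i2 i3 i4 [i5 i6]].
    split; try by upds.
    by split => //; apply: agr_trans i5 (agr_upd _ _ _); lia.
  + split; rewrite ?/s3 ?/s2; try by upds.
    * by upds; rewrite /S big_ord0.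
    split => //; apply: agr_trans (agr_upd _ _ (leqnn d)) _.
    by apply: agr_upd; lia.
  exists s4; split => //; exact: runs_seq r2 r4.
- move=> e1 IH1 e2 IH2 d s; have [s1 [r1 v1 v2 a1 o1]] := comp2P (IH1 d s) (IH2 d.+1).
  apply: (finish r1 a1 o1).
  rewrite /nx_eval -/nx_eval -v1 -v2 -(neval_ld s1 d (isT : 0 < 16)) -(neval_ld s1 d.+1 (isT : 0 < 16)) -teval_le.
  exact: ite01P.
- move=> e1 IH1 e2 IH2 d s; have [s1 [r1 v1 v2 a1 o1]] := comp2P (IH1 d s) (IH2 d.+1).
  apply: (finish r1 a1 o1).
  rewrite /nx_eval -/nx_eval -v1 -v2 -o1 -(neval_ld s1 d (isT : 0 < 16)) -(neval_ld s1 d.+1 (isT : 0 < 16)).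
  rewrite -!(reval_dynld s1 _ (isT : 1 < 16)).
  exact: (ite01P (b := RLe _ _)).
- move=> e1 IH1 e2 IH2 e3 IH3 d s; have [s1 [r1 v1 a1 o1]] := IH1 d s.
  apply: (finish (c2 := If (NLe (NConst 1) (reg d)) (comp e2 d) (comp e3 d))
    (T2 := step_cost + (cost e2 + cost e3)) r1 a1 o1).
  rewrite /nx_eval -/nx_eval -v1 -lt0n -o1 !(eval_eqm _ _ (agr_eqm a1)).
  have [s2 [r2 v2 a2 o2]] := IH2 d s1; have [s3 [r3 v3 a3 o3]] := IH3 d s1.
  have tE : teval (conc s1) (NLe (NConst 1) (reg d)) = (0 < s1.1 0 d).
    by rewrite teval_le neval_ld.
  case: ifP => c0; [exists s2|exists s3]; split => //.
    apply: (runs_le (T := tcost (NLe (NConst 1) (reg d)) + cost e2)).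
      by rewrite leq_add ?leq_addr.
    by apply: runs_if; rewrite tE c0.
  apply: (runs_le (T := tcost (NLe (NConst 1) (reg d)) + cost e3)).
    by rewrite leq_add ?leq_addl.
  by apply: runs_if; rewrite tE c0.
- move=> c x e IH d s.
  pose s1 : st := (upd s.1 0 d 0, s.2).
  have r1 : runs (set_cell 0 d (NConst 0)) step_cost s s1 by exact: runs_set.
  apply: (finish r1 (agr_upd _ _ (leqnn d)) erefl).
  pose S j := \sum_(i < j) nx_eval (upd s.1 1 x i) (s.2 1) e.
  pose I j (s' : st) := [/\ s'.1 0 d = S j,
    (forall q i, (q != 0) || (i < d) -> (q != 1) || (i != x) -> s'.1 q i = s.1 q i)
    & s'.2 = s.2].
  set body := (X in forx _ _ _ X).
  have [||||s2 [r2 [I1 I2 I3] x2]] := @forxP c d.+1 x body (cost e + step_cost) I s1.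
  + move=> j s' jc [i1 i2 i3] xj; have [s3 [r3 v3 a3 o3]] := IH (d.+2 + c) s'.
    exists (upd s3.1 0 d (S j.+1), s3.2); split.
    * apply: (runs_seq r3); apply: runs_set => //.
      rewrite neval_add !neval_ld // a3 ?i1 ?v3; last by lia.
      rewrite /S big_ord_recr /= i3; congr (_ + _); apply: eval_eqm => q i q0 q15.
      rewrite /upd; case: ifP => [/andP[/eqP -> /eqP ->] //|/negbT].
      by rewrite negb_and => qi; rewrite i2 // q0.
    * split; rewrite /= ?upd_same ?o3 //.
      move=> q i qd qx; rewrite upd_neq; last by lia.
      by rewrite a3 ?i2 //; lia.
    * by rewrite /= upd_neq // a3.
    * by move=> i ic; rewrite /= upd_neq ?a3 //; lia.
  + move=> j s' i v ic [i1 i2 i3]; split => //=.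
      by rewrite upd_neq // neq_ltn; lia.
    by move=> q i' qd qx; rewrite upd_neq ?i2 //; lia.
  + move=> j s' v [i1 i2 i3]; split => //=.
    by move=> q i' qd qx; rewrite upd_neq ?i2 //.
  + split; rewrite /= ?upd_same /S ?big_ord0 //.
    by move=> q i' qd qx; rewrite upd_neq //; lia.
  exists s2; split => // q i qd.
  have [/andP[/eqP -> /eqP ->]|] := boolP ((q == 1) && (i == x)).
    by rewrite x2.
  by rewrite negb_and => qx; rewrite I2 // /s1 /= upd_neq //; lia.
Qed.


(** * Compiling expressions with real values *)

Notation rreg d := (RLoad (cell 0 d)).

(** There are no real constants, so 0 is obtained by subtracting a register from itself. *)
Fixpoint rcomp e d :=
  match e with
  | RI e => Seq (comp e d)
      (If (NLe (NAdd (reg d) (NConst 1)) base)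
          (RStore (cell 0 d) (RLoad (reg d)))
          (RStore (cell 0 d) (RSub (rreg d) (rreg d))))
  | RSum c x g e => Seq (RStore (cell 0 d) (RSub (rreg d) (rreg d)))
      (forx d.+1 c x (Seq (comp g (d.+2 + c))
        (If (NLe (NConst 1) (reg (d.+2 + c)))
            (Seq (rcomp e (d.+2 + c))
                 (RStore (cell 0 d) (RAdd (rreg d) (rreg (d.+2 + c)))))
            Skip)))
  end.

Fixpoint rcost_of e :=
  match e with
  | RI e => cost e + 2 * step_cost
  | RSum c x g e => step_cost + fcost c (cost g + (step_cost + (rcost_of e + step_cost)))
  end.

Lemma reval_add s e1 e2 :
  (reval (conc s) (RAdd e1 e2) = reval (conc s) e1 + reval (conc s) e2)%R.
Proof. by []. Qed.

Lemma reval_sub s e1 e2 :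
  (reval (conc s) (RSub e1 e2) = reval (conc s) e1 - reval (conc s) e2)%R.
Proof. by []. Qed.

Lemma runs_rset q i e s v : q < 16 -> reval (conc s) e = v -> rcost e < 900 ->
  runs (RStore (cell q i) e) step_cost s (s.1, upd s.2 q i v).
Proof.
move=> q16 ev le; apply: runs_rstore (ev) _ => //; first exact: neval_cell.
by rewrite /= /step_cost; lia.
Qed.

Lemma runs_zero d s : runs (RStore (cell 0 d) (RSub (rreg d) (rreg d))) step_cost s
  (s.1, upd s.2 0 d 0%R).
Proof. by apply: runs_rset; rewrite // reval_sub subrr. Qed.

Lemma rcompP e d s : exists s', [/\ runs (rcomp e d) (rcost_of e) s s',
  s'.2 0 d = rx_eval s.1 (s.2 1) e, agr d s.1 s'.1 & agr d s.2 s'.2].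
Proof.
elim: e d s => [e|c x g e IH] d s.
  have [s1 [r1 v1 a1 o1]] := compP e d s.
  pose v := rx_eval s.1 (s.2 1) (RI e).
  exists (s1.1, upd s1.2 0 d v); split => //=; rewrite ?upd_same //; last first.
    by rewrite o1; apply: agr_upd.
  apply: (runs_seq r1).
  have tE : teval (conc s1) (NLe (NAdd (reg d) (NConst 1)) base) = (s1.1 0 d < B).
    by rewrite teval_le neval_inc // neval_base.
  apply: (runs_le (T := tcost (NLe (NAdd (reg d) (NConst 1)) base) + step_cost)) => //.
  apply: runs_if; rewrite tE /v /= /winp v1; case: ifP => lt; last exact: runs_zero.
  apply: runs_rset => //.
  have -> : reval (conc s1) (RLoad (reg d)) = rmem (conc s1) (neval (conc s1) (reg d)).
    by [].
  by rewrite neval_ld // v1 /= lt.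
pose s1 : st := (s.1, upd s.2 0 d 0%R).
pose S j := (\sum_(i < j | nx_eval (upd s.1 1 x i) (s.2 1) g != 0)
   rx_eval (upd s.1 1 x i) (s.2 1) e)%R.
pose I j (s' : st) := [/\ s'.2 0 d = S j,
    (forall q i, (q != 0) || (i < d) -> (q != 1) || (i != x) -> s'.1 q i = s.1 q i)
    & agr d s.2 s'.2].
rewrite /rcomp -/rcomp; set body := (X in forx _ _ _ X).
have [||||s2 [r2 [I1 I2 I3] x2]] :=
  @forxP c d.+1 x body (cost g + (step_cost + (rcost_of e + step_cost))) I s1.
+ move=> j s' jc [i1 i2 i3] xj.
  have oE : s'.2 1 = s.2 1 by apply/funext => i; rewrite i3.
  have mE : eqm (upd s.1 1 x j) s'.1.
    move=> q i q0 q15; rewrite /upd; case: ifP => [/andP[/eqP -> /eqP ->] //|/negbT].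
    by rewrite negb_and => qi; rewrite i2 // q0.
  have [s3 [r3 v3 a3 o3]] := compP g (d.+2 + c) s'.
  rewrite oE -(eval_eqm _ _ mE) in v3.
  have tE : teval (conc s3) (NLe (NConst 1) (reg (d.+2 + c))) =
      (nx_eval (upd s.1 1 x j) (s.2 1) g != 0).
    by rewrite teval_le neval_ld // v3 -lt0n.
  have SE : S j.+1 = (S j + if nx_eval (upd s.1 1 x j) (s.2 1) g != 0
     then rx_eval (upd s.1 1 x j) (s.2 1) e else 0)%R.
    by rewrite /S big_mkcond big_ord_recr /= -big_mkcond.
  have [b|b] := boolP (nx_eval (upd s.1 1 x j) (s.2 1) g != 0).
    have [s4 [r4 v4 a4 o4]] := IH (d.+2 + c) s3.
    exists (s4.1, upd s4.2 0 d (S j.+1)); split.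
    * apply: (runs_seq r3); apply: (runs_le
        (T := tcost (NLe (NConst 1) (reg (d.+2 + c))) + (rcost_of e + step_cost))).
        by rewrite leq_add2r.
      apply: runs_if; rewrite tE b; apply: (runs_seq r4); apply: runs_rset => //.
      rewrite reval_add !reval_ld // v4 o4 ?o3 ?i1 ?SE ?b; last by lia.
      by rewrite oE -(reval_eqm _ _ (agr_eqm a3)) -(reval_eqm _ _ mE).
    * split; rewrite /= ?upd_same //.
        by move=> q i qd qx; rewrite a4 ?a3 ?i2 //; lia.
      move=> q i qd; rewrite upd_neq ?o4 ?o3 ?i3 //; lia.
    * by rewrite /= a4 // a3.
    * by move=> i ic; rewrite /= a4 ?a3 //; lia.
  exists s3; split.
  * apply: (runs_seq r3); apply: (runs_le
        (T := tcost (NLe (NConst 1) (reg (d.+2 + c))) + 1)).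
      by rewrite leq_add // (leq_trans _ (leq_addl _ _)).
    by apply: runs_if; rewrite tE (negbTE b); apply: runs_skip.
  * split; rewrite ?SE ?(negbTE b) ?addr0 ?o3 //.
    by move=> q i qd qx; rewrite a3 ?i2 //; lia.
  * by rewrite a3.
  * by move=> i ic; rewrite /= a3 //; lia.
+ move=> j s' i v ic [i1 i2 i3]; split => //=.
  by move=> q i' qd qx; rewrite upd_neq ?i2 //; lia.
+ move=> j s' v [i1 i2 i3]; split => //=.
  by move=> q i' qd qx; rewrite upd_neq ?i2 //.
+ split; rewrite /= ?upd_same /S ?big_ord0 //.
  exact: agr_upd.
exists s2; split => //; first by apply: runs_seq r2; apply: runs_zero.
move=> q i qd; have [/andP[/eqP -> /eqP ->]|] := boolP ((q == 1) && (i == x)).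
  by rewrite x2.
by rewrite negb_and => qx; rewrite I2 // /s1 /= upd_neq //; lia.
Qed.

(** * Compiling statements *)

Notation vr x := (NLoad (cell 1 x)).

(** An entry may read the very array that is being rewritten. The new entries are therefore
    collected in a temporary array and copied by a second loop. *)
Fixpoint scomp c d :=
  match c with
  | Tab q c x e =>
    Seq (forx d c x (Seq (comp e (d.+1 + c))
                         (NStore (dyn 15 (vr x)) (reg (d.+1 + c)))))
        (forx d c x (NStore (dyn (cls q) (vr x)) (NLoad (dyn 15 (vr x)))))
  | RTab c x e =>
    Seq (forx d c x (Seq (rcomp e (d.+1 + c))
                         (RStore (dyn 2 (vr x)) (rreg (d.+1 + c)))))
        (forx d c x (RStore (dyn 1 (vr x)) (RLoad (dyn 2 (vr x)))))
  | Rep c b => loop d c (scomp b (d + c))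
  | SSeq c1 c2 => Seq (scomp c1 d) (scomp c2 d)
  end.

Fixpoint scost c :=
  match c with
  | Tab q c x e => fcost c (cost e + step_cost) + fcost c step_cost
  | RTab c x e => fcost c (rcost_of e + step_cost) + fcost c step_cost
  | Rep c b => lcost c (scost b)
  | SSeq c1 c2 => scost c1 + scost c2
  end.

Definition eqst (s s' : st) := eqm s.1 s'.1 /\ s.2 1 = s'.2 1.

Lemma eqst_trans s1 s2 s3 : eqst s1 s2 -> eqst s2 s3 -> eqst s1 s3.
Proof.
move=> [a b] [c d]; split; last by rewrite b.
by move=> q i q0 q15; rewrite a // c.
Qed.

Lemma run_eqst c s s' : eqst s s' -> eqst (run c s) (run c s').
Proof.
elim: c s s' => [q c x e|c x e|c b IH|c1 IH1 c2 IH2] s s' E.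
- case: E => E1 E2; split => //= q' i q0 q15; case: ifP => _; last exact: E1.
  by rewrite E2; apply/eval_eqm/eqm_upd.
- case: E => E1 E2; split => //=; apply/funext => i /=; rewrite E2.
  by case: ifP => _ //; apply/reval_eqm/eqm_upd.
- by rewrite /=; elim: (n ^ c) => //= j; apply: IH.
- by apply/IH2/IH1.
Qed.

Lemma scompP c d s : exists s',
  [/\ runs (scomp c d) (scost c) s s', eqst (run c s) s'
    & forall i, i < d -> s'.1 0 i = s.1 0 i].
Proof.
elim: c d s => [q c x e|c x e|c b IH|c1 IH1 c2 IH2] d s.
- pose I j (s' : st) := [/\ (forall i, i < j -> s'.1 15 i = nx_eval (upd s.1 1 x i) (s.2 1) e),
    (forall q i, (q != 0) || (i < d) -> (q != 1) || (i != x) -> q != 15 -> s'.1 q i = s.1 q i)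
    & s'.2 = s.2].
  rewrite /scomp; set body1 := Seq _ (NStore _ _).
  have [||||s1 [r1 [I1 I2 I3] x1]] := @forxP c d x body1 (cost e + step_cost) I s.
  + move=> j s' jc [i1 i2 i3] xj; have [s3 [r3 v3 a3 o3]] := compP e (d.+1 + c) s'.
    have mE : eqm (upd s.1 1 x j) s'.1.
      move=> q' i q0 q15; rewrite /upd; case: ifP => [/andP[/eqP -> /eqP ->] //|/negbT].
      by rewrite negb_and => qi; rewrite i2 // q0.
    rewrite i3 -(eval_eqm _ _ mE) in v3.
    exists (upd s3.1 15 j (nx_eval (upd s.1 1 x j) (s.2 1) e), s3.2); split.
    * apply: (runs_seq r3); apply: runs_store => //; last by rewrite neval_ld.
      by rewrite neval_dyn neval_ld // a3 // xj.
    * split; rewrite /= ?o3 //.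
        move=> i; rewrite ltnS leq_eqVlt => /orP[/eqP ->|ij]; first by rewrite upd_same.
        by rewrite upd_neq ?a3 ?i1 // (ltn_eqF ij) orbT.
      by move=> q' i qd qx q15; rewrite upd_neq ?q15 // a3 ?i2 //; lia.
    * by rewrite /= upd_neq // a3.
    * by move=> i ic; rewrite /= upd_neq // a3 //; lia.
  + move=> j s' i v ic [i1 i2 i3]; split => //=.
    by move=> q' i' qd qx q15; rewrite upd_neq ?i2 //; lia.
  + move=> j s' v [i1 i2 i3]; split => //=.
    by move=> q' i' qd qx q15; rewrite upd_neq ?i2 //.
  + by [].
  have q16 : cls q < 16 by case: (q).
  have q0 : cls q != 0 by case: (q).
  have q1 : cls q != 1 by case: (q).
  have q15 : cls q != 15 by case: (q).
  pose J j (s' : st) := [/\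
    (forall i, s'.1 15 i = s1.1 15 i),
    (forall i, s'.1 (cls q) i = if i < j then s1.1 15 i else s.1 (cls q) i),
    (forall q' i, (q' != 0) || (i < d) -> (q' != 1) || (i != x) -> q' != 15 ->
        q' != cls q -> s'.1 q' i = s.1 q' i)
    & s'.2 = s.2].
  have [||||s2 [r2 [J1 J2 J3 J4] x2]] := @forxP c d x
     (NStore (dyn (cls q) (vr x)) (NLoad (dyn 15 (vr x)))) step_cost J s1.
  + move=> j s' jc [i1 i2 i3 i4] xj.
    exists (upd s'.1 (cls q) j (s1.1 15 j), s'.2); split.
    * apply: runs_store => //; first by rewrite neval_dyn neval_ld // xj.
      by rewrite neval_dynld // neval_ld // xj i1.
    * split; rewrite //=.
      - by move=> i; rewrite upd_neq // eq_sym q15.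
      - move=> i; rewrite ltnS leq_eqVlt /upd eqxx; case: eqP => [-> //|] /= _.
        exact: i2.
      - by move=> q' i qd qx q15' qq; rewrite upd_neq ?qq // i3.
    * by rewrite /= upd_neq // eq_sym q1.
    * by move=> i ic; rewrite /= upd_neq // eq_sym q0.
  + move=> j s' i v ic [i1 i2 i3 i4]; split => //=.
      by move=> i'; rewrite upd_neq ?q0 ?i2.
    by move=> q' i' qd qx q15' qq; rewrite upd_neq ?i3 //; lia.
  + move=> j s' v [i1 i2 i3 i4]; split => //=.
      by move=> i'; rewrite upd_neq ?q1 ?i2.
    by move=> q' i' qd qx q15' qq; rewrite upd_neq ?i3 //.
  + split => // [i|q' i qd qx q15' qq]; first by rewrite I2 ?q0 ?q1.
    by rewrite I2.
  exists s2; split; first exact: runs_seq r1 r2.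
    split; rewrite /= ?J4 // => q' i q'0 q'15; case: eqP => /= [->|/eqP qq].
      by rewrite J2; case: ltnP => // ic; rewrite I1.
    have [/andP[/eqP -> /eqP ->]|] := boolP ((q' == 1) && (i == x)); first by rewrite x2 x1.
    by rewrite negb_and => qx; rewrite J3 // q'0.
  by move=> i id; rewrite J3 ?id ?orbT // eq_sym.
- pose I j (s' : st) := [/\ (forall i, i < j -> s'.2 2 i = rx_eval (upd s.1 1 x i) (s.2 1) e),
    (forall q i, (q != 0) || (i < d) -> (q != 1) || (i != x) -> s'.1 q i = s.1 q i)
    & s'.2 1 = s.2 1].
  rewrite /scomp; set body1 := Seq _ (RStore _ _).
  have [||||s1 [r1 [I1 I2 I3] x1]] := @forxP c d x body1 (rcost_of e + step_cost) I s.
  + move=> j s' jc [i1 i2 i3] xj; have [s3 [r3 v3 a3 o3]] := rcompP e (d.+1 + c) s'.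
    have mE : eqm (upd s.1 1 x j) s'.1.
      move=> q' i q0 q15; rewrite /upd; case: ifP => [/andP[/eqP -> /eqP ->] //|/negbT].
      by rewrite negb_and => qi; rewrite i2 // q0.
    rewrite i3 -(reval_eqm _ _ mE) in v3.
    exists (s3.1, upd s3.2 2 j (rx_eval (upd s.1 1 x j) (s.2 1) e)); split.
    * apply: (runs_seq r3); apply: runs_rstore => //; last by rewrite reval_ld.
      by rewrite neval_dyn neval_ld // a3 // xj.
    * split; rewrite //=.
      - move=> i; rewrite ltnS leq_eqVlt => /orP[/eqP ->|ij]; first by rewrite upd_same.
        by rewrite upd_neq ?o3 ?i1 // (ltn_eqF ij) orbT.
      - by move=> q' i qd qx; rewrite a3 ?i2 //; lia.
      - by rewrite -i3; apply/funext => i; rewrite upd_neq // o3.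
    * by rewrite /= a3.
    * by move=> i ic; rewrite /= a3 //; lia.
  + move=> j s' i v ic [i1 i2 i3]; split => //=.
    by move=> q' i' qd qx; rewrite upd_neq ?i2 //; lia.
  + move=> j s' v [i1 i2 i3]; split => //=.
    by move=> q' i' qd qx; rewrite upd_neq ?i2 //.
  + by [].
  pose J j (s' : st) := [/\
    (forall i, s'.2 2 i = s1.2 2 i),
    (forall i, s'.2 1 i = if i < j then s1.2 2 i else s.2 1 i)
    & (forall q' i, (q' != 0) || (i < d) -> (q' != 1) || (i != x) -> s'.1 q' i = s.1 q' i)].
  have [||||s2 [r2 [J1 J2 J3] x2]] := @forxP c d x
     (RStore (dyn 1 (vr x)) (RLoad (dyn 2 (vr x)))) step_cost J s1.
  + move=> j s' jc [i1 i2 i3] xj.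
    exists (s'.1, upd s'.2 1 j (s1.2 2 j)); split => //.
    * apply: runs_rstore => //; first by rewrite neval_dyn neval_ld // xj.
      by rewrite reval_dynld // neval_ld // xj i1.
    * split; rewrite //=.
      - move=> i; rewrite ltnS leq_eqVlt /upd eqxx; case: eqP => [-> //|] /= _.
        exact: i2.
  + move=> j s' i v ic [i1 i2 i3]; split => //=.
    by move=> q' i' qd qx; rewrite upd_neq ?i3 //; lia.
  + move=> j s' v [i1 i2 i3]; split => //=.
    by move=> q' i' qd qx; rewrite upd_neq ?i3 //.
  + by split => // i; rewrite I3.
  exists s2; split; first exact: runs_seq r1 r2.
    split; rewrite /=.
      move=> q' i q'0 q'15.
      have [/andP[/eqP -> /eqP ->]|] := boolP ((q' == 1) && (i == x)); first by rewrite x2 x1.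
      by rewrite negb_and => qx; rewrite J3 // q'0.
    by apply/funext => i; rewrite /= J2; case: ltnP => // ic; rewrite I1.
  by move=> i id; rewrite J3 ?id ?orbT.
- pose I j (s' : st) := eqst (iter j (run b) s) s' /\ forall i, i < d -> s'.1 0 i = s.1 0 i.
  have [||||s' [r [I1 I2] _]] := @loopP d c d (scomp b (d + c)) (scost b) I s.
  + by [].
  + move=> j s' jc [i1 i2]; have [s1 [r1 v1 a1]] := IH (d + c) s'.
    exists s1; split => //.
      split; first exact: eqst_trans (run_eqst _ i1) v1.
      by move=> i id; rewrite a1 ?i2 // ltn_addr.
    by move=> i /andP[_ ic]; apply: a1.
  + move=> j s' i v ic [[i1 i3] i2]; split.
      by split => //= q' i' q0 q15; rewrite upd_neq ?i1 ?q0.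
    by move=> i' id; rewrite /= upd_neq ?i2 //; lia.
  + by split.
  by exists s'.
- have [s1 [r1 v1 a1]] := IH1 d s; have [s2 [r2 v2 a2]] := IH2 d s1.
  exists s2; split; first exact: runs_seq r1 r2.
    exact: eqst_trans (run_eqst _ v1) v2.
  by move=> i id; rewrite a2 ?a1.
Qed.

End Machine.

(** * Polynomial cost, prologue and epilogue *)

(** The base [n.+1] is never 0, so raising the exponent never lowers the bound; this is needed to
    bound a sum. *)
Definition poly_bounded (f : nat -> nat) := exists a b, forall n, f n <= a * n.+1 ^ b.

Lemma poly_bounded_const c : poly_bounded (fun _ => c).
Proof. by exists c, 0 => n; rewrite expn0 muln1. Qed.

Lemma poly_bounded_id : poly_bounded id.
Proof. by exists 1, 1 => n; rewrite mul1n expn1. Qed.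

Lemma poly_boundedD f g : poly_bounded f -> poly_bounded g ->
  poly_bounded (fun n => f n + g n).
Proof.
move=> [a [b h]] [a' [b' h']]; exists (a + a'), (b + b') => n.
rewrite mulnDl; apply: leq_add.
  by apply: leq_trans (h n) _; rewrite leq_mul2l leq_pexp2l ?leq_addr ?orbT.
by apply: leq_trans (h' n) _; rewrite leq_mul2l leq_pexp2l ?leq_addl ?orbT.
Qed.

Lemma poly_boundedM f g : poly_bounded f -> poly_bounded g ->
  poly_bounded (fun n => f n * g n).
Proof.
move=> [a [b h]] [a' [b' h']]; exists (a * a'), (b + b') => n.
by rewrite expnD mulnACA leq_mul.
Qed.

Lemma lcost_poly c T : poly_bounded T -> poly_bounded (fun n => lcost n c (T n)).
Proof.
move=> hT; elim: c => //= c IH; apply: poly_boundedD; first exact: poly_bounded_const.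
apply: (poly_boundedM poly_bounded_id); apply: (poly_boundedD IH).
exact: poly_bounded_const.
Qed.

Ltac pb := repeat first
  [ assumption | exact: poly_bounded_const | apply: poly_boundedD | apply: lcost_poly ].

Lemma cost_poly e : poly_bounded (fun n => cost n e).
Proof. by elim: e => /=; rewrite /fcost => *; pb. Qed.

Lemma rcost_poly e : poly_bounded (fun n => rcost_of n e).
Proof. by elim: e => [e|c x g e IH] /=; rewrite /fcost; pb; apply: cost_poly. Qed.

Lemma scost_poly c : poly_bounded (fun n => scost n c).
Proof.
elim: c => [q c x e|c x e|c b IH|c1 IH1 c2 IH2] /=; rewrite /fcost; pb.
  exact: cost_poly.
exact: rcost_poly.
Qed.

Section Raw.
Variable R : realType.
Implicit Types s : state R.

Lemma exec_whileP b c T N (S : nat -> state R) :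
  (forall j, j < N -> teval (S j) b /\ exists2 t, t <= T & exec c (S j) t (S j.+1)) ->
  ~~ teval (S N) b ->
  exists2 t, t <= N * (tcost b + T) + tcost b & exec (While b c) (S 0) t (S N).
Proof.
elim: N S => [|N IH] S step stop.
  by exists (tcost b) => //; apply: exec_while_stop.
have [tb [t1 le1 ex1]] := step 0 (ltn0Sn N).
have [t2 le2 ex2] := IH (fun j => S j.+1) (fun j => step j.+1) stop.
exists (tcost b + t1 + t2); last exact: exec_while_step tb ex1 ex2.
by rewrite mulSn -!addnA leq_add2l leq_add.
Qed.

Lemma neval_x16 s e : neval s (x16 e) = 16 * neval s e.
Proof. by rewrite /=; lia. Qed.

Lemma exec_nstore_to s a e f : (update (nmem s) (neval s a) (neval s e)) =1 f ->
  exec (NStore a e) s (ncost a + ncost e).+1 (State f (rmem s)).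
Proof. by move=> /funext <-; apply: exec_nstore. Qed.

Variables (n : nat) (G : sgraph 'I_n) (w : {set 'I_n} -> R) (k : nat).

Lemma matrix_memE T (x0 : T) (F : 'I_n -> 'I_n -> T) (i j : 'I_n) :
  matrix_mem x0 F (i * n + j) = F i j.
Proof.
rewrite /matrix_mem; case: pickP => [[i' j'] /= /eqP e|/(_ (i, j))]; last by rewrite eqxx.
have n0 : 0 < n by exact: leq_ltn_trans (ltn_ord i).
have := congr1 (modn^~ n) e; have := congr1 (divn^~ n) e.
rewrite !divnMDl // !modnMDl !divn_small // !modn_small // !addn0.
by move=> /val_inj -> /val_inj ->.
Qed.

Lemma not_edge_diag (i : 'I_n) : [set i; i] \in edges G = false.
Proof. by apply/negP => /card_edge; rewrite setUid cards1. Qed.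

Let s0 := input_state G w k.

Lemma input_free2 : nmem s0 2 = 0.
Proof.
rewrite /= /matrix_mem; case: pickP => // -[i j] /= /eqP e.
have n0 : 0 < n by exact: leq_ltn_trans (ltn_ord i).
have -> : i = j.
  apply: val_inj; move/eqP: e; rewrite addn_eq0 muln_eq0 (gtn_eqF n0) orbF.
  by move=> /andP[/eqP /= -> /eqP ->].
by rewrite not_edge_diag.
Qed.

Lemma input_freen3 : nmem s0 (n + 3) = 0.
Proof.
rewrite addn3 /= /matrix_mem; case: pickP => // -[i j] /= /eqP e.
have -> : i = j.
  apply: val_inj => /=; have := ltn_ord j; have := ltn_ord i; move: e.
  move: (nat_of_ord i) (nat_of_ord j) => a b e an bn.
  have a1 : a = 1 by nia.
  by rewrite a1 in e *; lia.
by rewrite not_edge_diag.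
Qed.

Lemma input_out a : n * n <= a -> nmem s0 a.+2 = 0 /\ rmem s0 a = 0%R.
Proof.
move=> an; rewrite /= /matrix_mem; case: pickP => // -[i j] /= /eqP e.
by have := ltn_ord i; have := ltn_ord j; nia.
Qed.

(** Cells 2 and [n + 3] hold diagonal entries of the adjacency matrix, or lie
    beyond it, so they are 0 and free: they serve to compute [n * n]. Cell 2 then
    keeps the base address [Bn n]. *)
Definition Bn m := m * m + m + 4.
Definition low_of a := if a == 2 then Bn n else if a == n + 3 then n else nmem s0 a.

Definition an3 := NAdd (NLoad (NConst 0)) (NConst 3).
Definition prologue :=
  Seq (While (NLe (NAdd (NLoad an3) (NConst 1)) (NLoad (NConst 0)))
        (Seq (NStore (NConst 2) (NAdd (NLoad (NConst 2)) (NLoad (NConst 0))))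
             (NStore an3 (NAdd (NLoad an3) (NConst 1)))))
      (NStore (NConst 2) (NAdd (NLoad (NConst 2)) (NAdd (NLoad (NConst 0)) (NConst 4)))).

Lemma prologueP : exists2 t, t <= n * 100 + 100 &
  exec prologue s0 t (conc (Bn n) low_of (rmem s0) (fun _ _ => 0, fun _ _ => 0%R)).
Proof.
pose S j := State (fun a => if a == 2 then j * n else if a == n + 3 then j else nmem s0 a)
  (rmem s0).
have n32 : (n + 3 == 2) = false by rewrite addn3.
have n30 : (0 == n + 3) = false by rewrite addn3.
have S0 : S 0 = s0.
  rewrite /S /s0 /input_state; congr State; apply/funext => a.
  case: eqP => [->|_]; first by rewrite mul0n; apply/esym/input_free2.
  by case: eqP => [->|//]; apply/esym/input_freen3.
set b := NLe (NAdd (NLoad an3) (NConst 1)) (NLoad (NConst 0)).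
have tb j : teval (S j) b = (j < n).
  by rewrite /= !n30 n32 eqxx addn1.
have [||t1 le1 ex1] := @exec_whileP b
  (Seq (NStore (NConst 2) (NAdd (NLoad (NConst 2)) (NLoad (NConst 0))))
       (NStore an3 (NAdd (NLoad an3) (NConst 1)))) 50 n S.
- move=> j jn; split; first by rewrite tb.
  eexists; last first.
    apply: exec_seq.
      apply: exec_nstore.
    apply: exec_nstore_to => a /=; rewrite /update /= ?n30 ?n32 ?eqxx.
    case: (a =P n + 3) => [->|_]; first by rewrite n32 addn1.
    by case: (a =P 2) => // _; rewrite mulSn addnC.
  by [].
- by rewrite tb ltnn.
have ex2 := exec_nstore (S n) (NConst 2)
  (NAdd (NLoad (NConst 2)) (NAdd (NLoad (NConst 0)) (NConst 4))).
have := exec_seq ex1 ex2; rewrite S0 => ex; eexists; last first.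
  suff -> : conc (Bn n) low_of (rmem s0) (fun _ _ => 0, fun _ _ => 0%R) =
    State (update (nmem (S n)) (neval (S n) (NConst 2))
      (neval (S n) (NAdd (NLoad (NConst 2)) (NAdd (NLoad (NConst 0)) (NConst 4)))))
      (rmem (S n)) by exact: ex.
  rewrite /conc /=; congr State; apply/funext => a; rewrite /update /low_of /Bn ?n30.
    case: ltnP => [lt|le]; first by case: (a =P 2) => //; rewrite addnA.
    case: (a =P 2) => [|_]; first by lia.
    case: (a =P n + 3) => [|_]; first by lia.
    case: a le => [|[|a]]; [lia|lia|] => le.
    by apply/esym; have [|] := @input_out a; first lia.
  case: ltnP => // le; apply/esym; have [|] := @input_out a => //; lia.
by move: le1 => /=; lia.
Qed.

(** Makes the output array contiguous in place: its entry [z] moves from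
    [B + 16 * z + 11] to [B + 16 + z], which is below all entries still unread. *)
Definition epilogue :=
  Seq (NStore (cell 0 0) (NConst 0))
 (Seq (While (NLe (NAdd (NLoad (cell 0 0)) (NConst 1)) (NLoad (cell (cls ALen) 0)))
        (Seq (NStore (NAdd base (NAdd (NConst 16) (NLoad (cell 0 0))))
                     (NLoad (dyn (cls AOut) (NLoad (cell 0 0)))))
             (NStore (cell 0 0) (NAdd (NLoad (cell 0 0)) (NConst 1)))))
 (Seq (NStore (NConst 1) (NAdd base (NConst 16)))
      (NStore (NConst 0) (NLoad (cell (cls AAns) 0))))).

Lemma epilogueP (s : (nat -> nat -> nat) * (nat -> nat -> R)) :
  exists t s', [/\ exec epilogue (conc (Bn n) low_of (rmem s0) s) t s',
    t <= s.1 (cls ALen) 0 * step_cost + step_cost, nmem s' 0 = s.1 (cls AAns) 0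
    & forall z, z < s.1 (cls ALen) 0 -> nmem s' (nmem s' 1 + z) = s.1 (cls AOut) z].
Proof.
pose B := Bn n; pose f := nmem (conc B low_of (rmem s0) s).
have B4 : 4 <= B by exact: leq_addl.
have fE q i : q < 16 -> f (B + (16 * i + q)) = s.1 q i by move=> *; apply: conc_nmem.
have f2 : f 2 = B by rewrite /f /= (leq_trans _ B4).
pose N := s.1 (cls ALen) 0.
(* The state after [j] moves, with the counter in cell [B]. The answer and the length, in cells
   [B + 12] and [B + 13], lie below the moved block and survive. *)
pose S j := State (fun a => if (B + 16 <= a < B + 16 + j) then s.1 (cls AOut) (a - B - 16)
  else if a == B then j else f a) (rmem (conc B low_of (rmem s0) s)).
have SB j : nmem (S j) 2 = B.
  by rewrite /=; case: ifP => [|_]; [lia|case: eqP => [|_]; [lia|]].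
have c0 j : neval (S j) (cell 0 0) = B.
  have -> : neval (S j) (cell 0 0) = nmem (S j) 2 + (16 * 0 + 0) by [].
  by rewrite SB muln0 !addn0.
have n0 j : neval (S j) (NLoad (cell 0 0)) = j.
  have -> : neval (S j) (NLoad (cell 0 0)) = nmem (S j) (neval (S j) (cell 0 0)) by [].
  by rewrite c0 /= eqxx; case: ifP => //; lia.
have nq j q : 0 < q < 16 -> neval (S j) (NLoad (cell q 0)) = s.1 q 0.
  move=> /andP[q0 q16]; have -> : neval (S j) (NLoad (cell q 0)) = nmem (S j) (nmem (S j) 2 + (16 * 0 + q)) by [].
  rewrite SB -fE //=; case: ifP => [|_]; first by lia.
  by case: eqP => //; lia.
have ex0 : exec (NStore (cell 0 0) (NConst 0)) (conc B low_of (rmem s0) s)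
    (ncost (cell 0 0) + ncost (NConst 0)).+1 (S 0).
  apply: exec_nstore_to => a.
  have -> : neval (conc B low_of (rmem s0) s) (cell 0 0) = B.
    have -> : neval (conc B low_of (rmem s0) s) (cell 0 0) = f 2 + (16 * 0 + 0) by [].
    by rewrite f2 muln0 !addn0.
  rewrite /update -/f; case: ifP => [|_]; last by case: ifP => //; lia.
  by case: ifP => //; lia.
set b := NLe (NAdd (NLoad (cell 0 0)) (NConst 1)) (NLoad (cell (cls ALen) 0)).
have tb j : teval (S j) b = (j < N).
  have -> : teval (S j) b = (neval (S j) (NLoad (cell 0 0)) + 1 <=
     neval (S j) (NLoad (cell (cls ALen) 0))) by [].
  by rewrite n0 nq // addn1.
have [||t1 le1 ex1] := @exec_whileP b
  (Seq (NStore (NAdd base (NAdd (NConst 16) (NLoad (cell 0 0))))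
                     (NLoad (dyn (cls AOut) (NLoad (cell 0 0)))))
             (NStore (cell 0 0) (NAdd (NLoad (cell 0 0)) (NConst 1)))) 500 N S.
- move=> j jN; split; first by rewrite tb.
  pose S' := State (fun a => if (B + 16 <= a < B + 16 + j.+1) then s.1 (cls AOut) (a - B - 16)
    else if a == B then j else f a) (rmem (conc B low_of (rmem s0) s)).
  have e1 : exec (NStore (NAdd base (NAdd (NConst 16) (NLoad (cell 0 0))))
                     (NLoad (dyn (cls AOut) (NLoad (cell 0 0))))) (S j)
     (ncost (NAdd base (NAdd (NConst 16) (NLoad (cell 0 0)))) +
      ncost (NLoad (dyn (cls AOut) (NLoad (cell 0 0))))).+1 S'.
    apply: exec_nstore_to => a.
    have -> : neval (S j) (NAdd base (NAdd (NConst 16) (NLoad (cell 0 0)))) = B + (16 + j).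
      have -> : neval (S j) (NAdd base (NAdd (NConst 16) (NLoad (cell 0 0)))) =
        nmem (S j) 2 + (16 + neval (S j) (NLoad (cell 0 0))) by [].
      by rewrite SB n0.
    have -> : neval (S j) (NLoad (dyn (cls AOut) (NLoad (cell 0 0)))) = s.1 (cls AOut) j.
      have -> : neval (S j) (NLoad (dyn (cls AOut) (NLoad (cell 0 0)))) =
        nmem (S j) (nmem (S j) 2 + (neval (S j) (x16 (NLoad (cell 0 0))) + cls AOut)) by [].
      have -> : neval (S j) (x16 (NLoad (cell 0 0))) = 16 * j by rewrite neval_x16 n0.
      rewrite SB -fE //; cbn [nmem S]; case: ifP => [|_]; first by rewrite /=; lia.
      by case: eqP => //=; lia.
    rewrite /update; cbn [nmem S]; case: eqP => [->|ne].
      rewrite ifT; first by congr (s.1 _ _); lia.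
      by lia.
    case: ifP => [|h]; first by move=> ?; rewrite ifT //; lia.
    by rewrite [RHS]ifF //; lia.
  have e2 : exec (NStore (cell 0 0) (NAdd (NLoad (cell 0 0)) (NConst 1))) S'
      (ncost (cell 0 0) + ncost (NAdd (NLoad (cell 0 0)) (NConst 1))).+1 (S j.+1).
    apply: exec_nstore_to => a.
    have S'B : nmem S' 2 = B.
      by rewrite /=; case: ifP => [|_]; [lia|case: eqP => [|_]; [lia|]].
    have -> : neval S' (NAdd (NLoad (cell 0 0)) (NConst 1)) = nmem S' (nmem S' 2 + 0) + 1 by [].
    have -> : neval S' (cell 0 0) = nmem S' 2 + 0 by [].
    rewrite S'B addn0 /update; cbn [nmem S' S]; rewrite eqxx.
    case: (a =P B) => [->|ne //].
    by rewrite !ifF //; lia.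
  by exists ((ncost (NAdd base (NAdd (NConst 16) (NLoad (cell 0 0)))) +
      ncost (NLoad (dyn (cls AOut) (NLoad (cell 0 0))))).+1 +
      (ncost (cell 0 0) + ncost (NAdd (NLoad (cell 0 0)) (NConst 1))).+1) => //; apply: exec_seq e1 e2.
- by rewrite tb ltnn.
pose S2 := State (update (nmem (S N)) 1 (B + 16)) (rmem (S N)).
have ex2 : exec (NStore (NConst 1) (NAdd base (NConst 16))) (S N)
   (ncost (NConst 1) + ncost (NAdd base (NConst 16))).+1 S2.
  have E : neval (S N) (NAdd base (NConst 16)) = B + 16.
    have -> : neval (S N) (NAdd base (NConst 16)) = nmem (S N) 2 + 16 by [].
    by rewrite SB.
  rewrite /S2 -E; exact: exec_nstore.
have ex3 := exec_nstore S2 (NConst 0) (NLoad (cell (cls AAns) 0)).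
have := exec_seq ex0 (exec_seq ex1 (exec_seq ex2 ex3)).
set t := (X in exec _ _ X _); set s' := (X in exec _ _ _ X) => ex.
exists t, s'; split => //.
- rewrite /t -/N /= /step_cost; move: le1 => /=; lia.
- have -> : nmem s' 0 = nmem S2 (nmem S2 2 + cls AAns) by [].
  have S22 : nmem S2 2 = B by rewrite -(SB N).
  have <- := nq N (cls AAns) isT; rewrite S22.
  have -> : neval (S N) (NLoad (cell (cls AAns) 0)) = nmem (S N) (nmem (S N) 2 + cls AAns) by [].
  rewrite SB /S2; cbn [nmem]; rewrite /update; case: eqP => //; lia.
move=> z zN; have -> : nmem s' 1 = B + 16 by [].
have -> : nmem s' (B + 16 + z) = nmem (S N) (B + 16 + z).
  have U (f' : nat -> nat) b' v a : 1 < a -> update (update f' 1 b') 0 v a = f' a.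
    by rewrite /update; case: a => [|[]].
  apply: (U (nmem (S N)) (B + 16) (neval S2 (NLoad (cell (cls AAns) 0))) (B + 16 + z)); lia.
cbn [nmem S]; rewrite ifT; last by rewrite -/N in zN; lia.
by congr (s.1 _ _); lia.
Qed.

(** The condition [i < j] avoids the offsets 0 and [n.+1], whose cells the prologue has overwritten:
    inside the matrix they are diagonal entries. *)
Lemma inp_adj (i j : 'I_n) : i < j ->
  inp (Bn n) low_of (i * n + j) = ([set i; j] \in edges G).
Proof.
move=> ij; have := ltn_ord i; have := ltn_ord j => jn iN.
rewrite /inp /low_of /Bn ifT; last by nia.
rewrite ifF; last by nia.
rewrite ifF; last first.
  by move: ij iN jn; case: (nat_of_ord i) => [|[|a]]; nia.
by rewrite /= matrix_memE.
Qed.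

Lemma winp_adj (i j : 'I_n) : [set i; j] \in edges G ->
  winp (Bn n) (rmem s0) (i * n + j) = w [set i; j].
Proof.
move=> e; have := ltn_ord i; have := ltn_ord j => jn iN.
rewrite /winp /Bn ifT; last by nia.
by rewrite /= matrix_memE e.
Qed.

End Raw.

Definition zero_state (R : realType) : (nat -> nat -> nat) * (nat -> nat -> R) :=
  (fun _ _ => 0, fun _ _ => 0%R).

Lemma compileP (R : realType) (P : stmt) : exists (p : cmd) (a b : nat),
  forall (n : nat) (G : sgraph 'I_n) (w : {set 'I_n} -> R) (k : nat),
  let low := low_of G w k in let wlow := rmem (input_state G w k) in
  let m := (run n k (Bn n) low wlow P (zero_state R)).1 in
  exists (t : nat) (s : state R),
    [/\ exec p (input_state G w k) t s, t <= a * n.+1 ^ b, nmem s 0 = m (cls AAns) 0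
      & forall z, z < n ^ 6 -> nmem s (nmem s 1 + z) = m (cls AOut) z].
Proof.
(* The epilogue needs the length of the output in memory: at most [n ^ 4] cuts with [n ^ 2] entries
   each. *)
pose P' := SSeq P (Tab ALen 0 0 (XSum 6 0 (XC 1))).
have [a [b ab]] : poly_bounded (fun n => (n * 100 + 100) + (scost n P' + (n ^ 6 * step_cost + step_cost))).
  apply: poly_boundedD.
    by apply: poly_boundedD; [apply: poly_boundedM poly_bounded_id _|];
      apply: poly_bounded_const.
  apply: (poly_boundedD (scost_poly _)); apply: poly_boundedD; last exact: poly_bounded_const.
  apply: poly_boundedM; last exact: poly_bounded_const.
  by exists 1, 6 => n; rewrite mul1n leq_exp2r.
exists (Seq prologue (Seq (scomp P' 0) epilogue)), a, b => n G w k low wlow m.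
have low0 : low 0 = n by rewrite /low /low_of addn3.
have low1 : low 1 = k by rewrite /low /low_of addn3.
have low2 : low 2 = Bn n by [].
have B2 : 2 < Bn n by rewrite /Bn; lia.
have [t1 le1 ex1] := prologueP G w k.
have [s1 [[t2 le2 ex2] [e1 e2] _]] := @scompP R n k (Bn n) low wlow low0 low1 low2 B2 P' 0 (zero_state R).
have [t3 [s' [ex3 le3 v0 v1]]] := epilogueP G w k s1.
have lenE : s1.1 (cls ALen) 0 = n ^ 6.
  by rewrite -e1 // /= ?expn0 /= sum_nat_const card_ord muln1.
exists (t1 + (t2 + t3)), s'; split.
- exact: exec_seq ex1 (exec_seq ex2 ex3).
- apply: leq_trans (ab n); rewrite !leq_add //.
  by rewrite -lenE.
- by rewrite v0 -e1.
by move=> z; rewrite -lenE => zn; rewrite v1 // -e1.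
Qed.

(** * Exchanging edges along alternating walks *)

Definition sdiff (T : finType) (A B : {set T}) := (A :\: B) :|: (B :\: A).

Section Exchange.
Variable U : finType.
Implicit Types F P Q H : {set {set U}}.

Definition deg F v := \sum_(e in F) (v \in e).

Lemma degU1 F e v : e \notin F -> deg (e |: F) v = (v \in e) + deg F v.
Proof. by move=> eF; rewrite /deg big_setU1. Qed.

Lemma degD1 F e v : e \in F -> deg F v = (v \in e) + deg (F :\ e) v.
Proof. by move=> eF; rewrite /deg (big_setD1 e). Qed.

Lemma degE F v : deg F v = \sum_e (e \in F) * (v \in e).
Proof.
by rewrite /deg big_mkcond /=; apply: eq_bigr => e _; case: (e \in F); rewrite ?mul1n.
Qed.

Lemma cardE_sum F : #|F| = \sum_e (e \in F).
Proof. by rewrite -sum1_card big_mkcond. Qed.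

Lemma edge_other (e : {set U}) a : #|e| = 2 -> a \in e ->
  exists2 b, b != a & e = [set a; b].
Proof.
move=> /eqP /cards2P [x [y [xy ->]]]; rewrite !inE => /orP[/eqP ->|/eqP ->].
  by exists y; rewrite // eq_sym.
by exists x; rewrite // setUC.
Qed.

Lemma in_pair (a b z : U) : b != a -> (z \in [set a; b]) = (z == a) + (z == b) :> nat.
Proof. by move=> ba; rewrite !inE; case: eqP => //= ->; rewrite eq_sym (negbTE ba). Qed.

Lemma deg_lt_edge F F' b : deg F b < deg F' b ->
  exists2 e, e \in F' :\: F & b \in e.
Proof.
move=> lt; have [/existsP[e /andP[eD be]]|] := boolP [exists e in F' :\: F, b \in e].
  by exists e.
rewrite negb_exists => /forallP no; move: lt; rewrite ltnNge => /negP[].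
rewrite !degE; apply: leq_sum => e _; have := no e; rewrite !inE.
by case: (e \in F); case: (e \in F'); case: (b \in e).
Qed.

(** The walk starts in [u] with an edge of [F']. Here it also ends with an edge of [F'], in [v], and
    the number of edges grows by one; [u] and [v] may coincide. In [rb_exchange] the last edge
    belongs to [F], and the number of edges is kept. *)
Definition bb_exchange F F' F1 u := exists v,
  [/\ #|F1| = #|F|.+1, forall z, deg F1 z = deg F z + (z == u) + (z == v),
      deg F1 u <= deg F' u & deg F1 v <= deg F' v].

Definition rb_exchange F F' F1 u := exists v,
  [/\ v != u, #|F1| = #|F|, forall z, deg F1 z + (z == v) = deg F z + (z == u)
    & deg F' v < deg F v].

(** A maximal walk from [u] alternating between edges of [F'] outside [F] and
    edges of [F] outside [F']; [F1] is [F] after toggling the edges walked. *)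
Lemma alternating_walk F F' u : (forall e, e \in F :|: F' -> #|e| = 2) ->
  deg F u < deg F' u -> exists F1,
    [/\ F :&: F' \subset F1, F1 \subset F :|: F' & bb_exchange F F' F1 u \/ rb_exchange F F' F1 u].
Proof.
move=> c2 ltu.
(* In the first case the walk has just added an edge of [F'] and stands in [a]; in the second it has
   just removed an edge of [F] and stands in [b]. The empty walk belongs to the second case with [b]
   equal to [u]. Every step brings [F1] closer to [F'], so the walk ends. *)
suff W m F1 : #|sdiff F1 F'| < m -> F :&: F' \subset F1 -> F1 \subset F :|: F' ->
   (exists2 a, #|F1| = #|F|.+1 & forall z, deg F1 z = deg F z + (z == u) + (z == a)) \/
   (exists2 b, #|F1| = #|F| & forall z, deg F1 z + (z == b) = deg F z + (z == u)) ->
   exists F1, [/\ F :&: F' \subset F1, F1 \subset F :|: F'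
      & bb_exchange F F' F1 u \/ rb_exchange F F' F1 u].
  apply: (W _ F (ltnSn _)); rewrite ?subsetIl ?subsetUl //.
  by right; exists u.
elim: m F1 => // m IH F1 lt s1 s2 [[a cF1 dF1]|[b cF1 dF1]].
- have [|le] := ltnP (deg F' a) (deg F1 a).
    case/deg_lt_edge => e; rewrite inE => /andP[eF' eF1] ae.
    have [b ba eE] := edge_other (c2 e (subsetP s2 _ eF1)) ae.
    apply: (IH (F1 :\ e)).
    + rewrite -ltnS; apply: leq_trans lt; rewrite ltnS; apply/proper_card/properP; split.
        apply/subsetP => f; rewrite !inE; case: (f =P e) => [->|_] //=.
        by rewrite (negbTE eF').
      by exists e; rewrite !inE ?eF' ?eF1 ?eqxx // andbF.
    + apply/subsetP => f fI; rewrite !inE (subsetP s1) // andbT.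
      by apply: contraNneq eF' => <-; case/setIP: fI.
    + exact: subset_trans (subsetDl _ _) s2.
    right; exists b; first by have := cardsD1 e F1; rewrite eF1 cF1; lia.
    move=> z; have := degD1 z eF1; rewrite dF1 eE in_pair //.
    by move: (z == u) (z == a) (z == b); clear; lia.
  exists F1; split=> //; left; exists a; split => //.
  case: (u =P a) => [-> //|/eqP ua]; rewrite dF1 eqxx (negbTE ua) addn0 addn1 //.
- have [|le] := ltnP (deg F1 b) (deg F' b).
    case/deg_lt_edge => e; rewrite inE => /andP[eF1 eF'] be.
    have [a ab eE] : exists2 a, a != b & e = [set b; a].
      by apply: edge_other be; apply: c2; rewrite inE eF' orbT.
    apply: (IH (e |: F1)).
    + rewrite -ltnS; apply: leq_trans lt; rewrite ltnS; apply/proper_card/properP; split.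
        apply/subsetP => f; rewrite !inE; case: (f =P e) => [->|_] //=.
        by rewrite eF'.
      by exists e; rewrite !inE ?eF' ?eF1 ?eqxx.
    + exact: subset_trans s1 (subsetUr _ _).
    + by rewrite subUset s2 andbT sub1set inE eF' orbT.
    left; exists a; first by rewrite cardsU1 eF1 cF1.
    move=> z; rewrite degU1 // eE in_pair //; move: (dF1 z).
    by move: (z == u) (z == a) (z == b); clear; lia.
  exists F1; split => //; right; exists b.
  have dF1b := dF1 b; rewrite eqxx in dF1b.
  (* Back in [u] after an edge of [F], the degree of [u] is that in [F], still below that in [F'],
     and the walk could go on. *)
  case: (b =P u) => [bu|/eqP bu]; first by move: dF1b le; rewrite bu eqxx; lia.
  split => //; move: dF1b le; rewrite (negbTE bu); lia.
Qed.

Variables (R : realType) (w : U -> R) (k : nat).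
Hypothesis w0 : forall v, (0 <= w v)%R.

(** The diversity of [k] cuts with edge multiplicities [x]. *)
Definition fval_of (x : U -> nat) : R :=
  (\sum_v w v * ((x v)%:R * (k%:R - (x v)%:R)))%R.

Definition fval F := fval_of (deg F).

(** This is concavity: if [x1 + x2 = x + y] and [x1] lies between [x] and [y], then replacing [x],
    [y] by [x1], [x2] changes the sum of the values of [x (k - x)] by [2 (x1 - x) (y - x1)], which
    is nonnegative. *)
Lemma fval_exchange F F' F1 F2 :
  (forall z, deg F1 z + deg F2 z = deg F z + deg F' z) ->
  (forall z, deg F z <= deg F1 z <= deg F' z \/ deg F' z <= deg F1 z <= deg F z) ->
  (fval F + fval F' <= fval F1 + fval F2)%R.
Proof.
move=> E1 E2; rewrite /fval /fval_of -!big_split /=; apply: ler_sum => v _.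
rewrite -!mulrDr; apply: ler_wpM2l => //.
have /(congr1 (fun n => n%:R : R)%R) := E1 v; rewrite !natrD.
have h : ((deg F v)%:R <= (deg F1 v)%:R :> R)%R /\ ((deg F1 v)%:R <= (deg F' v)%:R :> R)%R \/
   ((deg F' v)%:R <= (deg F1 v)%:R :> R)%R /\ ((deg F1 v)%:R <= (deg F v)%:R :> R)%R.
  by rewrite !ler_nat; case: (E2 v) => /andP[]; [left|right].
move: h; move: (deg F v)%:R%R (deg F' v)%:R%R (deg F1 v)%:R%R (deg F2 v)%:R%R => x y x1 x2.
move=> h e; have {e} -> : (x2 = x + y - x1)%R by lra.
rewrite -subr_ge0.
have -> : (x1 * (k%:R - x1) + (x + y - x1) * (k%:R - (x + y - x1)) -
   (x * (k%:R - x) + y * (k%:R - y)) = 2 * ((x1 - x) * (y - x1)))%R by ring.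
apply: mulr_ge0 => //; case: h => [] [h1 h2].
  by apply: mulr_ge0; rewrite subr_ge0.
by apply: mulr_le0; rewrite subr_le0.
Qed.

Variable H : {set {set U}}.
Hypothesis cH : forall e, e \in H -> #|e| = 2.

Definition optimal p F := [&& F \subset H, #|F| == p &
  [forall F' : {set {set U}}, (F' \subset H) && (#|F'| == p) ==> (fval F' <= fval F)%R]].

Lemma optimalP p F : reflect [/\ F \subset H, #|F| = p &
  forall F', F' \subset H -> #|F'| = p -> (fval F' <= fval F)%R] (optimal p F).
Proof.
apply: (iffP and3P) => -[FH /eqP Fp h]; split => //.
- by move=> F' F'H F'p; have /forallP/(_ F') := h; rewrite F'H F'p eqxx.
- by apply/forallP => F'; apply/implyP => /andP[? /eqP ?]; apply: h.
Qed.

Lemma optimal_exists p : p <= #|H| -> exists F, optimal p F.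
Proof.
move=> /card_geqP[l [ul sl lH]].
pose P (F : {set {set U}}) := (F \subset H) && (#|F| == p).
have P0 : P [set x in l].
  rewrite /P cardsE (card_uniqP ul) sl eqxx andbT.
  by apply/subsetP => x; rewrite inE => /lH.
case: (Order.TotalTheory.arg_maxP fval P0) => F /andP[FH /eqP Fp] max.
exists F; apply/optimalP; split => // F' F'H F'p.
by apply: max; rewrite /P F'H F'p eqxx.
Qed.

Lemma sum_deg F : (forall e, e \in F -> #|e| = 2) -> \sum_v deg F v = 2 * #|F|.
Proof.
move=> c2; rewrite /deg exchange_big /= mulnC -sum_nat_const.
apply: eq_bigr => e eF; rewrite -(c2 e eF) -sum1_card [RHS]big_mkcond /=.
by apply: eq_bigr => v _; case: (v \in e).
Qed.

(** Take an optimal [F'] with [p + 1] edges closest to [F]. By concavity, walking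
    from [F] towards [F'] and the complementary walk from [F'] lose nothing in
    total, so a walk that keeps the number of edges would bring [F'] closer. *)
Lemma greedy_step p F : optimal p F -> p < #|H| ->
  exists F1 u v, optimal p.+1 F1 /\ forall z, deg F1 z = deg F z + (z == u) + (z == v).
Proof.
move=> optF pH; have [F0 opt0] := optimal_exists pH.
have /optimalP[FH Fp Fmax] := optF.
case: (arg_minnP (fun F' => #|sdiff F F'|) opt0) => F' optF' minF'.
have /optimalP[F'H F'p F'max] := optF'.
have [u ltu] : exists u, deg F u < deg F' u.
  apply/existsP; rewrite -[X in is_true X]negbK negb_exists; apply/negP => /forallP h.
  have : \sum_v deg F' v <= \sum_v deg F v.
    by apply: leq_sum => v _; rewrite leqNgt h.
  rewrite !sum_deg ?Fp ?F'p; first by lia.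
    by move=> e eF; apply/cH/(subsetP FH).
  by move=> e eF; apply/cH/(subsetP F'H).
have UH : F :|: F' \subset H by rewrite subUset FH.
have [F1 [s1 s2 ex]] := alternating_walk (fun e eU => cH (subsetP UH e eU)) ltu.
(* The result of the complementary walk: together, [F1] and [F2] use every edge as often as [F] and
   [F'] do. *)
pose F2 := ((F :|: F') :\: F1) :|: (F :&: F').
have mem e : (e \in F1) + (e \in F2) = (e \in F) + (e \in F').
  rewrite !inE; have := subsetP s1 e; have := subsetP s2 e; rewrite !inE.
  case: (e \in F); case: (e \in F'); case: (e \in F1) => //= h1 h2.
  - by have := h2 isT.
  - by have := h1 isT.
have dsum z : deg F1 z + deg F2 z = deg F z + deg F' z.
  rewrite !degE -!big_split /=; apply: eq_bigr => e _.
  by rewrite -!mulnDl mem.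
have csum : #|F1| + #|F2| = #|F| + #|F'|.
  rewrite !cardE_sum -!big_split /=; apply: eq_bigr => e _; exact: mem.
have F1H : F1 \subset H by exact: subset_trans s2 UH.
have F2H : F2 \subset H.
  by rewrite subUset (subset_trans (subsetDl _ _) UH) (subset_trans (subsetIl _ _) FH).
(* If an edge is gained, [F2] has [p] edges and is no better than [F], so [F1] is at least as good
   as [F']. *)
case: ex => [[v [cF1 dF1 leu lev]]|[v [vu cF1 dF1 ltv]]].
  exists F1, u, v; split => //; apply/optimalP; split => //; first by rewrite cF1 Fp.
  move=> X XH Xp; apply: le_trans (F'max X XH Xp) _.
  have : (fval F2 <= fval F)%R.
    by apply: Fmax => //; move: csum; rewrite cF1 Fp F'p; clear; lia.
  suff : (fval F + fval F' <= fval F1 + fval F2)%R by clear; lra.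
  apply: fval_exchange => // z; rewrite dF1.
  move: leu lev; rewrite !dF1 !eqxx.
  case: (z =P u) => [->|_] /=; first by clear; lia.
  case: (z =P v) => [->|_] /=; first by clear; lia.
  by clear; lia.
(* Otherwise [F1] has [p] edges and is no better than [F], so [F2] is as good as [F'], hence optimal
   as well. *)
have v1 : (fval F1 <= fval F)%R by apply: Fmax => //; rewrite cF1 Fp.
have v2 : (fval F + fval F' <= fval F1 + fval F2)%R.
  apply: fval_exchange => // z; have := dF1 z.
  case: (z =P u) => [->|_] /=; first by rewrite eq_sym (negbTE vu); move: ltu; clear; lia.
  case: (z =P v) => [->|_] /=; first by move: ltv; clear; lia.
  by clear; lia.
have optF2 : optimal p.+1 F2.
  apply/optimalP; split => //; first by move: csum; rewrite cF1 Fp F'p; clear; lia.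
  by move=> X XH Xp; move: v1 v2 (F'max X XH Xp); clear; lra.
have := minF' _ optF2; rewrite leqNgt => /negP[].
apply/proper_card/properP; split.
  apply/subsetP => e; have := mem e; rewrite !inE.
  by case: (e \in F); case: (e \in F'); case: (e \in F1).
(* An edge of the walk at [u] lies in [F'] but not in [F], and [F2] has lost it, so [F2] is strictly
   closer to [F] than [F'] is. *)
have [e] : exists2 e, e \in F1 :\: F & u \in e.
  by apply: deg_lt_edge; have := dF1 u; rewrite eqxx eq_sym (negbTE vu); clear; lia.
rewrite inE => /andP[eF eF1] _; exists e; have := subsetP s2 e eF1; have := mem e;
  rewrite !inE eF1 (negbTE eF) /=; by case: (e \in F').
Qed.

End Exchange.

(** * The Havel-Hakimi exchange in a disjoint union of cliques *)

Section HavelHakimi.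
Variables (N : nat).
Implicit Types F P Q H : {set {set 'I_N}}.

Definition nbrs Q a := [set y : 'I_N | (y != a) && ([set a; y] \in Q)].

Lemma pair_inj (a x y : 'I_N) : x != a -> y != a -> [set a; x] = [set a; y] -> x = y.
Proof.
move=> xa ya E; have : x \in [set a; y] by rewrite -E !inE eqxx orbT.
by rewrite !inE (negbTE xa) => /eqP.
Qed.

Lemma deg_nbrs Q a : (forall e, e \in Q -> #|e| = 2) -> deg Q a = #|nbrs Q a|.
Proof.
move=> c2; have inj : {in nbrs Q a &, injective (fun y => [set a; y])}.
  by move=> x y; rewrite !inE => /andP[xa _] /andP[ya _]; apply: pair_inj.
rewrite -(card_in_imset inj) /deg -big_mkcondr /= sum1_card.
apply: eq_card => e; rewrite [LHS]inE; apply/andP/imsetP => [[eQ ae]|[y]].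
  have [b ba eE] := edge_other (c2 e eQ) ae.
  by exists b; rewrite // inE ba -eE.
by rewrite inE => /andP[ya yQ] ->; rewrite yQ !inE eqxx.
Qed.

Variables (H P F : {set {set 'I_N}}) (r : 'I_N -> nat) (v : 'I_N).
Hypothesis (cH : forall e, e \in H -> #|e| = 2).
Hypothesis (tH : forall a b c, a != c -> [set a; b] \in H -> [set b; c] \in H -> [set a; c] \in H).
Hypothesis (PF : P \subset F) (FH : F \subset H).
Hypothesis (rE : forall z, deg F z = deg P z + r z).
Hypothesis (rv : 0 < r v).

(** Here [P] consists of the edges already placed, [r] gives the degrees still missing, and [F] is a
    realization containing [P]. The components of [H] are cliques by [tH], but those of [H] without
    [P] need not be; the order in which vertices are finished has to compensate for this. *)
Definition hh_candidate u := [&& [set v; u] \in H, [set v; u] \notin P & 0 < r u].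

Lemma not_loop a : [set a; a] \notin H.
Proof. by apply/negP => /cH; rewrite setUid cards1. Qed.

Let Q := F :\: P.

Let cQ e : e \in Q -> #|e| = 2.
Proof. by case/setDP => eF _; apply/cH/(subsetP FH). Qed.

Let dQ z : deg Q z = r z.
Proof.
apply/eqP; rewrite -(eqn_add2l (deg P z)) -rE; apply/eqP.
rewrite !degE -big_split /=; apply: eq_bigr => e _; rewrite -mulnDl inE.
by have := subsetP PF e; case: (e \in P) => [->|_] //; case: (e \in F).
Qed.

Let Q_pos a b : [set a; b] \in Q -> 0 < r b.
Proof.
move=> abQ; rewrite -dQ degE (bigD1 [set a; b]) //= abQ.
by rewrite !inE eqxx orbT.
Qed.

Lemma hh_candidate_exists : exists u, hh_candidate u.
Proof.
have : 0 < deg Q v by rewrite dQ.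
rewrite (deg_nbrs _ cQ) card_gt0 => /set0Pn[u]; rewrite inE => /andP[uv uQ].
exists u; rewrite /hh_candidate (Q_pos uQ) andbT.
by case/setDP: uQ => uF ->; rewrite (subsetP FH).
Qed.

Hypothesis first_v : forall z : 'I_N, z < v -> r z = 0.
Hypothesis P_early : forall e, e \in P -> exists2 a : 'I_N, a \in e & forall z : 'I_N, 0 < r z -> a <= z.

(** If [z] is a neighbour of [v] and [u] is not, then [u], of residual degree at
    least that of [z], has a neighbour [y] that [z] has not: replace the edges
    [v z], [u y] by [v u], [z y]. *)
Lemma hh_exchange u : hh_candidate u -> (forall z, hh_candidate z -> r z <= r u) ->
  exists F', [/\ P \subset F', F' \subset H, forall z, deg F' z = deg F z
    & [set v; u] \in F'].
Proof.
move=> /and3P[uH uP ru] max.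
have [uF|uF] := boolP ([set v; u] \in F); first by exists F.
have uv : u != v by apply: contraTneq uH => ->; apply: not_loop.
have : 0 < deg Q v by rewrite dQ.
rewrite (deg_nbrs _ cQ) card_gt0 => /set0Pn[z]; rewrite inE => /andP[zv zQ].
have [zF zP] : [set v; z] \in F /\ [set v; z] \notin P by case/setDP: zQ.
have rz := Q_pos zQ.
have zu : z != u by apply: contraNneq uF => <-.
have := max z; rewrite /hh_candidate zP rz (subsetP FH _ zF) => /(_ isT).
rewrite -!dQ !(deg_nbrs _ cQ) => le.
have zQ' : [set z; v] \in Q by rewrite setUC.
have uvQ : [set u; v] \notin Q by rewrite setUC inE negb_and uF orbT.
have [y yu yz] : exists2 y, y \in nbrs Q u & (y != z) && ([set z; y] \notin Q).
  apply/exists_inP; rewrite -[X in is_true X]negbK negb_exists_in.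
  apply/negP => /forall_inP no.
  (* Otherwise all neighbours of [u] other than [z] are neighbours of [z], which has the additional
     neighbour [v] and would exceed [u] in residual degree. *)
  have sub : nbrs Q u :\ z \subset (nbrs Q z :\ u) :\ v.
    apply/subsetP => y; rewrite in_setD1 => /andP[yz yN].
    have := no y yN; rewrite yz /= negbK => zyQ.
    move: yN; rewrite inE => /andP[yu yQ].
    rewrite !in_setD1 yu /= inE yz zyQ !andbT.
    by apply: contraNneq uvQ => <-.
  have := subset_leq_card sub.
  have := cardsD1 z (nbrs Q u); have := cardsD1 u (nbrs Q z).
  have := cardsD1 v (nbrs Q z :\ u); move: le.
  have -> : v \in nbrs Q z :\ u by rewrite in_setD1 eq_sym uv inE eq_sym zv zQ'.
  have -> : (u \in nbrs Q z) = (z \in nbrs Q u).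
    by rewrite inE [RHS]inE eq_sym setUC.
  by clear; lia.
move: yu yz; rewrite inE => /andP[yu yQ] /andP[yz zyQ].
have yv : y != v by apply: contraNneq uvQ => <-.
have [yF yP] : [set u; y] \in F /\ [set u; y] \notin P by case/setDP: yQ.
have ry := Q_pos yQ.
(* Both [z] and [y] have positive residual degree and differ from [v], so they come after [v]. Every
   placed edge has an end that does not come after [v]. *)
have zyP : [set z; y] \notin P.
  apply/negP => /P_early[a]; rewrite !inE => /orP[]/eqP -> /(_ v rv) av.
    by case/negP: zv; rewrite -val_eqE eqn_leq av leqNgt; apply/negP => /first_v z0; rewrite z0 in rz.
  by case/negP: yv; rewrite -val_eqE eqn_leq av leqNgt; apply/negP => /first_v y0; rewrite y0 in ry.
have zyF : [set z; y] \notin F by move: zyQ; rewrite inE zyP.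
(* The edges [z v], [v u] and [u y] of [H] put all four vertices into one clique. *)
have zyH : [set z; y] \in H.
  apply: (@tH z u y); [by rewrite eq_sym| |exact: (subsetP FH)].
  by apply: (@tH z v u) => //; rewrite setUC (subsetP FH).
have uyvz : [set u; y] != [set v; z].
  apply/eqP => E; have : v \in [set u; y] by rewrite E !inE eqxx.
  by rewrite !inE (eq_sym v u) (negbTE uv) (eq_sym v y) (negbTE yv).
have vuzy : [set v; u] != [set z; y].
  apply/eqP => E; have : v \in [set z; y] by rewrite -E !inE eqxx.
  by rewrite !inE (eq_sym v z) (negbTE zv) (eq_sym v y) (negbTE yv).
pose F2 := (F :\ [set v; z]) :\ [set u; y].
exists ([set v; u] |: ([set z; y] |: F2)); split.
- apply/subsetP => e eP; rewrite !inE (subsetP PF _ eP) andbT.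
  apply/orP; right; apply/orP; right; apply/andP; split.
    by apply: contraNneq yP => <-.
  by apply: contraNneq zP => <-.
- rewrite !subUset !sub1set uH zyH /=; apply: subset_trans FH.
  by apply: subset_trans (subsetDl _ _) (subsetDl _ _).
- move=> x; rewrite degU1; last first.
    by rewrite !inE negb_or vuzy /= (negbTE uF) !andbF.
  rewrite degU1; last by rewrite !inE (negbTE zyF) !andbF.
  rewrite (degD1 x zF) (@degD1 _ (F :\ [set v; z]) [set u; y] x); last by rewrite !inE uyvz.
  by rewrite !in_pair -/F2 //; clear; lia.
- by rewrite !inE eqxx.
Qed.

End HavelHakimi.

(** * Iterating the exchange *)

Section HavelHakimiLoop.
Variables (N : nat) (H : {set {set 'I_N}}) (y : 'I_N -> nat).
Hypothesis (cH : forall e, e \in H -> #|e| = 2).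
Hypothesis (tH : forall a b c, a != c -> [set a; b] \in H -> [set b; c] \in H -> [set a; c] \in H).
Implicit Types (P F : {set {set 'I_N}}) (D : 'I_N -> nat).

(** In the classical form a vertex is joined at once to its partners of largest degree; here one
    edge is placed at a time. Always taking the first unfinished vertex completes it before another
    one is started. *)
Definition hh_choice P D v u := [&& 0 < D v, hh_candidate H P D v u,
  [forall a : 'I_N, (v <= a) || (D a <= 0)]
  & [forall a : 'I_N, ~~ hh_candidate H P D v a || (D a <= D u)]].

Definition realizable := exists2 F : {set {set 'I_N}}, F \subset H & forall a, deg F a = y a.

Definition early P D := forall e, e \in P ->
  exists2 a : 'I_N, a \in e & forall z : 'I_N, 0 < D z -> a <= z.

(** The first three clauses hold for all prescribed degrees, so vanishing residual degrees always
    certify a realization. The last clause gives the converse. Its disjunction allows for idle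
    rounds after the construction has been completed. *)
Definition hh_inv t D P :=
  [/\ P \subset H, forall a, deg P a + D a = y a, early P D &
      realizable -> (exists F : {set {set 'I_N}}, [/\ P \subset F, F \subset H & forall a, deg F a = y a]) /\
        (\sum_a D a = 0 \/ \sum_a D a + 2 * t <= \sum_a y a)].

Lemma hh_inv0 : hh_inv 0 y set0.
Proof.
split; first exact: sub0set.
- by move=> a; rewrite /deg big_set0.
- by move=> e; rewrite inE.
- case=> F FH dF; split; last by right; rewrite addn0.
  by exists F; rewrite sub0set.
Qed.

Lemma hh_inv_step t D P v u : hh_choice P D v u -> hh_inv t D P ->
  hh_inv t.+1 (fun a => D a - ((a == v) || (a == u))) ([set v; u] |: P).
Proof.
case/and4P => Dv cand /forallP first /forallP max [PH dP eP real].
have /and3P[vuH vuP Du] := cand.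
have uv : u != v.
  by apply: contraTneq vuH => ->; apply: not_loop.
have memE a : (a \in [set v; u]) = ((a == v) || (a == u)) by rewrite !inE.
have le1 a : ((a == v) || (a == u) : nat) <= D a.
  by case: eqP => [->|_] //=; case: eqP => [->|_].
split.
- by rewrite subUset sub1set vuH.
- move=> a; rewrite degU1 // memE; move: (le1 a) (dP a); case: (_ || _) => /=; clear; lia.
- move=> e; rewrite !inE => /orP[/eqP ->|/eP[a ae h]].
    exists v; first by rewrite !inE eqxx.
    move=> z Dz; have := first z; case/orP => // z0; move: Dz z0; clear; lia.
  by exists a => // z Dz; apply: h; apply: leq_trans Dz (leq_subr _ _).
move=> rz; have [[F [PF FH dF]] sum] := real rz; split.
  have rE z : deg F z = deg P z + D z by rewrite dF dP.
  have [F' [PF' F'H dF' vuF']] := @hh_exchange _ _ _ _ _ _ cH tH PF FH rE Dv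
    (fun z zv => ltac:(by have := first z; rewrite leqNgt zv leqn0 => /eqP)) eP u cand
    (fun z cz => ltac:(by have := max z; rewrite cz)).
  exists F'; split => //; first by rewrite subUset sub1set vuF'.
  by move=> a; rewrite dF' dF.
have sumE : \sum_a D a = \sum_a (D a - ((a == v) || (a == u))) + 2.
  have -> : 2 = \sum_a (a \in [set v; u]).
    have c2 : #|[set v; u]| = 2 by rewrite cards2 eq_sym uv.
    by rewrite -[LHS]c2 -sum1_card big_mkcond.
  rewrite -big_split /=; apply: eq_bigr => a _; rewrite memE subnK //.
right; move: sum; rewrite sumE /=; move: (\sum_a (_ - _)) => S; clear; lia.
Qed.

(** As long as some residual degree is positive, a realization extending [P] has an unplaced edge at
    the first such vertex, which yields a candidate. For realizable degrees, being stuck thus means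
    being done. *)
Lemma hh_inv_stuck t D P : (forall v u, ~~ hh_choice P D v u) -> hh_inv t D P ->
  hh_inv t.+1 D P.
Proof.
move=> no [PH dP eP real]; split => // rz; have [[F [PF FH dF]] sum] := real rz.
split; first by exists F.
left; apply/eqP; rewrite sum_nat_eq0; apply/forall_inP => a0 _.
apply/negPn/negP => Da0; rewrite -lt0n in Da0.
case: (@arg_minnP _ a0 (fun a => 0 < D a) (fun a => nat_of_ord a) Da0) => v Dv vmin.
have rE z : deg F z = deg P z + D z by rewrite dF dP.
have [u0 cu0] := hh_candidate_exists cH PF FH rE Dv.
case: (@arg_maxnP _ u0 (fun u => hh_candidate H P D v u) D cu0) => u cu umax.
case/negP: (no v u); rewrite /hh_choice Dv cu /=; apply/andP; split; apply/forallP => a.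
  by have [Da|Da] := posnP (D a); [rewrite Da orbT|rewrite vmin].
by have [ca|//] := boolP (hh_candidate H P D v a); apply: (umax a ca).
Qed.

(** Realizable degrees are at most [N], so their sum is at most [N * N], and every round that is not
    idle lowers the residual sum by 2. *)
Lemma hh_inv_end t D P : N * N <= t -> hh_inv t D P -> realizable -> forall a, D a = 0.
Proof.
move=> Nt [_ dP _ real] rz a; have [[F [_ FH dF]] sum] := real rz.
have sD : \sum_a D a = 0.
  case: sum => // le; have : \sum_a y a <= N * N.
    apply: (@leq_trans (\sum_(b : 'I_N) N)); last by rewrite sum_nat_const card_ord.
    apply: leq_sum => b _.
    rewrite -dF deg_nbrs; first by rewrite -[X in _ <= X]card_ord; apply: max_card.
    by move=> e /(subsetP FH); apply: cH.
  by move: le Nt; have := ltn_ord a; nia.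
by move/eqP: sD; rewrite sum_nat_eq0 => /forallP/(_ a)/eqP.
Qed.

End HavelHakimiLoop.

(** * Cuts and their differences *)

Section Cuts.
Variables (V : finType) (G : sgraph V).
Implicit Types (A B : {set V}) (C X : {set {set V}}) (e : {set V}).

Definition delta A := edges_between G A (~: A).

Lemma in_delta A x y : [set x; y] \in edges G ->
  ([set x; y] \in delta A) = ((x \in A) != (y \in A)).
Proof.
move=> xyE; rewrite inE xyE /=; apply/existsP/idP => [[a /andP[aA /existsP[b /andP[]]]]|].
  rewrite inE => bA /eqP E.
  have [xE yE] : x \in [set a; b] /\ y \in [set a; b] by rewrite -E !inE !eqxx orbT.
  have : x != y by apply: contraTneq xyE => ->; apply/negP => /card_edge; rewrite setUid cards1.
  move: xE yE; rewrite !inE => /orP[]/eqP -> /orP[]/eqP ->; rewrite ?eqxx //.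
    by rewrite aA (negbTE bA).
  by rewrite aA (negbTE bA).
have [xA|xA] := boolP (x \in A); have [yA|yA] := boolP (y \in A) => // _.
  by exists x; rewrite xA; apply/existsP; exists y; rewrite inE yA eqxx.
by exists y; rewrite yA; apply/existsP; exists x; rewrite inE xA setUC eqxx.
Qed.

Lemma delta_sub A : delta A \subset edges G.
Proof. by apply/subsetP => e; rewrite inE => /andP[]. Qed.

Lemma cutsP C : reflect (exists A, [/\ A != set0, ~: A != set0 & C = delta A]) (C \in cuts G).
Proof.
rewrite inE; apply: (iffP existsP) => [[A /existsP[B /and5P[/eqP AB dis A0 B0 /eqP ->]]]|].
  have BE : B = ~: A.
    apply/setP => x; rewrite inE; have := in_setT x; rewrite -AB inE.
    have [xA _|_ /= ->] := boolP (x \in A); last by [].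
    by rewrite (disjointFr dis).
  by exists A; split=> //; rewrite /delta -?BE.
case=> A [A0 B0 ->]; exists A; apply/existsP; exists (~: A).
by rewrite setUCr eqxx A0 B0 eqxx -setI_eq0 setICr eqxx.
Qed.

Lemma cuts_sub C : C \in cuts G -> C \subset edges G.
Proof. by case/cutsP => A [_ _ ->]; apply: delta_sub. Qed.

Lemma edgeP e : e \in edges G -> exists x y, x != y /\ e = [set x; y].
Proof. by move/card_edge/eqP/cards2P. Qed.

(** An edge crosses the symmetric difference iff it crosses exactly one of the two sets: boundaries
    are linear over the field with two elements. *)
Lemma delta_sdiff A B : delta (sdiff A B) = sdiff (delta A) (delta B).
Proof.
apply/setP => e; have [eE|eE] := boolP (e \in edges G); last first.
  rewrite /delta /sdiff 2!inE (negbTE eE) /=; apply/esym/negbTE.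
  by rewrite !inE (negbTE eE) !andbF.
have [x [y [xy eq_e]]] := edgeP eE; rewrite eq_e in eE *.
rewrite in_delta // [RHS]inE ![_ \in _ :\: _]inE !in_delta // !inE.
by case: (x \in A); case: (y \in A); case: (x \in B); case: (y \in B).
Qed.

(** Containing a cut means that deleting [X] disconnects the graph, which a reachability computation
    can test. *)
Definition sep X := [exists C in cuts G, C \subset X].

Lemma sepP X : reflect (exists2 C, C \in cuts G & C \subset X) (sep X).
Proof. exact: exists_inP. Qed.

Lemma mincutsP C : reflect (C \in cuts G /\ forall D, D \in cuts G -> #|C| <= #|D|)
  (C \in mincuts G).
Proof.
rewrite [C \in mincuts G]inE; apply: (iffP andP) => -[CC h]; split=> //; first by move/forall_inP: h.
by apply/forall_inP.
Qed.

Lemma cuts_exist : 1 < #|V| -> exists C, C \in cuts G.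
Proof.
case/card_gt1P => x [y [_ _ xy]]; exists (delta [set x]); apply/cutsP; exists [set x].
split => //; apply/set0Pn; [exists x|exists y]; rewrite !inE ?eqxx //.
by rewrite eq_sym.
Qed.

(** With two vertices there is a cut, and the default value of the minimum is at least its size; so
    the default never makes [lambda] smaller than all cuts. *)
Lemma lambda_le_cut m : 1 < #|V| -> lambda G <= m -> exists2 C, C \in cuts G & #|C| <= m.
Proof.
move=> /cuts_exist[C0 C0c] lm.
have [/exists_inP[C Cc Cm]|] := boolP [exists C in cuts G, #|C| <= m]; first by exists C.
rewrite negb_exists_in => /forall_inP no.
have : m < lambda G.
  rewrite /lambda; elim/big_ind: _ => [|x y mx my|C Cc].
  - apply: leq_trans (subset_leq_card (cuts_sub C0c)).
    by rewrite ltnNge no.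
  - by rewrite leq_min mx.
  - by rewrite ltnNge no.
by rewrite ltnNge lm.
Qed.

(** The symmetric difference contains the edge [e1], and a boundary containing an edge has two
    nonempty sides, so it is a genuine cut. *)
Lemma cuts_card2 e1 e2 e3 : [set e1; e2] \in cuts G -> [set e2; e3] \in cuts G ->
  e1 != e2 -> e2 != e3 -> e1 != e3 -> [set e1; e3] \in cuts G.
Proof.
move=> /cutsP[A [A0 A1 eA]] /cutsP[B [B0 B1 eB]] n12 n23 n13.
have E : [set e1; e3] = delta (sdiff A B).
  rewrite delta_sdiff -eA -eB; apply/setP => e; rewrite !inE.
  case: (e =P e1) => [->|_]; first by rewrite (negbTE n12) (negbTE n13).
  case: (e =P e2) => [->|_] /=; first by rewrite (negbTE n23).
  by case: (e == e3).
apply/cutsP; exists (sdiff A B); split => //.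
  apply/negP => /eqP s0; have : e1 \in [set e1; e3] by rewrite !inE eqxx.
  by rewrite E s0 !inE => /andP[_ /existsP[x]]; rewrite !inE.
apply/negP => /eqP s0; have : e1 \in [set e1; e3] by rewrite !inE eqxx.
rewrite E /delta s0 !inE => /andP[_ /existsP[x /andP[_ /existsP[y]]]].
by rewrite !inE.
Qed.

Variables (R : realType) (w : {set V} -> R).

(** An unordered pair with different values corresponds to one ordered pair [(i, j)] with [b i] true
    and [b j] false, and such ordered pairs form a product. *)
Lemma count_pairs k (b : 'I_k -> bool) :
  (\sum_(i < k) \sum_(j < k | (i < j)%N) (b i != b j)%:R =
   (\sum_(i < k) b i)%:R * (k%:R - (\sum_(i < k) b i)%:R) :> R)%R.
Proof.
pose B i : R := (b i)%:R%R.
have BE : (\sum_(i < k) b i)%:R%R = (\sum_(i < k) B i)%R by rewrite natr_sum.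
have kE : (k%:R = \sum_(i < k) (1 : R))%R by rewrite sumr_const card_ord.
rewrite BE kE -sumrB big_distrl /=.
transitivity (\sum_(i < k) \sum_(j < k) B i * (1 - B j))%R; last first.
  by apply: eq_bigr => i _; rewrite big_distrr.
transitivity (\sum_(i < k) (\sum_(j < k | (i < j)%N) B i * (1 - B j) +
   \sum_(j < k | (j < i)%N) B i * (1 - B j)))%R.
  rewrite big_split /= [X in (_ + X)%R](exchange_big_dep xpredT) //= -big_split /=.
  apply: eq_bigr => i _; rewrite -big_split /=; apply: eq_bigr => j _.
  by rewrite /B; case: (b i); case: (b j);
    rewrite ?subrr ?subr0 ?mulr0 ?mul0r ?mulr1 ?addr0 ?add0r.
apply: eq_bigr => i _; rewrite [RHS](bigID (fun j : 'I_k => i < j)) /=; congr (_ + _)%R.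
rewrite [RHS](bigD1 i) ?ltnn //=.
have -> : (B i * (1 - B i) = 0)%R by rewrite /B; case: (b i); rewrite ?subrr ?mul0r ?mulr0.
by rewrite add0r; apply: eq_bigl => j; rewrite -leqNgt ltn_neqAle andbC.
Qed.

Definition mult k (Cs : k.-tuple {set {set V}}) e := \sum_(i < k) (e \in tnth Cs i).

Lemma dsumE k (Cs : k.-tuple {set {set V}}) : (forall i, tnth Cs i \subset edges G) ->
  (dsum w Cs = \sum_(e in edges G) w e * ((mult Cs e)%:R * (k%:R - (mult Cs e)%:R)))%R.
Proof.
move=> sub; rewrite /dsum.
transitivity (\sum_(i < k) \sum_(j < k | (i < j)%N) \sum_(e in edges G)
   w e * ((e \in tnth Cs i) != (e \in tnth Cs j))%:R)%R.
  apply: eq_bigr => i _; apply: eq_bigr => j _; rewrite /weight.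
  rewrite (big_mkcond (mem (symdiff _ _))) [RHS]big_mkcond; apply: eq_bigr => e _ /=.
  rewrite !inE; have [eE|eE] := boolP (e \in edges G); last first.
    by rewrite !(contraNF (subsetP (sub _) e) eE).
  by case: (e \in tnth Cs i); case: (e \in tnth Cs j); rewrite /= ?mulr1 ?mulr0.
transitivity (\sum_(e in edges G) \sum_(i < k) \sum_(j < k | (i < j)%N)
   w e * ((e \in tnth Cs i) != (e \in tnth Cs j))%:R)%R.
  rewrite [RHS]exchange_big /=; apply: eq_bigr => i _.
  by rewrite [RHS]exchange_big.
apply: eq_bigr => e _; rewrite -count_pairs big_distrr /=.
by apply: eq_bigr => i _; rewrite big_distrr.
Qed.

End Cuts.

(** * Minimum cuts as pairs of edge codes *)

Section Codes.
Variables (n : nat) (G : sgraph 'I_n).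
Notation U := 'I_(n ^ 2).
Implicit Types (a b c : nat) (p q : {set U}).

(** A number [a = i * n + j] below [n ^ 2] is the code of the edge [{i, j}] if
    [i < j] and this is an edge; the other codes are dummies. *)
Definition edge_of a : {set 'I_n} :=
  [set v : 'I_n | (v == a %/ n :> nat) || (v == a %% n :> nat)].

Definition real a := (a %/ n < a %% n) && (edge_of a \in edges G).

Definition swapc a := a %% n * n + a %/ n.

Lemma code_gt0 a : a < n ^ 2 -> 0 < n.
Proof. by case: n => //; rewrite exp0n. Qed.

Lemma div_ltn a : a < n ^ 2 -> a %/ n < n.
Proof. by move=> aN; rewrite ltn_divLR ?mulnn // (code_gt0 aN). Qed.

Lemma mod_ltn a : a < n ^ 2 -> a %% n < n.
Proof. by move=> aN; rewrite ltn_mod (code_gt0 aN). Qed.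

Lemma code_div (i j : 'I_n) : (i * n + j) %/ n = i.
Proof. by rewrite divnMDl ?divn_small ?addn0 // (leq_ltn_trans _ (ltn_ord i)). Qed.

Lemma code_mod (i j : 'I_n) : (i * n + j) %% n = j.
Proof. by rewrite modnMDl modn_small. Qed.

Lemma code_lt (i j : 'I_n) : i * n + j < n ^ 2.
Proof. by have := ltn_ord i; have := ltn_ord j; rewrite -mulnn; nia. Qed.

Lemma codeP a : a < n ^ 2 -> exists i j : 'I_n, a = i * n + j.
Proof.
move=> aN; exists (Ordinal (div_ltn aN)), (Ordinal (mod_ltn aN)).
exact: divn_eq.
Qed.

Lemma edge_ofE (i j : 'I_n) : edge_of (i * n + j) = [set i; j].
Proof. by apply/setP => v; rewrite !inE code_div code_mod. Qed.

Lemma real_codeE (i j : 'I_n) : real (i * n + j) = (i < j) && ([set i; j] \in edges G).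
Proof. by rewrite /real code_div code_mod edge_ofE. Qed.

Lemma real_edge a : real a -> edge_of a \in edges G.
Proof. by case/andP. Qed.

Lemma edge_code e : e \in edges G -> exists a : U, real a /\ edge_of a = e.
Proof.
move=> eE; have [x [y [xy E]]] := edgeP eE.
have [lt|] := ltnP x y.
  by exists (Ordinal (code_lt x y)); rewrite real_codeE lt /= edge_ofE -E.
rewrite leq_eqVlt val_eqE eq_sym (negbTE xy) /= => lt.
by exists (Ordinal (code_lt y x)); rewrite real_codeE lt /= edge_ofE setUC -E.
Qed.

Lemma edge_of_inj a b : a < n ^ 2 -> b < n ^ 2 -> real a -> real b ->
  edge_of a = edge_of b -> a = b.
Proof.
move=> /codeP[i [j ->]] /codeP[i' [j' ->]]; rewrite !real_codeE !edge_ofE.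
move=> /andP[ij _] /andP[ij' _] E.
have : i \in [set i'; j'] by rewrite -E !inE eqxx.
have : j \in [set i'; j'] by rewrite -E !inE eqxx orbT.
rewrite !inE => /orP[]/eqP ej /orP[]/eqP ei; subst i j; rewrite ?ltnn // in ij *.
by rewrite ltnNge ltnW in ij.
Qed.

Lemma swap_div a : a < n ^ 2 -> swapc a %/ n = a %% n.
Proof. by case/codeP => i [j ->]; rewrite /swapc code_div code_mod code_div. Qed.

Lemma swap_mod a : a < n ^ 2 -> swapc a %% n = a %/ n.
Proof. by case/codeP => i [j ->]; rewrite /swapc code_div code_mod code_mod. Qed.

Lemma swap_lt a : a < n ^ 2 -> swapc a < n ^ 2.
Proof. by case/codeP => i [j ->]; rewrite /swapc code_div code_mod code_lt. Qed.

Lemma swapK a : a < n ^ 2 -> swapc (swapc a) = a.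
Proof. by move=> aN; rewrite {1}/swapc swap_div // swap_mod // -divn_eq. Qed.

Lemma swap_unreal a : a < n ^ 2 -> real a -> real (swapc a) = false.
Proof.
move=> aN /andP[lt _]; rewrite /real swap_div // swap_mod //.
by rewrite ltnNge (ltnW lt).
Qed.

Definition cut_of p : {set {set 'I_n}} := [set edge_of a | a : U in [set a : U in p | real a]].

Lemma in_cut_of p (a : U) : real a -> (edge_of a \in cut_of p) = (a \in p).
Proof.
move=> ra; apply/imsetP/idP => [[b]|ap]; last by exists a; rewrite // inE ap.
rewrite inE => /andP[bp rb] /(edge_of_inj (ltn_ord a) (ltn_ord b) ra rb) E.
by rewrite (val_inj E).
Qed.

Lemma cut_of_sub p : cut_of p \subset edges G.
Proof. by apply/subsetP => e /imsetP[a]; rewrite inE => /andP[_ /real_edge] ? ->. Qed.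

Definition sepc (a b : U) := sep G (cut_of [set a; b]).

Definition disconnected := sep G set0.
Definition has_bridge := [exists c : U, real c && sepc c c].

(** Pairs of codes standing for the minimum cuts: a bridge is paired with the
    code of the reversed edge, and the empty cut is the pair of loops
    [(0, 0)], [(1, 1)], which have the codes 0 and [n + 1]. *)
Definition cut_pair (a b : U) := (a != b) &&
  if disconnected then
    (a == 0 :> nat) && (b == n.+1 :> nat) || (b == 0 :> nat) && (a == n.+1 :> nat)
  else if has_bridge then
    (b == swapc a :> nat) && (real a && sepc a a || real b && sepc b b)
  else [&& real a, real b & sepc a b].

Definition pairs := [set [set z.1; z.2] | z in [set z : U * U | cut_pair z.1 z.2]].

Lemma cut_pair_sym (a b : U) : cut_pair a b = cut_pair b a.
Proof.
rewrite /cut_pair eq_sym; congr (_ && _); case: ifP => _; first by rewrite orbC.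
case: ifP => _; last by rewrite /sepc setUC andbCA.
rewrite [_ && _ || _]orbC; congr (_ && _).
by apply/eqP/eqP => ->; rewrite swapK.
Qed.

Lemma pairsP p : reflect (exists2 z : U * U, cut_pair z.1 z.2 & p = [set z.1; z.2]) (p \in pairs).
Proof.
by apply: (iffP imsetP) => -[z]; rewrite ?inE => h E; exists z; rewrite ?inE.
Qed.

Lemma cut_pair_neq (a b : U) : cut_pair a b -> a != b.
Proof. by case/andP. Qed.

Lemma mem_pairs (a b : U) : ([set a; b] \in pairs) = cut_pair a b.
Proof.
apply/pairsP/idP => [[[c d] /= Tcd E]|Tab]; last by exists (a, b).
have cd := cut_pair_neq Tcd.
have [ca da] : c \in [set a; b] /\ d \in [set a; b] by rewrite E !inE !eqxx orbT.
move: ca da; rewrite !inE => /orP[]/eqP ec /orP[]/eqP ed; subst c d; rewrite ?eqxx // in cd.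
by rewrite cut_pair_sym.
Qed.

Lemma card_pairs p : p \in pairs -> #|p| = 2.
Proof. by case/pairsP => -[a b] /= /cut_pair_neq ab ->; rewrite cards2 ab. Qed.

Lemma cut_nonempty C : ~~ disconnected -> C \in cuts G -> C != set0.
Proof. by move=> nd CC; apply: contraNneq nd => C0; apply/sepP; exists C; rewrite // C0. Qed.

Lemma cut_not_single C e : ~~ disconnected -> ~~ has_bridge -> C \in cuts G -> C != [set e].
Proof.
move=> nd nb CC; apply: contraNneq nb => C1.
have eE : e \in edges G by rewrite (subsetP (cuts_sub CC)) // C1 set11.
have [a [ra ae]] := edge_code eE; apply/existsP; exists a; rewrite ra /=.
apply/sepP; exists C => //; apply/subsetP => f; rewrite C1 inE => /eqP ->.
by rewrite -ae in_cut_of // !inE eqxx.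
Qed.

Lemma cut_of_pair_real (a b : U) : real a -> real b ->
  cut_of [set a; b] = [set edge_of a; edge_of b].
Proof.
move=> ra rb; apply/setP => e; rewrite !inE; apply/imsetP/orP => [[c]|[]/eqP ->].
- by rewrite !inE => /andP[/orP[]/eqP -> _] ->; rewrite eqxx; [left|right].
- by exists a; rewrite // !inE eqxx ra.
- by exists b; rewrite // !inE eqxx orbT rb.
Qed.

Lemma cut_of_pair_swap (a b : U) : real a -> real b = false ->
  cut_of [set a; b] = [set edge_of a].
Proof.
move=> ra rb; apply/setP => e; rewrite !inE; apply/imsetP/eqP => [[c]|->].
- by rewrite !inE => /andP[/orP[]/eqP -> rc] -> //; rewrite rb in rc.
- by exists a; rewrite // !inE eqxx ra.
Qed.

Lemma cut_of_unreal p : (forall a : U, a \in p -> real a = false) -> cut_of p = set0.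
Proof.
move=> h; apply/setP => e; rewrite !inE; apply/negP => /imsetP[a].
by rewrite inE => /andP[/h ->].
Qed.

Lemma unreal0 : real 0 = false.
Proof. by rewrite /real div0n mod0n. Qed.

Lemma unreal_n1 : 0 < n -> real n.+1 = false.
Proof.
move=> n0; rewrite /real; suff -> : (n.+1 %/ n < n.+1 %% n) = false by [].
move: n0; case: n => [|[|m]] // _.
have -> : m.+3 = m.+2 + 1 by rewrite addn1.
by rewrite divnDl ?dvdnn // modnDl divnn !modn_small // divn_small.
Qed.

Lemma sepc_single (a : U) : ~~ disconnected -> real a -> sepc a a = ([set edge_of a] \in cuts G).
Proof.
move=> nd ra; rewrite /sepc cut_of_pair_real // setUid; apply/sepP/idP.
  case=> C CC; rewrite subset1 (negbTE (cut_nonempty nd CC)) orbF => /eqP <- //.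
by exists [set edge_of a].
Qed.

(** In the absence of cuts with at most one edge, a cut contained in a set of two edges is the whole
    set. Hence the reachability test recognizes the cut exactly. *)
Lemma sepc_pair (a b : U) : ~~ disconnected -> ~~ has_bridge -> real a -> real b -> a != b ->
  sepc a b = ([set edge_of a; edge_of b] \in cuts G).
Proof.
move=> nd nb ra rb ab; rewrite /sepc cut_of_pair_real //; apply/sepP/idP; last first.
  by exists [set edge_of a; edge_of b].
case=> C CC sub; suff <- : C = [set edge_of a; edge_of b] by [].
apply/eqP; rewrite eqEsubset sub /=; apply/subsetP => e; rewrite !inE.
have key x y : C \subset [set x; y] -> x \in C.
  move=> sub'; apply/negPn/negP => xC.
  have : C \subset [set y].
    apply/subsetP => z zC; have := subsetP sub' z zC; rewrite !inE.
    by case: (z =P x) => // zx; rewrite zx (negbTE xC) in zC.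
  rewrite subset1 (negbTE (cut_nonempty nd CC)) orbF.
  by rewrite (negbTE (cut_not_single _ nd nb CC)).
case/orP => /eqP ->; first exact: key sub.
by apply: (key _ (edge_of a)); rewrite setUC.
Qed.

(** With an empty cut or a bridge the pairs form a matching, and the hypotheses contradict each
    other; only cuts with two edges need an argument. *)
Lemma cut_pair_trans (a b c : U) : a != c -> cut_pair a b -> cut_pair b c -> cut_pair a c.
Proof.
move=> ac; rewrite /cut_pair ac /= => /andP[ab Tab] /andP[bc Tbc]; move: Tab Tbc.
have aN := ltn_ord a; have bN := ltn_ord b; have cN := ltn_ord c.
case: ifP => [_|/negbT nd].
  move=> h1 h2; case/negP: ac; rewrite -val_eqE /=; move: h1 h2; clear; lia.
case: ifP => [_|/negbT nb].
  move=> /andP[/eqP eb _] /andP[/eqP ec _]; case/negP: ac.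
  by rewrite -val_eqE /= ec eb swapK.
move=> /and3P[ra rb s1] /and3P[_ rc s2]; rewrite ra rc /=.
have ne (x y : U) : real x -> real y -> x != y -> edge_of x != edge_of y.
  move=> rx ry; apply: contraNneq => /(edge_of_inj (ltn_ord x) (ltn_ord y) rx ry) E.
  exact/eqP/val_inj.
rewrite sepc_pair // in s1; rewrite sepc_pair // in s2; rewrite sepc_pair //.
by apply: cuts_card2 s1 s2 _ _ _; apply: ne.
Qed.

Lemma cut_of_real_eq p q (a : U) : cut_of p = cut_of q -> real a -> (a \in p) = (a \in q).
Proof. by move=> E ra; rewrite -!in_cut_of // E. Qed.

Lemma pairs_swap p : ~~ disconnected -> has_bridge -> p \in pairs ->
  exists a b : U, [/\ p = [set a; b], real a, b = swapc a :> nat & sepc a a].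
Proof.
move=> /negbTE nd hb /pairsP[[a b] /= Tab ->]; move: Tab; rewrite /cut_pair nd hb.
move=> /and3P[_ /eqP ba /orP[]/andP[r s]]; first by exists a, b.
by exists b, a; split; rewrite // 1?setUC // ba swapK.
Qed.

(** The cut forgets the dummies, but nothing is lost: there is a single pair for the empty cut, and
    the dummy paired with a bridge is its reversed code. *)
Lemma cut_of_inj : {in pairs &, injective cut_of}.
Proof.
move=> p q pP qP E.
have [d|nd] := boolP disconnected.
  have uniq_pair r : r \in pairs -> forall a : U, (a \in r) = (a == 0 :> nat) || (a == n.+1 :> nat).
    case/pairsP => -[a b] /=; rewrite /cut_pair d => /andP[_ h] -> x; rewrite !inE -!val_eqE /=.
    by move: h => /orP[]/andP[/eqP -> /eqP ->] //; rewrite orbC.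
  by apply/setP => a; rewrite !uniq_pair.
have [hb|nb] := boolP has_bridge.
  have [a [b [pE ra ba _]]] := pairs_swap nd hb pP.
  have [a' [b' [qE ra' ba' _]]] := pairs_swap nd hb qP.
  suff aa : a = a' by rewrite pE qE aa; congr [set _; _]; apply: val_inj; rewrite /= ba ba' aa.
  have : a \in q by rewrite -(cut_of_real_eq E) // pE !inE eqxx.
  rewrite qE !inE => /orP[]/eqP // ab'.
  by move: ra; rewrite ab' ba' swap_unreal.
have all_real r : r \in pairs -> forall a : U, a \in r -> real a.
  case/pairsP => -[a b] /=; rewrite /cut_pair (negbTE nd) (negbTE nb) => /and4P[_ ra rb _] -> x.
  by rewrite !inE => /orP[]/eqP ->.
apply/setP => a; have [ra|ra] := boolP (real a); first exact: cut_of_real_eq.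
have h r : r \in pairs -> (a \in r) = false by move=> rP; apply: contraNF ra; apply: all_real.
by rewrite !h.
Qed.

Lemma cut_of_mincut p : p \in pairs -> cut_of p \in mincuts G.
Proof.
move=> pP; apply/mincutsP.
have [d|nd] := boolP disconnected.
  have -> : cut_of p = set0.
    apply: cut_of_unreal => a; case/pairsP: pP => -[x y] /=; rewrite /cut_pair d => /andP[_ h] ->.
    rewrite !inE => ay; have : (a == 0 :> nat) || (a == n.+1 :> nat).
      by case/orP: h => /andP[/eqP e1 /eqP e2]; case/orP: ay => /eqP ->; rewrite ?e1 ?e2 eqxx ?orbT.
    by case/orP => /eqP ->; rewrite ?unreal0 ?unreal_n1 // (code_gt0 (ltn_ord a)).
  split=> [|D _]; last by rewrite cards0.
  by have [C CC] := sepP _ _ d; rewrite subset0 => /eqP <-.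
have [hb|nb] := boolP has_bridge.
  have [a [b [-> ra ba sa]]] := pairs_swap nd hb pP.
  rewrite cut_of_pair_swap ?ba ?swap_unreal // -sepc_single //; split=> // D DC.
  by rewrite cards1 card_gt0 cut_nonempty.
case/pairsP: pP => -[a b] /=; rewrite /cut_pair (negbTE nd) (negbTE nb) => /and4P[ab ra rb s] ->.
rewrite cut_of_pair_real // -sepc_pair //; split=> // D DC.
apply: (@leq_trans 2); first by rewrite cards2; case: (_ != _).
rewrite ltn_neqAle card_gt0 (cut_nonempty nd DC) andbT eq_sym.
by apply/negP => /cards1P[e De]; have := cut_not_single e nd nb DC; rewrite De eqxx.
Qed.

Lemma cut_of_surj C : lambda G <= 2 -> C \in mincuts G -> exists2 p, p \in pairs & cut_of p = C.
Proof.
move=> l2 /mincutsP[CC Cmin].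
(* The two sides of a cut are nonempty. With at least two vertices the dummy code [n.+1] is below
   [n ^ 2]. *)
have n2 : 1 < n.
  case/cutsP: CC => A [/set0Pn[x xA] /set0Pn[y yA] _]; rewrite -[n]card_ord.
  apply/card_gt1P; exists x, y; split => //; apply: contraTneq yA => <-; by rewrite inE xA.
have [d|nd] := boolP disconnected.
  have C0 : C = set0.
    have [D DC] := sepP _ _ d; rewrite subset0 => /eqP D0.
    by apply/eqP; rewrite -cards_eq0 -leqn0 -(cards0 {set 'I_n}) -D0 Cmin.
  have l0 : 0 < n ^ 2 by rewrite expn_gt0 (ltnW n2).
  have l1 : n.+1 < n ^ 2 by rewrite -mulnn; nia.
  exists [set Ordinal l0; Ordinal l1]; first by rewrite mem_pairs /cut_pair d /= !eqxx.
  rewrite C0; apply: cut_of_unreal => a; rewrite !inE => /orP[]/eqP -> /=.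
    exact: unreal0.
  by apply/unreal_n1/ltnW.
have [hb|nb] := boolP has_bridge.
  have /existsP[c /andP[rc sc]] := hb; rewrite sepc_single // in sc.
  have : #|C| == 1.
    by rewrite eqn_leq card_gt0 (cut_nonempty nd CC) andbT -(cards1 (edge_of c)) Cmin.
  case/cards1P => e Ce; have eE : e \in edges G.
    by rewrite (subsetP (cuts_sub CC)) // Ce set11.
  have [a [ra ae]] := edge_code eE; have aN := ltn_ord a.
  exists [set a; Ordinal (swap_lt aN)]; last by rewrite cut_of_pair_swap ?swap_unreal // ae.
  rewrite mem_pairs /cut_pair (negbTE nd) hb /= eqxx ra sepc_single // ae -Ce CC /= andbT.
  by apply/eqP => E; have := swap_unreal aN ra; rewrite -[X in real X]/(val (Ordinal (swap_lt aN))) -E ra.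
have [D DC D2] := lambda_le_cut (eq_ind_r (fun m => 1 < m) n2 (card_ord n)) l2.
have : #|C| == 2.
  rewrite eqn_leq (leq_trans (Cmin D DC) D2) ltn_neqAle card_gt0 (cut_nonempty nd CC) andbT eq_sym.
  by apply/negP => /cards1P[e Ce]; have := cut_not_single e nd nb CC; rewrite Ce eqxx.
case/cards2P => e1 [e2 [e12 Ce]].
have [a [ra ae]] : exists a : U, real a /\ edge_of a = e1.
  by apply/edge_code/(subsetP (cuts_sub CC)); rewrite Ce !inE eqxx.
have [b [rb be]] : exists a : U, real a /\ edge_of a = e2.
  by apply/edge_code/(subsetP (cuts_sub CC)); rewrite Ce !inE eqxx orbT.
have ab : a != b by apply: contraNneq e12 => E; rewrite -ae -be E.
exists [set a; b]; last by rewrite cut_of_pair_real // ae be.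
by rewrite mem_pairs /cut_pair (negbTE nd) (negbTE nb) ab ra rb sepc_pair //= ae be -Ce.
Qed.

End Codes.

(** * Diverse cuts as optimal edge sets of the auxiliary graph *)

Section Diverse.
Variables (R : realType) (n : nat) (G : sgraph 'I_n) (w : {set 'I_n} -> R).
Hypothesis w0 : forall e, e \in edges G -> (0 <= w e)%R.
Hypothesis l2 : lambda G <= 2.
Notation U := 'I_(n ^ 2).

(** Weight 0 removes the degrees of the dummies from the objective. *)
Definition code_weight (a : U) : R := if real G a then w (edge_of n a) else 0%R.

Lemma code_weight_ge0 a : (0 <= code_weight a)%R.
Proof. by rewrite /code_weight; case: ifP => // /real_edge; apply: w0. Qed.

Lemma card_mincuts : #|mincuts G| = #|pairs G|.
Proof.
rewrite -(card_in_imset (@cut_of_inj _ G)); apply: eq_card => C; apply/idP/imsetP.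
  by case/(cut_of_surj l2) => p pP <-; exists p.
by case=> p pP ->; apply: cut_of_mincut.
Qed.

Lemma sum_edges (f : {set 'I_n} -> R) :
  (\sum_(e in edges G) f e = \sum_(a : U | real G a) f (edge_of n a))%R.
Proof.
have inj : {in [set a : U | real G a] &, injective (fun a : U => edge_of n a)}.
  move=> a b; rewrite !inE => ra rb /(edge_of_inj (ltn_ord a) (ltn_ord b) ra rb) E.
  exact: val_inj.
have -> : edges G = [set edge_of n a | a : U in [set a : U | real G a]].
  apply/setP => e; apply/idP/imsetP => [/edge_code[a [ra <-]]|[a]].
    by exists a; rewrite // inE.
  by rewrite inE => /real_edge ? ->.
by rewrite big_imset //=; apply: eq_bigl => a; rewrite inE.
Qed.

Variable k : nat.

(** The number of chosen cuts containing an edge is the degree of its code in [F], because [cut_of]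
    is injective on [F]. *)
Lemma dsum_val (F : {set {set U}}) (Cs : k.-tuple {set {set 'I_n}}) :
  F \subset pairs G -> uniq Cs -> (forall C, (C \in Cs) = (C \in [set cut_of G p | p in F])) ->
  dsum w Cs = fval code_weight k F.
Proof.
move=> FP uCs CsE; rewrite (@dsumE _ G); last first.
  move=> i; have := mem_tnth i Cs; rewrite CsE => /imsetP[p _ ->].
  exact: cut_of_sub.
rewrite sum_edges /fval /fval_of [RHS](bigID (fun a : U => real G a)) /= [X in (_ + X)%R]big1; last first.
  by move=> a /negbTE ra; rewrite /code_weight ra mul0r.
rewrite addr0; apply: eq_bigr => a ra; rewrite /code_weight ra.
suff -> : mult Cs (edge_of n a) = deg F a by [].
rewrite /mult -(big_tuple _ _ Cs xpredT (fun C : {set {set 'I_n}} => nat_of_bool (edge_of n a \in C))).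
rewrite (big_uniq _ uCs) /=.
have -> : \sum_(C in Cs) (edge_of n a \in C) =
  \sum_(C in [set cut_of G p | p in F]) (edge_of n a \in C) by apply: eq_bigl => C; rewrite CsE.
rewrite big_imset /=; last by move=> p q /(subsetP FP) pP /(subsetP FP) qP; apply: cut_of_inj.
by apply: eq_bigr => p _; rewrite in_cut_of.
Qed.

Lemma diverse_of_optimal (F : {set {set U}}) (Cs : k.-tuple {set {set 'I_n}}) :
  optimal code_weight k (pairs G) k F -> uniq Cs ->
  (forall C, (C \in Cs) = (C \in [set cut_of G p | p in F])) -> diverse_mincuts G w Cs.
Proof.
move=> /optimalP[FP Fk Fmax] uCs CsE; split.
  split => // C; rewrite CsE => /imsetP[p pF ->].
  by apply/cut_of_mincut/(subsetP FP).
move=> Ds [uDs sDs]; pose F' := [set p in pairs G | cut_of G p \in Ds].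
have F'P : F' \subset pairs G by apply/subsetP => p; rewrite inE => /andP[].
have DsE C : (C \in Ds) = (C \in [set cut_of G p | p in F']).
  apply/idP/imsetP => [CD|[p]]; last by rewrite inE => /andP[_ pD] ->.
  have [p pP pC] := cut_of_surj l2 (sDs _ CD).
  by exists p; rewrite // inE pP pC.
rewrite (dsum_val FP uCs CsE) (dsum_val F'P uDs DsE); apply: Fmax => //.
have -> : #|F'| = #|[set cut_of G p | p in F']|.
  rewrite card_in_imset // => p q /(subsetP F'P) pP /(subsetP F'P) qP.
  exact: cut_of_inj.
rewrite -(eq_card DsE) -[RHS](size_tuple Ds); exact/card_uniqP.
Qed.

End Diverse.

(** * Evaluating program fragments *)

(** Tuples of indices are packed into one number in base [n]: [EMk] packs, [EQuo] and [ERem] unpack.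
    The exponent [c] bounds the leading part by [n ^ c], and [d] is the number of digits of the
    trailing part. *)
Definition EPow c := XSum c 0 (XC 1).
Definition EQuo c x d := XDiv c x (EPow d).
Definition ERem c x d := XSub x (XMul c (EQuo c x d) (EPow d)).
Definition EMk c a d b := XAdd (XMul c a (EPow d)) b.

Definition EBool e := XIf e (XC 1) (XC 0).
Definition ENot e := XIf e (XC 0) (XC 1).
Definition EAnd a b := XIf a b (XC 0).
Definition EOr a b := XIf a (XC 1) b.
Definition EEq a b := EAnd (XLe a b) (XLe b a).
Definition ELt a b := XLe (XAdd a (XC 1)) b.
Definition EAll c x e := ENot (XSum c x (ENot e)).
(** The least [x] below [n ^ c] satisfying [e], or [n ^ c]; [y] must not occur in [e]. *)
Definition EFind c x y e := XSum c y (EAll c x (EOr (ELt (XV y) (XV x)) (ENot e))).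

Definition EReal e := EAnd (ELt (EQuo 1 e 1) (ERem 1 e 1)) (XI e).
Definition ESwap e := EMk 1 (ERem 1 e 1) 1 (EQuo 1 e 1).
Definition EFst z := EQuo 2 z 2.
Definition ESnd z := ERem 2 z 2.
Definition EPair a b := EMk 2 a 2 b.
Definition EEdge u v := XIf (ELt u v) (EMk 1 u 1 v) (EMk 1 v 1 u).
Definition EAdj c u v := EAnd (EReal (EEdge u v))
  (EAnd (ENot (EEq (EEdge u v) (EFst c))) (ENot (EEq (EEdge u v) (ESnd c)))).

(** [AR] at [c * n + v]: vertex [v] is reachable from vertex 0 once the two
    edges coded by the pair [c] are deleted. *)
Definition reach_step :=
  let c := EQuo 4 (XV 1) 1 in let v := ERem 4 (XV 1) 1 in
  Tab AR 5 1 (EOr (EEq v (XC 0))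
    (XSum 1 2 (EAnd (XA AR (EMk 4 c 1 (XV 2))) (EAdj c (XV 2) v)))).

(** The argument is evaluated under the binder and must not mention variable 3. The numbers of bound
    variables are chosen throughout so that nested fragments do not capture each other's
    variables. *)
Definition EDisc c := XSum 1 3 (ENot (XA AR (EMk 4 c 1 (XV 3)))).

(** The pair 0 consists of the dummy 0 twice, so [EDisc (XC 0)] deletes no edge and tests
    connectedness. A pair of equal codes deletes a single edge and tests for a bridge. *)
Definition ET a b := EAnd (ENot (EEq a b))
  (XIf (EDisc (XC 0))
    (EOr (EAnd (EEq a (XC 0)) (EEq b (XAdd XN (XC 1))))
         (EAnd (EEq b (XC 0)) (EEq a (XAdd XN (XC 1)))))
  (XIf (XSum 2 4 (EAnd (EReal (XV 4)) (EDisc (EPair (XV 4) (XV 4)))))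
    (EAnd (EEq b (ESwap a))
      (EOr (EAnd (EReal a) (EDisc (EPair a a))) (EAnd (EReal b) (EDisc (EPair b b)))))
    (EAnd (EReal a) (EAnd (EReal b) (EDisc (EPair a b)))))).

Definition tab_T := Tab AT 4 1 (EBool (ET (EFst (XV 1)) (ESnd (XV 1)))).

Lemma pow_gt0 n c d x : x < n ^ (c + d) -> 0 < n ^ d.
Proof.
rewrite expn_gt0; case: posnP => //= ->; case: d => //= d.
by rewrite addnS exp0n.
Qed.

(** * Values of the fragments, and reachability after deleting edges *)

Section Eval.
Variables (R : realType) (n : nat) (G : sgraph 'I_n) (w : {set 'I_n} -> R) (k : nat).
Notation low := (low_of G w k).
Notation wl := (rmem (input_state G w k)).
Notation ev := (nx_eval n k (Bn n) low).
Notation U := 'I_(n ^ 2).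
Implicit Types (m : nat -> nat -> nat) (o : nat -> R) (e a b x y z c u v : nx).

Definition tr m o e := ev m o e != 0.

Lemma tr_not m o e : tr m o (ENot e) = ~~ tr m o e.
Proof. by rewrite /tr /=; case: (ev m o e). Qed.

Lemma tr_if m o a b c : tr m o (XIf a b c) = if tr m o a then tr m o b else tr m o c.
Proof. by rewrite /tr /=; case: (ev m o a). Qed.

Lemma tr_and m o a b : tr m o (EAnd a b) = tr m o a && tr m o b.
Proof. by rewrite tr_if; case: (tr m o a). Qed.

Lemma tr_or m o a b : tr m o (EOr a b) = tr m o a || tr m o b.
Proof. by rewrite tr_if; case: (tr m o a). Qed.

Lemma tr_bool m o e : tr m o (EBool e) = tr m o e.
Proof. by rewrite tr_if; case: (tr m o e). Qed.

Lemma ev_bool m o e : ev m o (EBool e) = tr m o e.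
Proof. by rewrite /tr /=; case: (ev m o e). Qed.

Lemma tr_le m o a b : tr m o (XLe a b) = (ev m o a <= ev m o b).
Proof. by rewrite /tr /=; case: (_ <= _). Qed.

Lemma tr_lt m o a b : tr m o (ELt a b) = (ev m o a < ev m o b).
Proof. by rewrite tr_le /= addn1. Qed.

Lemma tr_eq m o a b : tr m o (EEq a b) = (ev m o a == ev m o b).
Proof. by rewrite tr_and !tr_le eqn_leq. Qed.

Lemma tr_obj m o a b : tr m o (XObj a b) = (o (ev m o a) <= o (ev m o b))%R.
Proof. by rewrite /tr /=; case: (_ <= _)%R. Qed.

Lemma tr_arr m o q e : tr m o (XA q e) = (m (cls q) (ev m o e) != 0).
Proof. by []. Qed.

Lemma tr_ex m o (c x : nat) e : tr m o (XSum c x e) = [exists i : 'I_(n ^ c), tr (upd m 1 x i) o e].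
Proof.
rewrite /tr /= sum_nat_eq0 negb_forall; apply: eq_existsb => i.
by rewrite negb_imply.
Qed.

Lemma tr_all m o (c x : nat) e : tr m o (EAll c x e) = [forall i : 'I_(n ^ c), tr (upd m 1 x i) o e].
Proof.
rewrite tr_not tr_ex negb_exists; apply: eq_forallb => i.
by rewrite tr_not negbK.
Qed.

Definition trE := (tr_not, tr_if, tr_and, tr_or, tr_bool, tr_le, tr_lt, tr_eq, tr_obj, tr_arr).

(** The expression counts the [j] for which [P] fails at all indices up to [j]. These [j] form an
    initial segment, whose length is the least index satisfying [P]. *)
Lemma ev_find m o (c x y : nat) e (P : nat -> bool) :
  (forall i j, i < n ^ c -> tr (upd (upd m 1 y j) 1 x i) o e = P i) -> x != y ->
  forall r, r = ev m o (EFind c x y e) ->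
  [/\ r <= n ^ c, r < n ^ c -> P r & forall i, i < n ^ c -> P i -> r < n ^ c].
Proof.
move=> hP xy r rE0; have rE : ev m o (EFind c x y e) = \sum_(j < n ^ c) [forall i : 'I_(n ^ c), (j < i) || ~~ P i].
  rewrite /=; apply: eq_bigr => j _.
  have := tr_all (upd m 1 y j) o c x (EOr (ELt (XV y) (XV x)) (ENot e)).
  rewrite /tr => E.
  have -> : [forall i : 'I_(n ^ c), (j < i) || ~~ P i] =
    (ev (upd m 1 y j) o (EAll c x (EOr (ELt (XV y) (XV x)) (ENot e))) != 0).
    rewrite E; apply: eq_forallb => i; rewrite -[_ != 0]/(tr _ _ _) !trE hP //.
    congr (_ || _); rewrite /= upd_same upd_neq ?upd_same //.
    by rewrite eq_sym xy orbT.
  by rewrite /=; case: (_ != 0).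
rewrite -rE0 in rE.
have [/existsP[i0 Pi0]|/existsPn no] := boolP [exists i : 'I_(n ^ c), P i]; last first.
  have re : r = n ^ c.
    rewrite rE (eq_bigr (fun _ => 1)) ?sum_nat_const ?card_ord ?muln1 // => j _.
    suff -> : [forall i : 'I_(n ^ c), (j < i) || ~~ P i] by [].
    by apply/forallP => i; rewrite no orbT.
  rewrite re ltnn; split => // i ic Pi; by case/negP: (no (Ordinal ic)).
case: (@arg_minnP _ i0 (fun i : 'I_(n ^ c) => P i) (fun i => nat_of_ord i) Pi0) => i Pi imin.
have -> : r = i.
  rewrite rE (eq_bigr (fun j : 'I_(n ^ c) => nat_of_bool (j < i))).
    have := ltn_ord i; move: (nat_of_ord i) => i' ii.
    rewrite -(subnKC (ltnW ii)) big_split_ord /= [X in _ + X]big1 ?addn0; last first.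
      by move=> j _; rewrite ltnNge leq_addr.
    by rewrite (eq_bigr (fun _ => 1)) ?sum_nat_const ?card_ord ?muln1 // => j _; rewrite ltn_ord.
  move=> j _; congr nat_of_bool; apply/forallP/idP => [/(_ i)|ji i']; first by rewrite Pi orbF.
  have [Pi'|] := boolP (P i'); last by rewrite orbT.
  by rewrite orbF; apply: leq_trans ji (imin _ Pi').
by split; [exact/ltnW/ltn_ord| |move=> *; apply: ltn_ord].
Qed.

Lemma ev_pow m o (c : nat) : ev m o (EPow c) = n ^ c.
Proof. by rewrite /= sum_nat_const card_ord muln1. Qed.

Lemma sum_ltn M q : \sum_(i < M) (i < q) = minn M q.
Proof.
elim: M => [|M IH]; first by rewrite big_ord0 min0n.
rewrite big_ord_recr /= IH; case: (ltnP M q) => h; lia.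
Qed.

Lemma ev_quo m o (c : nat) x (d : nat) : ev m o x < n ^ (c + d) -> ev m o (EQuo c x d) = ev m o x %/ n ^ d.
Proof.
move=> xl; have nd := pow_gt0 xl.
have -> : ev m o (EQuo c x d) = \sum_(i < n ^ c) (i.+1 * ev m o (EPow d) <= ev m o x) by [].
rewrite ev_pow (eq_bigr (fun i : 'I_(n ^ c) => nat_of_bool (i < ev m o x %/ n ^ d))).
  rewrite sum_ltn; apply/minn_idPr.
  by apply: ltnW; rewrite ltn_divLR // -expnD.
by move=> i _; rewrite leq_divRL.
Qed.

Lemma quo_lt (c d x : nat) : x < n ^ (c + d) -> x %/ n ^ d < n ^ c.
Proof.
by move=> xl; rewrite ltn_divLR -?expnD // (pow_gt0 xl).
Qed.

Lemma ev_mk m o (c : nat) a (d : nat) b : ev m o a <= n ^ c ->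
  ev m o (EMk c a d b) = ev m o a * n ^ d + ev m o b.
Proof.
move=> ac; have -> : ev m o (EMk c a d b) =
  minn (ev m o a) (n ^ c) * ev m o (EPow d) + ev m o b by [].
by rewrite ev_pow (minn_idPl ac).
Qed.

Lemma ev_rem m o (c : nat) x (d : nat) : ev m o x < n ^ (c + d) -> ev m o (ERem c x d) = ev m o x %% n ^ d.
Proof.
move=> xl; have -> : ev m o (ERem c x d) =
  ev m o x - minn (ev m o (EQuo c x d)) (n ^ c) * ev m o (EPow d) by [].
rewrite ev_pow ev_quo // (minn_idPl (ltnW (quo_lt xl))).
by rewrite {1}(divn_eq (ev m o x) (n ^ d)) addKn.
Qed.

Lemma rem_lt (c d x : nat) : x < n ^ (c + d) -> x %% n ^ d < n ^ d.
Proof.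
by move=> xl; rewrite ltn_mod (pow_gt0 xl).
Qed.

Lemma mk_lt (c d a b : nat) : a < n ^ c -> b < n ^ d -> a * n ^ d + b < n ^ (c + d).
Proof. by move=> ac bd; rewrite expnD; nia. Qed.

Lemma mk_quo (d a b : nat) : b < n ^ d -> (a * n ^ d + b) %/ n ^ d = a.
Proof. by move=> bd; rewrite divnMDl ?divn_small ?addn0 // (leq_ltn_trans _ bd). Qed.

Lemma mk_rem (d a b : nat) : b < n ^ d -> (a * n ^ d + b) %% n ^ d = b.
Proof. by move=> bd; rewrite modnMDl modn_small. Qed.

Lemma ev_quo1 m o x : ev m o x < n ^ 2 -> ev m o (EQuo 1 x 1) = ev m o x %/ n.
Proof. by move=> xl; rewrite ev_quo // expn1. Qed.

Lemma ev_rem1 m o x : ev m o x < n ^ 2 -> ev m o (ERem 1 x 1) = ev m o x %% n.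
Proof. by move=> xl; rewrite ev_rem // expn1. Qed.

Lemma tr_real m o e : ev m o e < n ^ 2 -> tr m o (EReal e) = real G (ev m o e).
Proof.
move=> el; rewrite !trE ev_quo1 // ev_rem1 //.
have -> : tr m o (XI e) = (inp (Bn n) low (ev m o e) != 0) by [].
case/codeP: el => i [j ->]; rewrite code_div code_mod real_codeE.
case: ltnP => //= ij; rewrite inp_adj //.
by case: (_ \in _).
Qed.

Lemma ev_swap m o e : ev m o e < n ^ 2 -> ev m o (ESwap e) = swapc n (ev m o e).
Proof.
move=> el; rewrite ev_mk ev_rem1 // ?ev_quo1 // expn1 //.
exact/ltnW/mod_ltn.
Qed.

Lemma ev_fst m o z : ev m o z < n ^ 4 -> ev m o (EFst z) = ev m o z %/ n ^ 2.
Proof. exact: (@ev_quo m o 2 z 2). Qed.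

Lemma ev_snd m o z : ev m o z < n ^ 4 -> ev m o (ESnd z) = ev m o z %% n ^ 2.
Proof. exact: (@ev_rem m o 2 z 2). Qed.

Lemma ev_pair m o a b : ev m o a < n ^ 2 -> ev m o (EPair a b) = ev m o a * n ^ 2 + ev m o b.
Proof. by move=> al; rewrite ev_mk // ltnW. Qed.

Definition fstU (z : 'I_(n ^ 4)) : U := Ordinal (@quo_lt 2 2 z (ltn_ord z)).
Definition sndU (z : 'I_(n ^ 4)) : U := Ordinal (@rem_lt 2 2 z (ltn_ord z)).
Definition pairU (a b : U) : 'I_(n ^ 4) := Ordinal (@mk_lt 2 2 a b (ltn_ord a) (ltn_ord b)).

Lemma fst_pair (a b : U) : fstU (pairU a b) = a.
Proof. by apply: val_inj; rewrite /= mk_quo. Qed.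

Lemma snd_pair (a b : U) : sndU (pairU a b) = b.
Proof. by apply: val_inj; rewrite /= mk_rem. Qed.

Lemma pairK (z : 'I_(n ^ 4)) : pairU (fstU z) (sndU z) = z.
Proof. by apply: val_inj; rewrite /= -divn_eq. Qed.

Definition ecode (i j : 'I_n) := if i < j then i * n + j else j * n + i.

Lemma ev_edge m o u v (i j : 'I_n) : ev m o u = i -> ev m o v = j ->
  ev m o (EEdge u v) = ecode i j.
Proof.
move=> ui vj; have -> : ev m o (EEdge u v) =
  if tr m o (ELt u v) then ev m o (EMk 1 u 1 v) else ev m o (EMk 1 v 1 u) by [].
rewrite tr_lt ui vj /ecode !ev_mk ?ui ?vj ?expn1 //; exact: ltnW.
Qed.

Lemma ecode_lt i j : ecode i j < n ^ 2.
Proof. by rewrite /ecode; case: ifP => _; apply: code_lt. Qed.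

Lemma ecode_edge i j : edge_of n (ecode i j) = [set i; j].
Proof. by rewrite /ecode; case: ifP => _; rewrite edge_ofE // setUC. Qed.

Lemma ecode_real i j : real G (ecode i j) = ([set i; j] \in edges G).
Proof.
rewrite /ecode; case: ltnP => ij; rewrite real_codeE ?ij //.
have [->|ne] := eqVneq i j; first by rewrite ltnn (not_edge_diag G).
by rewrite ltn_neqAle ij eq_sym val_eqE ne setUC.
Qed.

Lemma tr_adj m o c u v (z : 'I_(n ^ 4)) (i j : 'I_n) : ev m o c = z -> ev m o u = i -> ev m o v = j ->
  tr m o (EAdj c u v) = ([set i; j] \in edges G :\: cut_of G [set fstU z; sndU z]).
Proof.
move=> cz ui vj; rewrite tr_and tr_real ?(ev_edge ui vj) ?ecode_lt // tr_and !tr_not !tr_eq ?(ev_edge ui vj).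
rewrite ev_fst ?cz // ev_snd ?cz // ecode_real in_setD [RHS]andbC.
have [e|] := boolP (_ \in edges G); last by [].
have := @in_cut_of _ G [set fstU z; sndU z] (Ordinal (ecode_lt i j)).
rewrite /= ecode_real e ecode_edge => -> //.
by rewrite !inE -!val_eqE negb_or.
Qed.

Definition reach_op (X : {set {set 'I_n}}) (S : {set 'I_n}) : {set 'I_n} :=
  [set v : 'I_n | (v == 0 :> nat) ||
     [exists u : 'I_n, (u \in S) && ([set u; v] \in edges G :\: X)]].

Lemma reach_op_mono X : {homo reach_op X : S S' / S \subset S'}.
Proof.
move=> S S' SS'; apply/subsetP => v; rewrite !inE => /orP[->//|/existsP[u /andP[uS uv]]].
by apply/orP; right; apply/existsP; exists u; rewrite (subsetP SS').
Qed.

Lemma sep_reach X : 0 < n -> sep G X = [exists v : 'I_n, v \notin iter n (reach_op X) set0].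
Proof.
move=> n0; set S := iter n _ _.
have fixS : reach_op X S = S.
  by have := fixsetK (@reach_op_mono X); rewrite /fixset card_ord.
apply/sepP/existsP => [[C /cutsP[A [/set0Pn[x xA] /set0Pn[y yA] ->]] sub]|[v vS]].
  pose A' := if Ordinal n0 \in A then A else ~: A.
  have dA' : delta G A' \subset X.
    apply: subset_trans sub; rewrite /A'; case: ifP => // _.
    apply/subsetP => e eD; have eE := subsetP (delta_sub G _) e eD.
    have [a [b [_ E]]] := edgeP eE; rewrite E in eD eE *; move: eD.
    by rewrite !in_delta // !inE; case: (a \in A); case: (b \in A).
  have SA' : S \subset A'.
    suff sub_iter t : iter t (reach_op X) set0 \subset A' by exact: sub_iter.
    elim: t => [|t IH] /=; first exact: sub0set.
    apply/subsetP => v; rewrite inE => /orP[v0|/existsP[u /andP[/(subsetP IH) uA]]].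
      have -> : v = Ordinal n0 by apply/val_inj/eqP.
      by rewrite /A'; case: ifP => // /negbT; rewrite inE.
    rewrite inE => /andP[uvX uvE]; apply: contraNT uvX => vA.
    by apply/(subsetP dA'); rewrite in_delta // uA (negbTE vA).
  have [z zA] : exists z : 'I_n, z \notin A'.
    rewrite /A'; case: ifP => _; last by exists x; rewrite inE negbK.
    by exists y; rewrite inE in yA.
  by exists z; apply: contraNN zA => /(subsetP SA').
exists (delta G S).
  apply/cutsP; exists S; split => //; last by apply/set0Pn; exists v; rewrite inE.
  by apply/set0Pn; exists (Ordinal n0); rewrite -fixS inE eqxx.
apply/subsetP => e eD; have eE := subsetP (delta_sub G _) e eD.
have [a [b [_ E]]] := edgeP eE; rewrite E in eD eE *.
apply/negPn/negP => eX; move: eD; rewrite in_delta //.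
have step (x y : 'I_n) : [set x; y] \in edges G -> [set x; y] \notin X -> x \in S -> y \in S.
  move=> xyE xyX xS; rewrite -fixS inE; apply/orP; right; apply/existsP; exists x.
  by rewrite xS inE xyE xyX.
have [aS|aS] := boolP (a \in S); have [bS|bS] := boolP (b \in S) => // _.
  by rewrite (step a b) in bS.
by rewrite (step b a) // setUC in aS.
Qed.

Notation runp := (run n k (Bn n) low wl).

Lemma tr_reach m o (c : 'I_(n ^ 4)) (v : 'I_n) (S : {set 'I_n}) :
  (forall u : 'I_n, (m (cls AR) (c * n + u) != 0) = (u \in S)) ->
  tr (upd m 1 1 (c * n + v)) o
    (EOr (EEq (ERem 4 (XV 1) 1) (XC 0))
    (XSum 1 2 (EAnd (XA AR (EMk 4 (EQuo 4 (XV 1) 1) 1 (XV 2))) (EAdj (EQuo 4 (XV 1) 1) (XV 2) (ERem 4 (XV 1) 1)))))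
  = (v \in reach_op (cut_of G [set fstU c; sndU c]) S).
Proof.
move=> hS; have vn : v < n ^ 1 by rewrite expn1.
have xl : c * n + v < n ^ (4 + 1) by have := mk_lt (ltn_ord c) vn; rewrite expn1.
have evc i : ev (upd (upd m 1 1 (c * n + v)) 1 2 i) o (EQuo 4 (XV 1) 1) = c.
  by rewrite ev_quo //=; have := mk_quo c vn; rewrite expn1.
have evv m' : m' 1 1 = c * n + v -> ev m' o (ERem 4 (XV 1) 1) = v.
  by move=> E; rewrite ev_rem /= E //; have := mk_rem c vn; rewrite expn1.
rewrite tr_or tr_eq evv // tr_ex inE; congr (_ || _).
have -> : n ^ 1 = n by rewrite expn1.
apply: eq_existsb => u; rewrite tr_and; congr (_ && _).
  by rewrite tr_arr ev_mk evc ?expn1 /= ?hS // ltnW.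
by rewrite (@tr_adj _ _ _ _ _ c u v) ?evc ?evv.
Qed.

Lemma run_tab_same q (c x : nat) e s i : i < n ^ c ->
  (runp (Tab q c x e) s).1 (cls q) i = ev (upd s.1 1 x i) (s.2 1) e.
Proof. by move=> ic; rewrite /= eqxx ic. Qed.

Lemma run_tab_other q (c x : nat) e s q' i : q' != cls q ->
  (runp (Tab q c x e) s).1 q' i = s.1 q' i.
Proof. by move=> /negbTE qq; rewrite /= qq. Qed.

Lemma reachP (s : (nat -> nat -> nat) * (nat -> nat -> R)) : (forall i, s.1 (cls AR) i = 0) ->
  let s' := runp (Rep 1 reach_step) s in
  [/\ forall (c : 'I_(n ^ 4)) (v : 'I_n), (s'.1 (cls AR) (c * n + v) != 0) =
        (v \in iter n (reach_op (cut_of G [set fstU c; sndU c])) set0)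
    & forall q i, q != cls AR -> s'.1 q i = s.1 q i].
Proof.
move=> s0; have -> : runp (Rep 1 reach_step) s = iter n (runp reach_step) s.
  by transitivity (iter (n ^ 1) (runp reach_step) s); last rewrite expn1.
suff H t : let s' := iter t (runp reach_step) s in
  [/\ forall (c : 'I_(n ^ 4)) (v : 'I_n), (s'.1 (cls AR) (c * n + v) != 0) =
        (v \in iter t (reach_op (cut_of G [set fstU c; sndU c])) set0)
    & forall q i, q != cls AR -> s'.1 q i = s.1 q i] by exact: H.
elim: t => [|t [IH1 IH2]]; first by split => // c v; rewrite s0 inE.
rewrite iterS; set s' := iter t _ s in IH1 IH2 *.
split=> [c v|q i q2]; last first.
  by rewrite -(IH2 _ i q2) run_tab_other.
rewrite run_tab_same; first exact: tr_reach (IH1 c).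
by have := @mk_lt 4 1 c v (ltn_ord c); rewrite expn1 => /(_ (ltn_ord v)).
Qed.

End Eval.

(** * Realizing degree sequences *)

(** [AD] at [c * n ^ 2 + a] is the residual degree of [a], and [AP] at
    [c * n ^ 4 + z] the adjacency of the pair [z], in the construction that
    realizes the degrees of [AF] increased at both members of the pair [c]. *)
Definition ED c a := XA AD (EMk 4 c 2 a).
Definition EP c z := XA AP (EMk 4 c 4 z).

(** The increments are two separate summands because the members of [c] may be equal; such a code
    gains 2. *)
Definition EY c a := XAdd (XSum 2 7 (EBool (XA AF (EPair a (XV 7)))))
  (XAdd (EBool (EEq a (EFst c))) (EBool (EEq a (ESnd c)))).

Definition ECand c v u := EAnd (XA AT (EPair v u))
  (EAnd (ENot (EP c (EPair v u))) (ELt (XC 0) (ED c u))).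

Definition EChoice c z := EAnd (ELt (XC 0) (ED c (EFst z)))
  (EAnd (ECand c (EFst z) (ESnd z))
  (EAnd (EAll 2 6 (EOr (XLe (EFst z) (XV 6)) (XLe (ED c (XV 6)) (XC 0))))
        (EAll 2 6 (EOr (ENot (ECand c (EFst z) (XV 6))) (XLe (ED c (XV 6)) (ED c (ESnd z))))))).

(** The value [n ^ 4], which is no pair, signals that no choice exists; the next two statements then
    leave the candidate unchanged. *)
Definition hh_find := Tab AS 4 1 (EFind 4 2 3 (EChoice (XV 1) (XV 2))).

Definition hh_residual :=
  let S := XA AS (EQuo 4 (XV 1) 2) in let a := ERem 4 (XV 1) 2 in
  Tab AD 6 1 (XSub (XA AD (XV 1))
    (EBool (EAnd (ELt S (EPow 4)) (EOr (EEq a (EFst S)) (EEq a (ESnd S)))))).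

Definition hh_connect :=
  let S := XA AS (EQuo 4 (XV 1) 4) in let z := ERem 4 (XV 1) 4 in
  Tab AP 8 1 (EOr (XA AP (XV 1))
    (EAnd (ELt S (EPow 4)) (EOr (EEq z S) (EEq z (EPair (ESnd S) (EFst S)))))).

Definition hh_step := SSeq hh_find (SSeq hh_residual hh_connect).

Definition init_residual := Tab AD 6 1 (EY (EQuo 4 (XV 1) 2) (ERem 4 (XV 1) 2)).
Definition init_connect := Tab AP 8 1 (XC 0).
Definition tab_ok := Tab AOk 4 1 (ENot (XSum 2 5 (ED (XV 1) (XV 5)))).

(** There are [n ^ 2] codes, so the square [n ^ 4] of their number is enough rounds. *)
Definition havel_hakimi :=
  SSeq init_residual (SSeq init_connect (SSeq (Rep 4 hh_step) tab_ok)).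

(** * Correctness of the parallel Havel-Hakimi construction *)

Section Eval.
Variables (R : realType) (n : nat) (G : sgraph 'I_n) (w : {set 'I_n} -> R) (k : nat).
Notation low := (low_of G w k).
Notation wl := (rmem (input_state G w k)).
Notation ev := (nx_eval n k (Bn n) low).
Notation trm := (@tr R n G w k).
Notation runp := (run n k (Bn n) low wl).
Notation U := 'I_(n ^ 2).
Notation state := ((nat -> nat -> nat) * (nat -> nat -> R))%type.
Implicit Types (m : nat -> nat -> nat) (o : nat -> R).
Implicit Types (F P : {set {set U}}).

Definition reach_table m := forall (c : 'I_(n ^ 4)) (v : 'I_n),
  (m (cls AR) (c * n + v) != 0) =
  (v \in iter n (reach_op G (cut_of G [set fstU c; sndU c])) set0).

Lemma tr_disc m o c (z : 'I_(n ^ 4)) : reach_table m ->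
  (forall i, ev (upd m 1 3 i) o c = z) ->
  trm m o (EDisc c) = sepc G (fstU z) (sndU z).
Proof.
move=> HR cz; have n0 : 0 < n by have := @pow_gt0 n 3 1 z (ltn_ord z); rewrite expn1.
rewrite /EDisc tr_ex /sepc (sep_reach G _ n0) expn1; apply: eq_existsb => i.
rewrite tr_not tr_arr ev_mk ?cz; last exact: ltnW.
by rewrite expn1 HR.
Qed.

Lemma ev_fstU m o x (z : 'I_(n ^ 4)) : ev m o x = z -> ev m o (EFst x) = fstU z.
Proof. by move=> E; rewrite ev_fst E. Qed.

Lemma ev_sndU m o x (z : 'I_(n ^ 4)) : ev m o x = z -> ev m o (ESnd x) = sndU z.
Proof. by move=> E; rewrite ev_snd E. Qed.

Lemma ev_pairU m o a b (a' b' : U) : ev m o a = a' -> ev m o b = b' ->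
  ev m o (EPair a b) = pairU a' b'.
Proof. by move=> E1 E2; rewrite ev_pair E1 ?E2. Qed.

Lemma tr_T m o (z : 'I_(n ^ 4)) : reach_table m -> m 1 1 = z ->
  trm m o (ET (EFst (XV 1)) (ESnd (XV 1))) = cut_pair G (fstU z) (sndU z).
Proof.
move=> HR m11.
have ea m' : m' 1 1 = z -> ev m' o (EFst (XV 1)) = fstU z by move=> h; apply: ev_fstU.
have eb m' : m' 1 1 = z -> ev m' o (ESnd (XV 1)) = sndU z by move=> h; apply: ev_sndU.
have N4 : 0 < n ^ 4 by exact: leq_ltn_trans (ltn_ord z).
have disc0 : trm m o (EDisc (XC 0)) = disconnected G.
  rewrite (@tr_disc _ _ _ (Ordinal N4)) //; congr (sep G _); apply: cut_of_unreal => a.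
  by rewrite !inE => /orP[]/eqP -> /=; rewrite ?div0n ?mod0n unreal0.
have disc2 m' e1 e2 (a b : U) : reach_table m' -> (forall i, ev (upd m' 1 3 i) o e1 = a) ->
    (forall i, ev (upd m' 1 3 i) o e2 = b) -> trm m' o (EDisc (EPair e1 e2)) = sepc G a b.
  move=> HR' h1 h2; rewrite (@tr_disc _ _ _ (pairU a b)) ?fst_pair ?snd_pair //.
  by move=> i; apply: ev_pairU.
rewrite /ET tr_and tr_not tr_eq ea // eb // tr_if disc0 /cut_pair -val_eqE; congr (_ && _).
case: ifP => _.
  by rewrite tr_or tr_and !tr_eq tr_and !tr_eq ea // eb //= addn1.
rewrite tr_if.
have -> : trm m o (XSum 2 4 (EAnd (EReal (XV 4)) (EDisc (EPair (XV 4) (XV 4))))) = has_bridge G.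
  rewrite tr_ex; apply: eq_existsb => a.
  have E : ev (upd m 1 4 a) o (XV 4) = a by rewrite /= upd_same.
  by rewrite tr_and (disc2 _ _ _ a a) // tr_real E.
case: ifP => _.
  rewrite tr_and tr_eq ev_swap ea // eb //; congr (_ && _).
  rewrite tr_or tr_and tr_real ea // (disc2 _ _ _ (fstU z) (fstU z)) //; try (by move=> i; apply: ea).
  by rewrite tr_and tr_real eb // (disc2 _ _ _ (sndU z) (sndU z)) // => i; apply: eb.
rewrite tr_and tr_real ea // tr_and tr_real eb // (disc2 _ _ _ (fstU z) (sndU z)) // => i.
  exact: ea.
exact: eb.
Qed.

Definition cut_pair_table m := forall z : 'I_(n ^ 4), m (cls AT) z = cut_pair G (fstU z) (sndU z).

Lemma tab_TP (s : state) : reach_table s.1 ->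
  let s' := runp tab_T s in
  cut_pair_table s'.1 /\ forall q i, q != cls AT -> s'.1 q i = s.1 q i.
Proof.
move=> HR; split=> [z|q i qT]; last exact: run_tab_other.
by rewrite run_tab_same // ev_bool (@tr_T _ _ z) //= upd_same.
Qed.

Definition edge_table m q off F := forall z : 'I_(n ^ 4),
  (m (cls q) (off + z) != 0) = ([set fstU z; sndU z] \in F).

Lemma edge_table_pair m q off F (a b : U) : edge_table m q off F ->
  (m (cls q) (off + pairU a b) != 0) = ([set a; b] \in F).
Proof. by move=> h; rewrite h fst_pair snd_pair. Qed.

Definition new_deg F (c : 'I_(n ^ 4)) (a : U) := deg F a + (a == fstU c) + (a == sndU c).

Lemma ev_y m o c a (c' : 'I_(n ^ 4)) (a' : U) F : edge_table m AF 0 F -> F \subset pairs G ->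
  (forall m', (forall i, i != 7 -> m' 1 i = m 1 i) -> ev m' o c = c') ->
  (forall m', (forall i, i != 7 -> m' 1 i = m 1 i) -> ev m' o a = a') ->
  ev m o (EY c a) = new_deg F c' a'.
Proof.
move=> rF FP hc ha.
have -> : ev m o (EY c a) = \sum_(i < n ^ 2) ev (upd m 1 7 i) o (EBool (XA AF (EPair a (XV 7)))) +
  (ev m o (EBool (EEq a (EFst c))) + ev m o (EBool (EEq a (ESnd c)))) by [].
rewrite !ev_bool !tr_eq (ev_fstU (hc m _)) // (ev_sndU (hc m _)) // ha // addnA !val_eqE.
congr (_ + _ + _); rewrite deg_nbrs; last by move=> e /(subsetP FP); apply: card_pairs.
rewrite -sum1_card [RHS]big_mkcond; apply: eq_bigr => b _.
have E : ev (upd m 1 7 b) o (EPair a (XV 7)) = pairU a' b.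
  by apply: ev_pairU => //; apply: ha => i i7; rewrite upd_neq // i7 orbT.
rewrite ev_bool tr_arr E upd_neq //; have := edge_table_pair a' b rF; rewrite add0n => ->.
rewrite inE; case: (b =P a') => [->|_] /=; last by case: (_ \in F).
by rewrite (contraNF (subsetP FP _) (not_loop (@card_pairs _ G) a')).
Qed.

Definition resid m (c : 'I_(n ^ 4)) (a : U) := m (cls AD) (c * n ^ 2 + a).

Lemma ev_resid m o c a (c' : 'I_(n ^ 4)) (a' : U) : ev m o c = c' -> ev m o a = a' ->
  ev m o (ED c a) = resid m c' a'.
Proof.
move=> ec ea; have -> : ev m o (ED c a) = m (cls AD) (ev m o (EMk 4 c 2 a)) by [].
by rewrite ev_mk ec ?ea // ltnW.
Qed.

Lemma tr_cand m o c v u (c' : 'I_(n ^ 4)) (v' u' : U) P : cut_pair_table m -> edge_table m AP (c' * n ^ 4) P ->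
  ev m o c = c' -> ev m o v = v' -> ev m o u = u' ->
  trm m o (ECand c v u) = hh_candidate (pairs G) P (resid m c') v' u'.
Proof.
move=> TT rP ec ev' eu; rewrite /ECand tr_and tr_and tr_not tr_lt (ev_resid ec eu).
have E : ev m o (EPair v u) = pairU v' u' by exact: ev_pairU.
rewrite tr_arr E TT fst_pair snd_pair /hh_candidate mem_pairs eqb0 negbK.
congr [&& _, ~~ _ & _].
by rewrite tr_arr ev_mk ec ?E ?(edge_table_pair _ _ rP) // ltnW.
Qed.

Lemma tr_choice m o c z (c' z' : 'I_(n ^ 4)) P : cut_pair_table m -> edge_table m AP (c' * n ^ 4) P ->
  (forall m', (forall i, i != 6 -> m' 1 i = m 1 i) -> ev m' o c = c') ->
  (forall m', (forall i, i != 6 -> m' 1 i = m 1 i) -> ev m' o z = z') ->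
  trm m o (EChoice c z) = hh_choice (pairs G) P (resid m c') (fstU z') (sndU z').
Proof.
move=> TT rP hc hz; rewrite /EChoice tr_and tr_lt (ev_resid (hc m _) (ev_fstU (hz m _))) //.
have up i : forall j, j != 6 -> upd m 1 6 i 1 j = m 1 j.
  by move=> j j6; rewrite upd_neq // j6 orbT.
have hc' i := hc _ (up i); have hz' i := hz _ (up i).
rewrite tr_and (tr_cand TT rP (hc m _) (ev_fstU (hz m _)) (ev_sndU (hz m _))) //.
rewrite tr_and !tr_all /hh_choice; congr [&& _, _, _ & _]; apply: eq_forallb => a.
  rewrite tr_or !tr_le (ev_fstU (hz' a)) (ev_resid (a' := a) (hc' a)) ?upd_same //.
rewrite tr_or tr_not tr_le (ev_resid (hc' a) (ev_sndU (hz' a))) (ev_resid (a' := a) (hc' a)) ?upd_same //.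
by rewrite (@tr_cand (upd m 1 6 a) _ _ _ _ c' (fstU z') a P) //; exact: ev_fstU.
Qed.


Lemma hh_findP (s : state) (c : 'I_(n ^ 4)) P : cut_pair_table s.1 -> edge_table s.1 AP (c * n ^ 4) P ->
  let S := (runp hh_find s).1 (cls AS) c in
  (exists2 z : 'I_(n ^ 4), S = z & hh_choice (pairs G) P (resid s.1 c) (fstU z) (sndU z)) \/
  (n ^ 4 <= S /\ forall v u : U, ~~ hh_choice (pairs G) P (resid s.1 c) v u).
Proof.
move=> TT rP S; pose Q (i : nat) := [exists z : 'I_(n ^ 4), (z == i :> nat) &&
  hh_choice (pairs G) P (resid s.1 c) (fstU z) (sndU z)].
have QE (z : 'I_(n ^ 4)) : Q z = hh_choice (pairs G) P (resid s.1 c) (fstU z) (sndU z).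
  apply/existsP/idP => [[z' /andP[/eqP/val_inj ->]] //|h].
  by exists z; rewrite eqxx.
have SE : S = ev (upd s.1 1 1 c) (s.2 1) (EFind 4 2 3 (EChoice (XV 1) (XV 2))).
  by rewrite /S /hh_find run_tab_same.
have [||le hS hQ] := @ev_find R n G w k (upd s.1 1 1 c) (s.2 1) 4 2 3 (EChoice (XV 1) (XV 2)) Q _ _ S SE => //.
  move=> i j ic; pose z := Ordinal ic; rewrite -[i]/(nat_of_ord z) QE.
  apply: tr_choice => //.
    by move=> m' h; rewrite /= h //= !upd_neq // upd_same.
  by move=> m' h; rewrite /= h //= upd_same.
have [lt|ge] := ltnP S (n ^ 4); [left|right].
  by exists (Ordinal lt) => //; rewrite -QE; apply: hS.
split=> // v u; apply/negP => ch.
have := hQ (pairU v u) (ltn_ord _); rewrite QE fst_pair snd_pair => /(_ ch).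
by rewrite ltnNge ge.
Qed.

Lemma pair_lt6 (c : 'I_(n ^ 4)) (a : U) : c * n ^ 2 + a < n ^ (4 + 2).
Proof. exact: mk_lt. Qed.

Lemma pair_lt8 (c z : 'I_(n ^ 4)) : c * n ^ 4 + z < n ^ (4 + 4).
Proof. exact: mk_lt. Qed.

Lemma ev_inst2 m o (c : 'I_(n ^ 4)) (a : U) : m 1 1 = c * n ^ 2 + a ->
  ev m o (EQuo 4 (XV 1) 2) = c /\ ev m o (ERem 4 (XV 1) 2) = a.
Proof.
move=> E; have lt := pair_lt6 c a; rewrite -E in lt.
by rewrite ev_quo ?ev_rem //= E mk_quo ?mk_rem.
Qed.

Lemma ev_inst4 m o (c z : 'I_(n ^ 4)) : m 1 1 = c * n ^ 4 + z ->
  ev m o (EQuo 4 (XV 1) 4) = c /\ ev m o (ERem 4 (XV 1) 4) = z.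
Proof.
move=> E; have lt := pair_lt8 c z; rewrite -E in lt.
by rewrite ev_quo ?ev_rem //= E mk_quo ?mk_rem.
Qed.

Lemma hh_residualP (s : state) (c : 'I_(n ^ 4)) (a : U) :
  let S := s.1 (cls AS) c in
  resid (runp hh_residual s).1 c a =
  resid s.1 c a - [&& S < n ^ 4 & (a == S %/ n ^ 2 :> nat) || (a == S %% n ^ 2 :> nat)].
Proof.
move=> S; rewrite /resid /hh_residual run_tab_same; last exact: pair_lt6.
set m := upd s.1 1 1 _; have m11 : m 1 1 = c * n ^ 2 + a by rewrite /m upd_same.
have mO q i : q != 1 -> m q i = s.1 q i by move=> q1; rewrite /m upd_neq ?q1.
have [ec ea] := ev_inst2 (s.2 1) m11.
set e1 := XA AS _; set e2 := EBool _.
have -> : ev m (s.2 1) (XSub (XA AD (XV 1)) e2) = m (cls AD) (m 1 1) - ev m (s.2 1) e2 by [].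
rewrite m11 mO // ev_bool tr_and tr_lt ev_pow.
have e1E : ev m (s.2 1) e1 = S.
  by rewrite -[LHS]/(m (cls AS) (ev m (s.2 1) (EQuo 4 (XV 1) 2))) ec mO.
by rewrite e1E; case: ltnP => //= lt; rewrite tr_or !tr_eq ea ev_fst ?ev_snd e1E.
Qed.

Lemma hh_connectP (s : state) (c z : 'I_(n ^ 4)) :
  let S := s.1 (cls AS) c in
  ((runp hh_connect s).1 (cls AP) (c * n ^ 4 + z) != 0) =
  (s.1 (cls AP) (c * n ^ 4 + z) != 0) ||
  [&& S < n ^ 4 & (z == S :> nat) || (z == S %% n ^ 2 * n ^ 2 + S %/ n ^ 2 :> nat)].
Proof.
move=> S; rewrite /hh_connect run_tab_same; last exact: pair_lt8.
set m := upd s.1 1 1 _; have m11 : m 1 1 = c * n ^ 4 + z by rewrite /m upd_same.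
have mO q i : q != 1 -> m q i = s.1 q i by move=> q1; rewrite /m upd_neq ?q1.
have [ec ez] := ev_inst4 (s.2 1) m11.
set e1 := XA AS _; rewrite -[_ != 0]/(trm m (s.2 1) _) tr_or tr_arr.
rewrite -[ev _ _ (XV 1)]/(m 1 1) m11 mO // tr_and tr_lt ev_pow.
have e1E : ev m (s.2 1) e1 = S.
  by rewrite -[LHS]/(m (cls AS) (ev m (s.2 1) (EQuo 4 (XV 1) 4))) ec mO.
rewrite e1E; case: ltnP => //= lt.
have fE : ev m (s.2 1) (EFst e1) = S %/ n ^ 2 by rewrite ev_fst e1E.
have sE : ev m (s.2 1) (ESnd e1) = S %% n ^ 2 by rewrite ev_snd e1E.
rewrite tr_or !tr_eq ez e1E ev_pair sE ?fE //; exact: (@rem_lt _ 2 2).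
Qed.

Lemma set2_eq (a b c d : U) : c != d ->
  ([set a; b] == [set c; d]) = (a == c) && (b == d) || (a == d) && (b == c).
Proof.
move=> cd; apply/eqP/orP => [E|[]/andP[/eqP -> /eqP ->] //]; last by rewrite setUC.
have ca : c \in [set a; b] by rewrite E !inE eqxx.
have da : d \in [set a; b] by rewrite E !inE eqxx orbT.
move: ca da; rewrite !inE => /orP[]/eqP ca /orP[]/eqP da; subst; rewrite ?eqxx in cd *;
  by [|left|right].
Qed.

Definition hh_instances F t (s : state) := forall c : 'I_(n ^ 4), exists P,
  edge_table s.1 AP (c * n ^ 4) P /\ hh_inv (pairs G) (new_deg F c) t (resid s.1 c) P.

Lemma hh_step_other (s : state) q i : q != cls AS -> q != cls AD -> q != cls AP ->
  (runp hh_step s).1 q i = s.1 q i.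
Proof.
move=> qS qD qP.
have -> : runp hh_step s = runp hh_connect (runp hh_residual (runp hh_find s)) by [].
by rewrite /hh_connect run_tab_other // /hh_residual run_tab_other // /hh_find run_tab_other.
Qed.

Lemma hh_stepP F t (s : state) : cut_pair_table s.1 -> hh_instances F t s ->
  hh_instances F t.+1 (runp hh_step s).
Proof.
move=> TT inst c; have [P [rP inv]] := inst c.
pose s1 := runp hh_find s; pose s2 := runp hh_residual s1.
have -> : runp hh_step s = runp hh_connect s2 by [].
have AS2 : s2.1 (cls AS) c = s1.1 (cls AS) c by rewrite /s2 /hh_residual run_tab_other.
have rs1 (a : U) : resid s1.1 c a = resid s.1 c a by rewrite /resid /s1 /hh_find run_tab_other.
have rs3 (a : U) : resid (runp hh_connect s2).1 c a = resid s2.1 c a.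
  by rewrite /resid /hh_connect run_tab_other.
have ps2 (z : nat) : s2.1 (cls AP) z = s.1 (cls AP) z.
  by rewrite /s2 /hh_residual run_tab_other // /s1 /hh_find run_tab_other.
have tr' : forall a b c0 : U, a != c0 -> [set a; b] \in pairs G -> [set b; c0] \in pairs G ->
   [set a; c0] \in pairs G.
  by move=> a b c0 ac; rewrite !mem_pairs; apply: cut_pair_trans.
case: (hh_findP TT rP) => [[z0 Sz ch]|[ge no]].
  exists ([set fstU z0; sndU z0] |: P); split.
    move=> z; rewrite hh_connectP AS2 Sz ltn_ord ps2 rP in_setU1 orbC; congr (_ || _).
    rewrite set2_eq; last first.
      case/and4P: ch => _ /and3P[zH _ _] _ _; apply: contraTneq zH => ->.
      exact/not_loop/card_pairs.
    rewrite -!val_eqE /=; apply/orP/orP => [[]/eqP ->|[]/andP[/eqP e1 /eqP e2]].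
    - by left; rewrite !eqxx.
    - right; rewrite mk_quo ?mk_rem ?eqxx //; exact: (@quo_lt _ 2 2).
    - by left; rewrite (divn_eq z (n ^ 2)) e1 e2 -divn_eq.
    - by right; rewrite (divn_eq z (n ^ 2)) e1 e2.
  have -> : resid (runp hh_connect s2).1 c =
     (fun a : U => resid s.1 c a - ((a == fstU z0) || (a == sndU z0))).
    by apply/funext => a; rewrite rs3 hh_residualP rs1 Sz ltn_ord.
  by apply: (hh_inv_step (@card_pairs _ G) tr') ch inv.
exists P; split.
  by move=> z; rewrite hh_connectP ps2 rP AS2 ltnNge ge /= orbF.
have -> : resid (runp hh_connect s2).1 c = resid s.1 c.
  by apply/funext => a; rewrite rs3 hh_residualP rs1 ltnNge ge /= subn0.
exact: (hh_inv_stuck (@card_pairs _ G)) no inv.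
Qed.

Lemma hh_loopP F t (s : state) : cut_pair_table s.1 -> hh_instances F 0 s ->
  hh_instances F t (iter t (runp hh_step) s) /\
  forall q i, q != cls AS -> q != cls AD -> q != cls AP ->
    (iter t (runp hh_step) s).1 q i = s.1 q i.
Proof.
move=> TT i0; elim: t => [|t [IH1 IH2]] //; rewrite iterS; split; last first.
  by move=> q i qS qD qP; rewrite hh_step_other // IH2.
by apply: hh_stepP => // z; rewrite IH2.
Qed.

(** Accepted candidates come with an edge set realizing their degrees, and no realizable candidate
    is rejected. Both directions are needed to compare the candidates by their degrees alone. *)
Lemma havel_hakimiP F (s : state) : cut_pair_table s.1 -> edge_table s.1 AF 0 F -> F \subset pairs G ->
  let s' := runp havel_hakimi s in
  (forall c : 'I_(n ^ 4), exists P, [/\ P \subset pairs G, edge_table s'.1 AP (c * n ^ 4) P,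
     s'.1 (cls AOk) c != 0 -> forall a, deg P a = new_deg F c a
     & realizable (pairs G) (new_deg F c) -> s'.1 (cls AOk) c != 0])
  /\ forall q i, q != cls AS -> q != cls AD -> q != cls AP -> q != cls AOk ->
    s'.1 q i = s.1 q i.
Proof.
move=> TT rF FP; pose s1 := runp init_residual s; pose s2 := runp init_connect s1.
pose s3 := iter (n ^ 4) (runp hh_step) s2.
have -> : runp havel_hakimi s = runp tab_ok s3 by [].
have oth2 q i : q != cls AD -> q != cls AP -> s2.1 q i = s.1 q i.
  by move=> qD qP; rewrite /s2 /init_connect run_tab_other // /s1 /init_residual run_tab_other.
have [||inst oth3] := @hh_loopP F (n ^ 4) s2.
- by move=> z; rewrite oth2.
- move=> c; exists set0; split.
    by move=> z; rewrite /s2 /init_connect run_tab_same ?inE //; apply: pair_lt8.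
  suff -> : resid s2.1 c = new_deg F c by apply: hh_inv0.
  apply/funext => a; rewrite /resid /s2 /init_connect run_tab_other // /s1 /init_residual.
  rewrite run_tab_same; last exact: pair_lt6.
  apply: ev_y => // m' h.
    by have [] := @ev_inst2 m' (s.2 1) c a (etrans (h 1 isT) (upd_same _ _ _ _)).
  by have [] := @ev_inst2 m' (s.2 1) c a (etrans (h 1 isT) (upd_same _ _ _ _)).
split; last first.
  by move=> q i qS qD qP qO; rewrite /tab_ok run_tab_other // oth3 // oth2.
move=> c; have [P [rP inv]] := inst c; have [PH dP _ _] := inv.
have okE : ((runp tab_ok s3).1 (cls AOk) c != 0) = [forall a, resid s3.1 c a == 0].
  rewrite /tab_ok run_tab_same // -[_ != 0]/(trm _ _ _) tr_not tr_ex negb_exists.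
  apply: eq_forallb => a; rewrite /tr (@ev_resid _ _ _ _ c a) ?negbK //=.
exists P; split => //.
- by rewrite okE => /forallP r0 a; rewrite -dP (eqP (r0 a)) addn0.
move=> rz; rewrite okE; apply/forallP => a; apply/eqP.
apply: (hh_inv_end (@card_pairs _ G)) inv rz a.
by rewrite -expnD.
Qed.

End Eval.

(** * The greedy algorithm *)

(** With reals that can only be added, the weight is summed once for every [j] below [x (k - x)],
    where [x] is the new degree. For the candidates that matter, [x] is at most [n ^ 2] and [k] at
    most [n ^ 4], so [n ^ 6] terms suffice. *)
Definition rtab_obj := RTab 4 1 (RSum 2 5 (EReal (XV 5))
  (RSum 6 6 (ELt (XV 6) (XMul 2 (EY (XV 1) (XV 5)) (XSub XK (EY (XV 1) (XV 5)))))
    (RI (XV 5)))).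

Definition EBest c := EAnd (XA AOk c) (EAll 4 4 (EOr (ENot (XA AOk (XV 4))) (XObj (XV 4) c))).
Definition tab_best := Tab ABest 0 1 (EFind 4 2 3 (EBest (XV 2))).

(** The number of rounds does not depend on [k]; once [k] edges are chosen, the remaining rounds
    keep [AF]. *)
Definition tab_F := Tab AF 4 1 (XIf (ELt (XA ACnt (XC 0)) XK)
  (XA AP (EMk 4 (XA ABest (XC 0)) 4 (XV 1))) (XA AF (XV 1))).
Definition tab_cnt := Tab ACnt 0 1 (XAdd (XA ACnt (XC 0)) (XC 1)).

Definition greedy_body :=
  SSeq havel_hakimi (SSeq rtab_obj (SSeq tab_best (SSeq tab_F tab_cnt))).

Definition tab_ans := Tab AAns 0 1 (XLe XK (XSum 4 2
  (EBool (EAnd (ELt (EFst (XV 2)) (ESnd (XV 2))) (XA AT (XV 2)))))).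

Definition EPick z := EAnd (ELt (EFst z) (ESnd z)) (XA AF z).
(** The rank of a picked pair decides which block of the output its cut occupies. *)
Definition ERank z := XSum 4 3 (EBool (EAnd (ELt (XV 3) z) (EPick (XV 3)))).
Definition EOutEdge :=
  let ij := ERem 4 (XV 1) 2 in EEdge (EQuo 1 ij 1) (ERem 1 ij 1).
Definition tab_out := Tab AOut 6 1 (EBool (XSum 4 2 (EAnd (EPick (XV 2))
  (EAnd (EEq (ERank (XV 2)) (EQuo 4 (XV 1) 2))
  (EAnd (EReal EOutEdge)
        (EOr (EEq EOutEdge (EFst (XV 2))) (EEq EOutEdge (ESnd (XV 2))))))))).

Definition program := SSeq (Rep 1 reach_step) (SSeq tab_T (SSeq tab_ans
  (SSeq (Rep 4 greedy_body) tab_out))).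

Fixpoint writes c q :=
  match c with
  | Tab q' _ _ _ => q == cls q'
  | RTab _ _ _ => false
  | Rep _ b => writes b q
  | SSeq c1 c2 => writes c1 q || writes c2 q
  end.

(** * Correctness of the greedy rounds *)

Section Eval.
Variables (R : realType) (n : nat) (G : sgraph 'I_n) (w : {set 'I_n} -> R) (k : nat).
Hypothesis w0 : forall e, e \in edges G -> (0 <= w e)%R.
Notation low := (low_of G w k).
Notation wl := (rmem (input_state G w k)).
Notation ev := (nx_eval n k (Bn n) low).
Notation trm := (@tr R n G w k).
Notation runp := (run n k (Bn n) low wl).
Notation U := 'I_(n ^ 2).
Notation state := ((nat -> nat -> nat) * (nat -> nat -> R))%type.
Notation wU := (code_weight G w).
Implicit Types (m : nat -> nat -> nat) (o : nat -> R).
Implicit Types (F P : {set {set U}}) (s : state).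

Lemma run_frame c s q i : ~~ writes c q -> (runp c s).1 q i = s.1 q i.
Proof.
elim: c s => [q' d x e|d x e|d b IH|c1 IH1 c2 IH2] s /=; last 1 first.
- by rewrite negb_or => /andP[h1 h2]; rewrite IH2 // IH1.
- by move=> /negbTE ->.
- by [].
- by move=> h; elim: (n ^ d) => //= j IHj; rewrite IH.
Qed.

Lemma evA m o q e : ev m o (XA q e) = m (cls q) (ev m o e).
Proof. by []. Qed.

Lemma evV m o x : ev m o (XV x) = m 1 x.
Proof. by []. Qed.

Lemma evC m o c : ev m o (XC c) = c.
Proof. by []. Qed.

Lemma evK m o : ev m o XK = k.
Proof. by []. Qed.

Lemma sum_lt_const M q (v : R) : (\sum_(j < M | (j < q)%N) v = (minn M q)%:R * v)%R.
Proof.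
rewrite -sum_ltn natr_sum mulr_suml big_mkcond; apply: eq_bigr => j _.
by case: (_ < _); rewrite ?mul1r ?mul0r.
Qed.

Lemma winp_real (a : U) : real G a -> winp (Bn n) wl a = w (edge_of n a).
Proof.
have [i [j E]] := codeP (ltn_ord a).
by rewrite E edge_ofE real_codeE => /andP[_]; apply: winp_adj.
Qed.

Lemma rtab_objP F s (c : 'I_(n ^ 4)) : edge_table s.1 AF 0 F -> F \subset pairs G -> k <= n ^ 4 ->
  (forall a, new_deg F c a <= n ^ 2 /\ new_deg F c a <= k) ->
  (runp rtab_obj s).2 1 c = fval_of wU k (new_deg F c).
Proof.
move=> rF FP k4 bnd.
have -> : (runp rtab_obj s).2 1 c = if (c < n ^ 4) then
  (\sum_(i < n ^ 2 | trm (upd (upd s.1 1 1 c) 1 5 i) (s.2 1) (EReal (XV 5)))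
    \sum_(j < n ^ 6 | trm (upd (upd (upd s.1 1 1 c) 1 5 i) 1 6 j) (s.2 1)
        (ELt (XV 6) (XMul 2 (EY (XV 1) (XV 5)) (XSub XK (EY (XV 1) (XV 5))))))
      winp (Bn n) wl i)%R else s.2 1 c by [].
rewrite ltn_ord /fval_of [RHS](bigID (fun a : U => real G a)) /= [X in (_ + X)%R]big1; last first.
  by move=> a /negbTE ra; rewrite /code_weight ra mul0r.
have E (a : U) : ev (upd (upd s.1 1 1 c) 1 5 a) (s.2 1) (XV 5) = a by rewrite /= upd_same.
rewrite addr0; apply: eq_big => a; first by rewrite tr_real E.
rewrite tr_real E // => ra.
have [yN yk] := bnd a.
transitivity (\sum_(j < n ^ 6 | (j < new_deg F c a * (k - new_deg F c a))%N) winp (Bn n) wl a)%R.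
  apply: eq_bigl => j; rewrite tr_lt.
  pose m := upd (upd (upd s.1 1 1 c) 1 5 a) 1 6 j.
  have ey : ev m (s.2 1) (EY (XV 1) (XV 5)) = new_deg F c a.
    by apply: ev_y => // m' h; rewrite /= h.
  transitivity (m 1 6 < minn (ev m (s.2 1) (EY (XV 1) (XV 5))) (n ^ 2) *
    (k - ev m (s.2 1) (EY (XV 1) (XV 5)))); first by [].
  by rewrite ey (minn_idPl yN) /m upd_same.
rewrite sum_lt_const (minn_idPr _); last first.
  rewrite -[6]/(2 + 4) expnD; apply: leq_mul => //; exact: leq_trans (leq_subr _ _) k4.
by rewrite winp_real // /code_weight ra natrM natrB // mulrC.
Qed.

Lemma card_pairs_le : #|pairs G| <= n ^ 4.
Proof.
apply: leq_trans (leq_imset_card _ _) _; apply: leq_trans (max_card _) _.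
by rewrite card_prod card_ord -expnD.
Qed.

Lemma deg_le_card F (a : U) : deg F a <= #|F|.
Proof. by rewrite /deg -sum1_card; apply: leq_sum => e _; case: (_ \in _). Qed.

Lemma deg_le_codes F (a : U) : F \subset pairs G -> deg F a <= n ^ 2.
Proof.
move=> FP; rewrite deg_nbrs; last by move=> e /(subsetP FP); apply: card_pairs.
by rewrite -[X in _ <= X](card_ord (n ^ 2)); apply: max_card.
Qed.

Definition ok_inst (s : state) (i : nat) := s.1 (cls AOk) i != 0.

Lemma tab_bestP s : (exists c : 'I_(n ^ 4), ok_inst s c) ->
  exists b : 'I_(n ^ 4), [/\ (runp tab_best s).1 (cls ABest) 0 = b, ok_inst s b
    & forall c : 'I_(n ^ 4), ok_inst s c -> (s.2 1 c <= s.2 1 b)%R].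
Proof.
case=> c0 ok0; pose Q i := ok_inst s i &&
  [forall c : 'I_(n ^ 4), ~~ ok_inst s c || (s.2 1 c <= s.2 1 i)%R].
set r := (runp tab_best s).1 _ 0.
have rE : r = ev (upd s.1 1 1 0) (s.2 1) (EFind 4 2 3 (EBest (XV 2))).
  by rewrite /r /tab_best run_tab_same // expn0.
have [||_ hQ ex] := @ev_find R n G w k (upd s.1 1 1 0) (s.2 1) 4 2 3 (EBest (XV 2)) Q _ _ r rE => //.
  move=> i j ic; rewrite /EBest tr_and tr_arr tr_all /Q /ok_inst; congr (_ && _).
  by apply: eq_forallb => c; rewrite tr_or tr_not tr_arr tr_obj.
case: (@Order.TotalTheory.arg_maxP _ _ _ c0 (fun c : 'I_(n ^ 4) => ok_inst s c)
  (fun c => s.2 1 c) ok0) => c okc max.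
have Qc : Q c.
  rewrite /Q okc; apply/forallP => c'; have [okc'|//] := boolP (ok_inst s c').
  exact: max.
have rlt := ex c (ltn_ord c) Qc; have /andP[okr /forallP maxr] := hQ rlt.
exists (Ordinal rlt); split => // c' okc'; have := maxr c'; by rewrite okc'.
Qed.

Lemma optimal0 : optimal wU k (pairs G) 0 set0.
Proof.
apply/optimalP; split; rewrite ?sub0set ?cards0 // => F' _ /eqP.
by rewrite cards_eq0 => /eqP ->.
Qed.

Definition loop_inv t s := [/\ cut_pair_table G s.1, s.1 (cls ACnt) 0 = t &
  exists2 F, optimal wU k (pairs G) (minn t k) F & edge_table s.1 AF 0 F].

Lemma sum_delta (a0 : U) : \sum_(a : U) (a == a0) = 1.
Proof. by rewrite (bigD1 a0) //= eqxx big1 // => a /negbTE ->. Qed.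

(** The greedy step provides one realizable candidate that attains the optimum for one more edge.
    The accepted candidate of largest objective may be another one, but the edge set realizing it is
    then optimal too; it need not contain the old edges. *)
Lemma greedy_bodyP t s : k <= #|pairs G| -> loop_inv t s -> loop_inv t.+1 (runp greedy_body s).
Proof.
move=> kP [TT cnt [F optF rF]]; have /optimalP[FP Fk Fmax] := optF.
have [hh oth] := @havel_hakimiP R n G w k F s TT rF FP.
pose s1 := runp havel_hakimi s; pose s2 := runp rtab_obj s1; pose s3 := runp tab_best s2.
have -> : runp greedy_body s = runp tab_cnt (runp tab_F s3) by [].
have oth3 q i : q != cls ABest -> s3.1 q i = s1.1 q i.
  by move=> qB; rewrite /s3 /tab_best run_tab_other.
have TT' : cut_pair_table G (runp tab_cnt (runp tab_F s3)).1.
  by move=> z; rewrite /tab_cnt run_tab_other // /tab_F run_tab_other // oth3 // oth.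
have cnt3 : s3.1 (cls ACnt) 0 = t by rewrite oth3 // oth.
have FE (z : 'I_(n ^ 4)) : (runp tab_cnt (runp tab_F s3)).1 (cls AF) (0 + z) =
    if t < k then ev (upd s3.1 1 1 z) (s3.2 1) (XA AP (EMk 4 (XA ABest (XC 0)) 4 (XV 1)))
    else s.1 (cls AF) z.
  rewrite add0n /tab_cnt run_tab_other // /tab_F run_tab_same //.
  have -> : forall m o e1 e2 e3, ev m o (XIf e1 e2 e3) =
    if trm m o e1 then ev m o e2 else ev m o e3 by [].
  rewrite tr_lt.
  rewrite evA upd_neq // evC cnt3 evK; case: ifP => // _.
  by rewrite evA evV upd_same upd_neq // oth3 // oth.
split => //.
  rewrite /tab_cnt run_tab_same ?expn0 //.
  have -> : forall m o, ev m o (XAdd (XA ACnt (XC 0)) (XC 1)) = m (cls ACnt) 0 + 1 by [].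
  by rewrite upd_neq // /tab_F run_tab_other // cnt3 addn1.
have [tk|kt] := ltnP t k; last first.
  exists F; first by rewrite (minn_idPr (leqW kt)) -[k in optimal _ _ _ k](minn_idPr kt).
  by move=> z; rewrite FE ltnNge kt /= -(rF z).
rewrite (minn_idPl (ltnW tk)) in optF Fk Fmax; rewrite (minn_idPl tk).
have cH := @card_pairs _ G.
have [F1 [u [v [optF1 dF1]]]] := greedy_step (code_weight_ge0 w0) cH optF (leq_trans tk kP).
have /optimalP[F1P F1t F1max] := optF1.
have nd0 : realizable (pairs G) (new_deg F (pairU u v)).
  by exists F1 => // a; rewrite dF1 /new_deg fst_pair snd_pair.
have s2ok c : ok_inst s2 c = ok_inst s1 c by [].
(* The prescribed degrees sum to 2 more than the old ones, so any realization has one more edge. *)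
have inst_card (c : 'I_(n ^ 4)) P : P \subset pairs G ->
    (forall a, deg P a = new_deg F c a) -> #|P| = t.+1.
  move=> PP dP; have := sum_deg (fun e eP => cH e (subsetP PP e eP)).
  rewrite (eq_bigr (fun a => deg F a + (a == fstU c) + (a == sndU c))) //.
  rewrite !big_split /= !sum_delta sum_deg; last by move=> e /(subsetP FP); apply: cH.
  by rewrite Fk; clear; lia.
(* The bounds that make the loops exact come from the realizing edge set. For rejected candidates
   the computed value may be meaningless, but it is ignored. *)
have obj (c : 'I_(n ^ 4)) : ok_inst s1 c -> s2.2 1 c = fval_of wU k (new_deg F c).
  move=> okc; have [P [PP _ okP _]] := hh c.
  have dP := okP okc; have cP := inst_card c P PP dP.
  apply: rtab_objP => //.
  - by move=> z; rewrite -(rF z) oth.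
  - exact: leq_trans kP card_pairs_le.
  - move=> a; rewrite -dP deg_le_codes //; split=> //.
    by apply: leq_trans (deg_le_card _ _) _; rewrite cP.
have ok0 : ok_inst s2 (pairU u v) by have [P [_ _ _]] := hh (pairU u v); apply.
have [b [bE okb bmax]] := @tab_bestP s2 (ex_intro _ (pairU u v) ok0).
have [P [PP rP okP _]] := hh b; have dP := okP okb; have cP := inst_card b P PP dP.
exists P.
  apply/optimalP; split => // X XH Xt; apply: le_trans (F1max X XH Xt) _.
  have := bmax _ ok0; rewrite !obj //.
  have -> : fval_of wU k (new_deg F (pairU u v)) = fval wU k F1.
    by apply: eq_bigr => a _; rewrite /new_deg dF1 fst_pair snd_pair.
  suff -> : fval_of wU k (new_deg F b) = fval wU k P by [].
  by apply: eq_bigr => a _; rewrite dP.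
move=> z; rewrite FE tk -rP.
rewrite evA.
have bE' : ev (upd s3.1 1 1 z) (s3.2 1) (XA ABest (XC 0)) = b by rewrite evA evC upd_neq.
rewrite ev_mk bE' ?(ltnW (ltn_ord b)) // upd_neq // oth3 //.
Qed.

End Eval.

(** * Output *)

Lemma index_sorted (T : eqType) (lt : rel T) (s : seq T) x :
  transitive lt -> irreflexive lt -> sorted lt s -> x \in s -> index x s = count (lt^~ x) s.
Proof.
move=> tr irr; elim: s => //= y s IH ss; rewrite inE eq_sym.
have all_y := order_path_min tr ss.
case: eqP => [yx|_] /= xs; first subst x.
  rewrite irr add0n; apply/esym/eqP; rewrite -leqn0 leqNgt -has_count; apply/hasP => -[z zs].
  by move=> zx; have := allP all_y z zs => xz; have := tr _ _ _ zx xz; rewrite irr.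
by rewrite (allP all_y) // IH // (path_sorted ss).
Qed.

(** Ordinals are enumerated in increasing order, so the rank computed by the program is the position
    in the list of picked pairs. *)
Lemma index_enum_set M (A : {set 'I_M}) (z : 'I_M) : z \in A ->
  index z (enum A) = #|[set y in A | y < z]|.
Proof.
move=> zA; rewrite (@index_sorted _ (fun x y : 'I_M => x < y)).
- rewrite cardE -size_filter; congr size; rewrite /enum_mem -filter_predI.
  by apply: eq_filter => y; rewrite /= !inE andbC.
- by move=> x y t; apply: ltn_trans.
- by move=> x; apply: ltnn.
- rewrite /enum_mem; apply: sorted_filter; first by move=> x y t; apply: ltn_trans.
  by rewrite -enumT; have := iota_ltn_sorted 0 M; rewrite -val_enum_ord sorted_map.
- by rewrite mem_enum.
Qed.

Section Output.
Variables (R : realType) (n : nat) (G : sgraph 'I_n) (w : {set 'I_n} -> R) (k : nat).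
Notation low := (low_of G w k).
Notation wl := (rmem (input_state G w k)).
Notation ev := (nx_eval n k (Bn n) low).
Notation trm := (@tr R n G w k).
Notation runp := (run n k (Bn n) low wl).
Notation U := 'I_(n ^ 2).
Notation state := ((nat -> nat -> nat) * (nat -> nat -> R))%type.
Implicit Types (m : nat -> nat -> nat) (o : nat -> R).
Implicit Types (F P : {set {set U}}) (s : state).

Definition pair_of (z : 'I_(n ^ 4)) : {set U} := [set fstU z; sndU z].

(** An edge of [F] is encoded by two ordered pairs; only the increasing one is kept, so that every
    cut is output once. *)
Definition picked F := [set z : 'I_(n ^ 4) | (fstU z < sndU z) && (pair_of z \in F)].

Lemma pair_of_inj F : {in picked F &, injective pair_of}.
Proof.
move=> z z'; rewrite !inE => /andP[lt _] /andP[lt' _] /eqP.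
rewrite set2_eq; last by rewrite neq_ltn lt'.
case/orP => /andP[/eqP e1 /eqP e2]; first by rewrite -(pairK z) -(pairK z') e1 e2.
by move: lt; rewrite e1 e2 ltnNge ltnW.
Qed.

Lemma picked_image F : F \subset pairs G -> [set pair_of z | z in picked F] = F.
Proof.
move=> FP; apply/setP => e; apply/imsetP/idP => [[z]|eF].
  by rewrite inE => /andP[_ zF] ->.
have /pairsP[[a b] /= Tab E] := subsetP FP e eF; rewrite E in eF *.
case: (ltngtP a b) => [lt|lt|/val_inj ab]; last by have := cut_pair_neq Tab; rewrite ab eqxx.
  by exists (pairU a b); rewrite ?inE /pair_of fst_pair snd_pair ?lt.
by exists (pairU b a); rewrite ?inE /pair_of fst_pair snd_pair ?lt ?[[set b; a]]setUC.
Qed.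

Lemma card_picked F : F \subset pairs G -> #|picked F| = #|F|.
Proof. by move=> FP; rewrite -(card_in_imset (@pair_of_inj F)) picked_image. Qed.

Lemma tr_pick m o z (z' : 'I_(n ^ 4)) F : edge_table m AF 0 F -> ev m o z = z' ->
  trm m o (EPick z) = (z' \in picked F).
Proof.
move=> rF ez; rewrite /EPick tr_and tr_lt (ev_fstU ez) (ev_sndU ez) tr_arr ez inE.
by rewrite -(rF z').
Qed.

Lemma ev_rank m o z (z' : 'I_(n ^ 4)) F : edge_table m AF 0 F ->
  (forall i, ev (upd m 1 3 i) o z = z') ->
  ev m o (ERank z) = #|[set y in picked F | y < z']|.
Proof.
move=> rF ez; have -> : ev m o (ERank z) = \sum_(y < n ^ 4)
  ev (upd m 1 3 y) o (EBool (EAnd (ELt (XV 3) z) (EPick (XV 3)))) by [].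
rewrite -sum1_card [RHS]big_mkcond; apply: eq_bigr => y _.
have ey : ev (upd m 1 3 y) o (XV 3) = y by rewrite evV upd_same.
by rewrite ev_bool tr_and tr_lt ez ey (tr_pick (F := F) _ ey) // !inE andbC; case: (_ && _).
Qed.

Lemma tr_out_edge m o (i j : 'I_n) (z : 'I_(n ^ 4)) x : ev m o EOutEdge = ecode i j ->
  ev m o x = z ->
  trm m o (EAnd (EReal EOutEdge) (EOr (EEq EOutEdge (EFst x)) (EEq EOutEdge (ESnd x)))) =
  ([set i; j] \in cut_of G (pair_of z)).
Proof.
move=> eE ez; rewrite tr_and tr_real eE ?ecode_lt // tr_or !tr_eq eE (ev_fstU ez) (ev_sndU ez).
rewrite ecode_real; have [e|e] := boolP (_ \in edges G); last first.
  by apply/esym/negbTE; apply: contra e; apply: (subsetP (cut_of_sub _ _)).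
have := @in_cut_of _ G (pair_of z) (Ordinal (ecode_lt i j)).
by rewrite /= ecode_real e ecode_edge => -> //; rewrite !inE -!val_eqE.
Qed.

Lemma tab_outP s F (l : 'I_(n ^ 4)) (i j : 'I_n) : edge_table s.1 AF 0 F ->
  (runp tab_out s).1 (cls AOut) (l * n ^ 2 + (i * n + j)) =
  [exists z, [&& z \in picked F, #|[set y in picked F | y < z]| == l &
     [set i; j] \in cut_of G (pair_of z)]].
Proof.
move=> rF; rewrite /tab_out run_tab_same; last first.
  exact: (pair_lt6 l (Ordinal (code_lt i j))).
rewrite ev_bool tr_ex; congr nat_of_bool; apply: eq_existsb => z.
pose m := upd (upd s.1 1 1 (l * n ^ 2 + (i * n + j))) 1 2 z; rewrite -/m.
have m11 : m 1 1 = l * n ^ 2 + Ordinal (code_lt i j) by [].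
have m12 : m 1 2 = z by rewrite /m upd_same.
have [el eij] := @ev_inst2 R n G w k m (s.2 1) l _ m11.
have eE : ev m (s.2 1) EOutEdge = ecode i j.
  apply: ev_edge; first by rewrite ev_quo1 eij ?code_div // ltn_ord.
  by rewrite ev_rem1 eij ?code_mod // ltn_ord.
rewrite tr_and (tr_pick (z' := z) (F := F)) //; congr (_ && _).
rewrite tr_and tr_eq el (ev_rank (z' := z) (F := F)) //; congr (_ && _).
exact: tr_out_edge.
Qed.

Lemma tab_ansP s : cut_pair_table G s.1 -> (runp tab_ans s).1 (cls AAns) 0 = (k <= #|pairs G|).
Proof.
move=> TT; rewrite /tab_ans run_tab_same ?expn0 //.
have -> : forall m o, ev m o (XLe XK (XSum 4 2
  (EBool (EAnd (ELt (EFst (XV 2)) (ESnd (XV 2))) (XA AT (XV 2)))))) =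
  (k <= \sum_(z < n ^ 4) ev (upd m 1 2 z) o
    (EBool (EAnd (ELt (EFst (XV 2)) (ESnd (XV 2))) (XA AT (XV 2))))) by [].
congr (nat_of_bool (k <= _)); rewrite -(card_picked (subxx _)) -sum1_card [RHS]big_mkcond.
apply: eq_bigr => z _; pose m := upd (upd s.1 1 1 0) 1 2 z; rewrite -/m.
have ez : ev m (s.2 1) (XV 2) = z by rewrite /m evV upd_same.
rewrite ev_bool tr_and tr_lt (ev_fstU ez) (ev_sndU ez) tr_arr ez inE mem_pairs.
have -> : m (cls AT) z = cut_pair G (fstU z) (sndU z) by rewrite -TT.
by rewrite eqb0 negbK; case: (_ && _).
Qed.

Hypothesis w0 : forall e, e \in edges G -> (0 <= w e)%R.
Hypothesis l2 : lambda G <= 2.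

Lemma out_tuple F : optimal (code_weight G w) k (pairs G) k F ->
  exists2 Cs : k.-tuple {set {set 'I_n}}, diverse_mincuts G w Cs &
    forall (l : 'I_k) e, (e \in tnth Cs l) =
      [exists z, [&& z \in picked F, #|[set y in picked F | y < z]| == l &
        e \in cut_of G (pair_of z)]].
Proof.
move=> optF; have /optimalP[FP Fk _] := optF.
pose zs := enum (picked F).
have szs : size zs = k by rewrite -cardE card_picked.
pose Cl := [seq cut_of G (pair_of z) | z <- zs].
have sC : size Cl == k by rewrite size_map szs.
exists (Tuple sC).
  apply: (diverse_of_optimal l2 optF).
    rewrite /= map_inj_in_uniq ?enum_uniq // => z z'; rewrite !mem_enum => zp zp' E.
    have /cut_of_inj E' := E; apply: (pair_of_inj zp zp'); apply: E'; apply: (subsetP FP).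
      by move: zp; rewrite inE => /andP[].
    by move: zp'; rewrite inE => /andP[].
  move=> C; apply/mapP/imsetP => [[z]|[p]].
    rewrite mem_enum => zp ->; exists (pair_of z) => //.
    by move: zp; rewrite inE => /andP[].
  rewrite -{1}(picked_image FP) => /imsetP[z zp ->] ->.
  by exists z; rewrite ?mem_enum.
move=> l e; have lz : l < size zs by rewrite szs.
have z0 : 'I_(n ^ 4) by move: lz; rewrite /zs; case: (enum _).
rewrite (tnth_nth set0) /= (nth_map z0) //; set zl := nth z0 zs l.
have zlp : zl \in picked F by rewrite -mem_enum mem_nth.
have rank z : z \in picked F -> #|[set y in picked F | y < z]| = index z zs.
  by move=> zp; rewrite index_enum_set.
apply/idP/existsP => [ez|[z /and3P[zp /eqP rz ez]]].
  by exists zl; rewrite zlp ez rank // index_uniq ?enum_uniq ?eqxx.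
rewrite rank // in rz; suff -> : zl = z by [].
by rewrite /zl -rz nth_index // mem_enum.
Qed.

Lemma programP :
  let m := (runp program (zero_state R)).1 in
  m (cls AAns) 0 = (k <= #|mincuts G|) /\
  (k <= #|mincuts G| ->
   exists2 Cs : k.-tuple {set {set 'I_n}}, diverse_mincuts G w Cs &
     forall (l : 'I_k) (i j : 'I_n),
       (l * n + i) * n + j < n ^ 6 /\
       m (cls AOut) ((l * n + i) * n + j) = nat_of_bool ([set i; j] \in tnth Cs l)).
Proof.
rewrite (card_mincuts l2).
pose s1 := runp (Rep 1 reach_step) (zero_state R); pose s2 := runp tab_T s1.
pose s3 := runp tab_ans s2; pose s4 := runp (Rep 4 greedy_body) s3.
have -> : runp program (zero_state R) = runp tab_out s4 by [].
have [|HR oth1] := @reachP R n G w k (zero_state R); first by [].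
have [TT oth2] := @tab_TP R n G w k s1 HR.
have TT3 : cut_pair_table G s3.1 by move=> z; rewrite /s3 run_frame.
split.
  have -> : (runp tab_out s4).1 (cls AAns) 0 = s3.1 (cls AAns) 0.
    by rewrite run_frame // /s4 run_frame.
  exact: tab_ansP.
move=> kP; have inv3 : loop_inv G w k 0 s3.
  split => //; first by rewrite /s3 run_frame // oth2 // oth1.
  exists set0; first by rewrite min0n; apply: optimal0.
  by move=> z; rewrite /s3 run_frame // oth2 // oth1 // inE.
have inv t : loop_inv G w k t (iter t (runp greedy_body) s3).
  by elim: t => // t IH; rewrite iterS; apply: greedy_bodyP.
have [_ _ [F optF rF]] : loop_inv G w k (n ^ 4) s4 by exact: inv.
(* Since [k] is at most the number of pairs and hence at most [n ^ 4], the fixed number of rounds is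
   large enough to choose [k] edges. *)
rewrite (minn_idPr (leq_trans kP (card_pairs_le G))) in optF.
have [Cs div CsE] := out_tuple optF; exists Cs => // l i j.
have ln : l < n ^ 4 by apply: leq_trans (ltn_ord l) (leq_trans kP (card_pairs_le G)).
have E : (l * n + i) * n + j = Ordinal ln * n ^ 2 + (i * n + j).
  by rewrite /= mulnDl -mulnA mulnn addnA.
rewrite E; split; first exact: (pair_lt6 (Ordinal ln) (Ordinal (code_lt i j))).
by rewrite (tab_outP _ _ _ rF) CsE.
Qed.

End Output.

Theorem theorem7 (R : realType) :
  exists (p : cmd) (a b : nat),
  forall (n : nat) (G : sgraph 'I_n) (w : {set 'I_n} -> R) (k : nat),
    (forall e : {set 'I_n}, e \in edges G -> (0 <= w e)%R) ->
    lambda G <= 2 ->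
    exists (t : nat) (s : state R),
      [/\ exec p (input_state G w k) t s,
          t <= a * n.+1 ^ b
        & correct_output G w k s].
Proof.
have [p [a [b H]]] := compileP R program.
exists p, a, b => n G w k w0 l2; have [t [s [ex tle ans out]]] := H n G w k.
have [ansE correct] := programP k w0 l2.
exists t, s; split => //; rewrite ansE in ans.
have [kle|klt] := leqP k #|mincuts G|; last first.
  by left; rewrite ans leqNgt klt.
right; split; first by rewrite ans kle.
have [Cs div CsE] := correct kle; exists Cs => // l i j.
by have [lt <-] := CsE l i j; apply: out.
Qed.
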